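(* Let $\alpha:A\to A$ be an endomorphism of a unital uniform algebra $A$. Let $(X,\varphi)$ be the partial dynamical system dual to $(A,\alpha)$. Then for any $a\in A$ the spectral radius of the weighted endomorphism $a\alpha:A\to A$ is given by $$r(a\alpha)=\max_{\mu\in\mathrm{Inv}(\Delta_\infty,\varphi)}\exp\int_{\Delta_\infty}\ln|\widehat a(x)|\,d\mu=\max_{\mu\in\mathrm{Erg}(\Delta_\infty,\varphi)}\exp\int_{\Delta_\infty}\ln|\widehat a(x)|\,d\mu,$$ where $\ln(0)=-\infty$, $\exp(-\infty)=0$, and $r(a\alpha)=0$ if $\Delta_\infty=\emptyset$. For a fixed $a\in A$, the set $\Delta_\infty$ above can be replaced by the essential domain of the restricted partial map $\varphi:\{x\in\Delta:\widehat a(x)\ne0\}\to X$.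
   Context: A uniform algebra is a commutative Banach algebra $A$ such that $\|a\|=r(a)$ for every $a\in A$; equivalently, the Gelfand transform $A\ni a\mapsto\widehat a\in C(X)$ is an isometry, where $X$ is the maximal ideal space (Gelfand spectrum) of $A$, a compact Hausdorff space. For an endomorphism $\alpha$ of $A$ there is a unique continuous map $\varphi:\Delta\to X$ defined on a clopen set $\Delta\subseteq X$ such that for all $a\in A$: $\widehat{\alpha(a)}(x)=\widehat a(\varphi(x))$ for $x\in\Delta$ and $\widehat{\alpha(a)}(x)=0$ for $x\notin\Delta$; the pair $(X,\varphi)$ is the partial dynamical system dual to $(A,\alpha)$. The weighted endomorphism $a\alpha$ is the operator $b\mapsto a\,\alpha(b)$ on $A$, and $r(a\alpha)$ is its spectral radius in the algebra $\mathcal{B}(A)$ of bounded operators on $A$. For a partial map $\varphi:\Delta\to X$ (continuous, with $\Delta$ open), put $\Delta_0=X$, $\Delta_n=\varphi^{-1}(\Delta_{n-1})$ for $n>0$, $\Delta_{-n}=\varphi^n(\Delta_n)$; the essential domain is $\Delta_\infty=\bigcap_{n\in\mathbb{Z}}\Delta_n$. A normalized Radon measure $\mu$ is $\varphi$-invariant if $\mu(\varphi^{-1}(\omega))=\mu(\omega)$ for every Borel $\omega$, and $\varphi$-ergodic if, in addition, $\varphi^{-1}(\omega)=\omega$ implies $\mu(\omega)\in\{0,1\}$. $\mathrm{Inv}(\Delta_\infty,\varphi)$ and $\mathrm{Erg}(\Delta_\infty,\varphi)$ denote the invariant, respectively ergodic, normalized Radon measures for the full map $\varphi:\Delta_\i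nfty\to\Delta_\infty$.
   Formalization: In the last sentence, the essential domain of the restricted map may be nonempty yet carry no invariant normalized Radon measure, so the maxima do not exist; there the theorem asserts r(aα)=0, and it asserts both maxima formulas whenever an invariant measure exists. *)

(* Defs.v *)
From HB Require Import structures.
From mathcomp Require Import all_boot all_order all_algebra.
From mathcomp Require Import all_classical all_reals all_analysis.
From mathcomp Require Import complex.

Set Implicit Arguments.
Unset Strict Implicit.
Unset Printing Implicit Defensive.

Import Order.TTheory GRing.Theory Num.Theory.
Import numFieldNormedType.Exports.

Local Open Scope classical_set_scope.
Local Open Scope ring_scope.
Local Open Scope complex_scope.

(* The product is declared here because Hierarchy Builder rejects the join of
   the ring hierarchy with normed modules (their common instances already
   belong to [numDomainType]). *)
HB.mixin Record CompleteNormedModule_isComBanachAlgebra (K : numFieldType) A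
    of CompleteNormedModule K A := {
  bmul : A -> A -> A;
  bone : A;
  bmulA : associative bmul;
  bmulC : commutative bmul;
  bmul1l : left_id bone bmul;
  bmulDl : left_distributive bmul +%R;
  bmulZl : forall (z : K) a b, bmul (z *: a) b = z *: bmul a b;
  bone_neq0 : bone != 0;
  bnormM : forall a b, `|bmul a b| <= `|a| * `|b|
}.

#[short(type="comBanachAlgType")]
HB.structure Definition ComBanachAlgebra (K : numFieldType) :=
  {A of CompleteNormedModule K A & CompleteNormedModule_isComBanachAlgebra K A}.

(* [`|z|] and [`|v|] below are elements of R[i], namely nonnegative reals;
   [cmod] and [rnorm] return them as elements of R. *)
Definition cmod (R : realType) (z : R[i]) : R := complex.Re `|z|.

Definition rnorm (R : realType) (V : normedModType R[i]) (v : V) : R :=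
  complex.Re `|v|.

Definition sup_modulus (R : realType) (S : set R[i]) : \bar R :=
  ereal_sup [set (cmod z)%:E | z in S].

Section UniformAlgebra.
Context {R : realType} {A : comBanachAlgType R[i]}.

Definition spectrum (a : A) : set R[i] :=
  [set z | ~ exists b : A, bmul (z *: bone - a) b = bone].

Definition spectral_radius (a : A) : \bar R := sup_modulus (spectrum a).

Definition bounded_op (T : A -> A) : Prop :=
  linear T /\ exists M : R, forall b, rnorm (T b) <= M * rnorm b.

(* The spectrum of T in the Banach algebra of bounded operators on A *)
Definition op_spectrum (T : A -> A) : set R[i] :=
  [set z | ~ exists S : A -> A, [/\ bounded_op S,
     forall b, S (z *: b - T b) = b & forall b, z *: S b - T (S b) = b]].

Definition op_spectral_radius (T : A -> A) : \bar R :=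
  sup_modulus (op_spectrum T).

(* not required to preserve the unit *)
Definition algebra_endomorphism (alpha : A -> A) : Prop :=
  linear alpha /\ forall a b, alpha (bmul a b) = bmul (alpha a) (alpha b).

Definition weighted_endo (a : A) (alpha : A -> A) : A -> A :=
  fun b => bmul a (alpha b).

Definition is_character (chi : A -> R[i]) : Prop :=
  [/\ forall z a b, chi (z *: a + b) = z * chi a + chi b,
      forall a b, chi (bmul a b) = chi a * chi b
    & exists a, chi a != 0].

End UniformAlgebra.

Definition uniform_algebra (R : realType) (A : comBanachAlgType R[i]) : Prop :=
  forall a : A, (rnorm a)%:E = spectral_radius a.

(* Maximal ideals are identified with characters; the topology is the one
   induced by pointwise convergence ([^o] provides the topology of R[i]). *)
Definition gelfand_spectrum (R : realType) (A : comBanachAlgType R[i]) :=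
  set_type ([set chi | is_character chi] : set {ptws A -> R[i]^o}).

Definition gelfand (R : realType) (A : comBanachAlgType R[i])
  (a : A) (x : gelfand_spectrum A) : R[i] := (set_val x : A -> R[i]) a.

(* A partial map with domain [Delta] is represented by a total function [phi]
   whose values outside [Delta] are irrelevant. *)
Definition dual_partial_system (R : realType) (A : comBanachAlgType R[i])
    (alpha : A -> A) (Delta : set (gelfand_spectrum A))
    (phi : gelfand_spectrum A -> gelfand_spectrum A) : Prop :=
  [/\ clopen Delta, {within Delta, continuous phi},
      forall a x, Delta x -> gelfand (alpha a) x = gelfand a (phi x)
    & forall a x, ~ Delta x -> gelfand (alpha a) x = 0].

Section EssentialDomain.
Context {X : choiceType} (Delta : set X) (phi : X -> X).

Fixpoint iter_dom (n : nat) : set X :=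
  if n is m.+1 then Delta `&` phi @^-1` (iter_dom m) else setT.

(* On [iter_dom n] the n-th iterate of phi only visits points of Delta. *)
Definition int_dom (n : int) : set X :=
  match n with
  | Posz m => iter_dom m
  | Negz m => iter m.+1 phi @` iter_dom m.+1
  end.

Definition essential_domain : set X := \bigcap_(n in [set: int]) int_dom n.

Lemma essential_domain_stable x :
  essential_domain x -> essential_domain (phi x).
Proof.
move=> Dx n _; have posD m : iter_dom m (phi x).
  by have [] := Dx (Posz m.+1) I.
case: n => [m|m] /=; first exact: posD.
have [y Dy yx] := Dx (Negz m) I.
exists (phi y); last by rewrite -yx -!iterSr.
have iterD k z : iter_dom k z -> iter_dom 1 (iter k phi z) ->
    iter_dom k.+1 z.
  elim: k z => [//|k IH] z [Dz Dz'] Dkz; split=> //.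
  by apply: IH => //; rewrite -iterSr.
suff [] : iter_dom m.+2 y by [].
by apply: iterD => //; rewrite yx; exact: (Dx (Posz 1) I).
Qed.

Definition essential_map (x : essential_domain) : essential_domain :=
  exist _ (phi (set_val x)) (mem_set (essential_domain_stable (set_valP x))).

End EssentialDomain.

Arguments essential_map {X} Delta phi x.

(* Measurable types are pointed, hence the point [y0] of the space; nothing
   below depends on its choice. *)
Definition at_point (Y : topologicalType) (y0 : Y) : Type := Y.
HB.instance Definition _ (Y : topologicalType) (y0 : Y) :=
  Topological.copy (at_point y0) Y.
HB.instance Definition _ (Y : topologicalType) (y0 : Y) :=
  isPointed.Build (at_point y0) y0.

Definition borel (Y : topologicalType) (y0 : Y) :=
  g_sigma_algebraType (@open (at_point y0)).

Section InvariantMeasures.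
Context {R : realType} {Y : topologicalType} (y0 : Y) (T : Y -> Y).

Definition radon (mu : probability (borel y0) R) : Prop :=
  forall B : set Y, measurable (B : set (borel y0)) ->
    mu B = ereal_sup [set mu K | K in [set K : set Y | compact K /\ K `<=` B]].

Definition invariant_measures : set (probability (borel y0) R) :=
  [set mu | radon mu /\
    forall w : set Y, measurable (w : set (borel y0)) -> mu (T @^-1` w) = mu w].

Definition ergodic_measures : set (probability (borel y0) R) :=
  [set mu | invariant_measures mu /\
    forall w : set Y, measurable (w : set (borel y0)) -> T @^-1` w = w ->
      mu w = 0%E \/ mu w = 1%E].

End InvariantMeasures.

Arguments invariant_measures R {Y} y0 T.
Arguments ergodic_measures R {Y} y0 T.

Definition exp_int_ln (R : realType) (X : topologicalType) (D : set X)
    (x0 : D) (f : X -> R[i]) (mu : probability (borel x0) R) : \bar R :=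
  expeR (\int[mu]_(x in [set: borel x0]) lne (cmod (f (set_val (x : D))))%:E).

Definition is_max (R : realType) (S : set \bar R) (m : \bar R) : Prop :=
  S m /\ ubound S m.

(* Main.v *)
Require Import Defs.
From HB Require Import structures.
From mathcomp Require Import all_boot all_order all_algebra.
From mathcomp Require Import all_classical all_reals all_analysis.
From mathcomp Require Import measurable_realfun complex ring lra.

Set Implicit Arguments.
Unset Strict Implicit.
Unset Printing Implicit Defensive.

Import Order.TTheory GRing.Theory Num.Theory.
Import numFieldNormedType.Exports.

Local Open Scope classical_set_scope.
Local Open Scope ring_scope.
Local Open Scope complex_scope.

(** Put [u := |a^|] and [P n x := \prod_(i < n) u (phi^i x)] on the domain
    [D n] of [phi^n]. The norm of [A] being the uniform norm on [X], the norm of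
    [(a alpha)^n] is [sup_(D n) P n], and the spectral radius [r] is controlled
    by these suprema; Cauchy's formula is replaced by Rickart's averaging of the
    resolvent over roots of unity. If [P n <= l ^ n] on [D n] for some [n], then
    invariance gives [\int ln u <= ln l]. Conversely, if [l < r], a selection
    argument of Pliss type yields a point of the essential domain whose orbit
    satisfies [l ^ j <= P j] for all [j]; averaging point masses along it
    produces an invariant measure with [ln l <= \int ln u]. The lower
    semicontinuous integral of [c - ln u] attains its minimum over the invariant
    measures at an ergodic one, because the set of minimizers is a closed face
    and minimal closed faces consist of ergodic measures. Finally, a measure
    with [\int ln u > -oo] does not charge the zeros of [a^], hence by
    invariance it lives on the essential domain of the restricted map. *)

(** No representation theorem and no weak topology on measures enter. Invariant measures are
    replaced by finitely additive means on sets, which form a compact subset of a product of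
    intervals because each axiom involves finitely many values; a mean is then regularized to a
    Radon measure through its values at closed sets. This controls the measures of open sets only,
    which is why the integrands are lower semicontinuous: [c - ln u] is one when [c] bounds [ln u],
    and being nonnegative, with value [+oo] at the zeros of [a^], it has an unambiguous integral.
    Squaring [T] repeatedly goes with averages over [2^k]-th roots of unity, whose Lipschitz
    constants do not depend on [k]; a bound on the powers therefore descends from the norm to the
    spectral radius by steps of fixed length. The essential domain of the restricted map need not be
    compact, so it may carry no invariant measure, and a maximizer found for [r = 0] may charge the
    zeros of [a^]; an auxiliary integrand, infinite at these zeros and integrable for a given
    measure, is minimized in that case. *)

(** * Separation and compactness in compact Hausdorff spaces *)

Section CompactHausdorff.
Context {Y : topologicalType}.

Lemma compact_closed_setT (C : set Y) :
  compact [set: Y] -> closed C -> compact C.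
Proof. by move=> cY clC; apply: (subclosed_compact clC cY). Qed.

Lemma compact_monotone_cover (C : set Y) (V : nat -> set Y) :
  compact C -> (forall n, open (V n)) ->
  (forall m n, (m <= n)%N -> V m `<=` V n) ->
  C `<=` \bigcup_n V n -> exists n, C `<=` V n.
Proof.
move=> /compact_near_coveringP cC oV mV CV.
have [n _ Hn] : \forall n \near \oo, C `<=` V n.
  apply: cC => x /CV [n _ Vnx].
  exists (V n, [set m | (n <= m)%N]) => /=.
    split; first exact: open_nbhs_nbhs.
    by exists n.
  by move=> [y m] /= [Vy nm]; exact: mV Vy.
by exists n; exact: Hn (leqnn n).
Qed.

Lemma compact_nested_nonempty (F : nat -> set Y) :
  compact [set: Y] -> (forall n, closed (F n)) ->
  (forall m n, (m <= n)%N -> F n `<=` F m) ->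
  (forall n, F n !=set0) -> \bigcap_n F n !=set0.
Proof.
move=> cY clF mF F0; apply: contrapT => /set0P/negP; rewrite negbK => /eqP E.
have [n Hn] : exists n, [set: Y] `<=` ~` F n.
  apply: compact_monotone_cover => // [n|m n mn|y _].
  - exact: closed_openC.
  - by apply: subsetC; exact: mF.
  - by rewrite -setC_bigcap E.
by have [y /(Hn y I)] := F0 n.
Qed.

Hypotheses (hY : hausdorff_space Y) (cY : compact [set: Y]).

Lemma compact_hausdorff_normal (R : realType) (A B : set Y) :
  closed A -> closed B -> A `&` B = set0 ->
  exists U V, [/\ open U, open V, A `<=` U, B `<=` V & U `&` V = set0].
Proof. by move: A B; apply/(@normal_openP R)/compact_normal. Qed.

Lemma closed_open_interpolation (R : realType) (C U : set Y) :
  closed C -> open U -> C `<=` U ->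
  exists V D, [/\ open V, closed D, C `<=` V, V `<=` D & D `<=` U].
Proof.
move=> clC oU CU.
have [||V [W [oV oW CV UW VW]]] := @compact_hausdorff_normal R C (~` U) clC.
- exact: open_closedC.
- by apply/disjoints_subset; rewrite setCK.
exists V, (~` W); split => //; first exact: open_closedC.
- exact/disjoints_subset.
- by move=> x Wx; apply: contrapT => /UW.
Qed.

(** The part of [C] outside [W] is closed and lies in [U], so an open [V] and a closed [D] fit
    between them; since [V] is inside [D], the sets [C & D] and [C \ V] together exhaust [C]. This
    splitting makes inner contents of open sets subadditive. *)
Lemma closed_cover_shrink (R : realType) (C U W : set Y) :
  closed C -> open U -> open W -> C `<=` U `|` W ->
  exists C1 C2, [/\ closed C1, closed C2, C1 `<=` U, C2 `<=` W
    & C = C1 `|` C2].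
Proof.
move=> clC oU oW CUW.
have [|//||V [D [oV clD CV VD DU]]] := @closed_open_interpolation R (C `\` W) U.
- by rewrite setDE; apply: closedI => //; exact: open_closedC.
- by move=> x [/CUW []].
exists (C `&` D), (C `\` V); split.
- exact: closedI.
- by rewrite setDE; apply: closedI => //; exact: open_closedC.
- by move=> x [_ /DU].
- by move=> x [Cx nVx]; apply: contrapT => nWx; apply: nVx; exact: CV.
- apply/seteqP; split=> [x Cx|x [[]//|[]//]].
  by have [/VD|] := pselect (V x); [left|right].
Qed.

End CompactHausdorff.

(** * Radon measures from contents on closed sets *)

Section ClosedContent.
Context {R : realType} {Y : topologicalType}.
Hypotheses (hY : hausdorff_space Y) (cY : compact [set: Y]).
Context (y0 : Y) (m : set Y -> R).
Hypotheses (m_le : forall C D, closed C -> closed D -> C `<=` D -> m C <= m D)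
  (m_subadd : forall C D, closed C -> closed D -> m (C `|` D) <= m C + m D)
  (m_add : forall C D, closed C -> closed D -> C `&` D = set0 ->
    m (C `|` D) = m C + m D).

Local Open Scope ereal_scope.

(** The classical passage from a content to a regular measure: approximation by closed sets from
    inside, applied to open sets, then by open sets from outside. At a closed set the result may
    exceed [m], so that only the values at open sets are kept track of later. *)
Definition inner_content (U : set Y) : \bar R :=
  ereal_sup [set (m C)%:E | C in [set C | closed C /\ C `<=` U]].

Definition outer_content (E : set Y) : \bar R :=
  ereal_inf [set inner_content U | U in [set U | open U /\ E `<=` U]].

Lemma closed_content0 : m set0 = 0%R.
Proof.
have := m_add closed0 closed0 (setI0 _); rewrite setU0 => /eqP.
by rewrite -subr_eq subrr => /eqP.
Qed.

Lemma le_inner_content (C U : set Y) :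
  closed C -> C `<=` U -> (m C)%:E <= inner_content U.
Proof. by move=> clC CU; apply: ereal_sup_ubound; exists C. Qed.

Lemma inner_content_ge0 U : 0 <= inner_content U.
Proof.
have -> : 0 = (m set0)%:E by rewrite closed_content0.
by apply: le_inner_content => //; exact: closed0.
Qed.

Lemma inner_content_le U V : U `<=` V -> inner_content U <= inner_content V.
Proof.
move=> UV; apply: ereal_sup_le => _ [C [clC CU] <-]; exists C => //.
by split => //; exact: subset_trans UV.
Qed.

Lemma inner_contentT : inner_content setT = (m setT)%:E.
Proof.
apply/eqP; rewrite eq_le (le_inner_content closedT)// andbT.
apply: ge_ereal_sup => _ [C [clC _] <-]; rewrite lee_fin.
exact: m_le clC closedT _.
Qed.

Lemma inner_content_fin U : inner_content U \is a fin_num.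
Proof.
rewrite ge0_fin_numE ?inner_content_ge0//.
by rewrite (le_lt_trans (inner_content_le (@subsetT _ U)))// inner_contentT ltry.
Qed.

Lemma inner_contentU (U V : set Y) : open U -> open V ->
  inner_content (U `|` V) <= inner_content U + inner_content V.
Proof.
move=> oU oV; apply: ge_ereal_sup => _ [C [clC CUV] <-].
have [C1 [C2 [cl1 cl2 C1U C2V ->]]] :=
  @closed_cover_shrink _ hY cY R _ _ _ clC oU oV CUV.
apply: (@le_trans _ _ ((m C1)%:E + (m C2)%:E)).
  by rewrite -EFinD lee_fin m_subadd.
by apply: leeD; exact: le_inner_content.
Qed.

Lemma open_bigsetU (F : nat -> set Y) n : (forall i, open (F i)) ->
  open (\big[setU/set0]_(i < n) F i).
Proof.
move=> oF; rewrite -bigcup_mkord; apply: bigcup_open => i _; exact: oF.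
Qed.

Lemma inner_content_bigsetU (F : nat -> set Y) n : (forall i, open (F i)) ->
  inner_content (\big[setU/set0]_(i < n) F i) <=
  \sum_(i < n) inner_content (F i).
Proof.
move=> oF; elim: n => [|n IH].
  rewrite !big_ord0; apply: ge_ereal_sup => _ [C [_ C0] <-].
  by have -> : C = set0 by [apply/seteqP; split]; rewrite closed_content0.
rewrite !big_ord_recr/=; apply: le_trans (inner_contentU _ _) _ => //.
  exact: open_bigsetU.
by rewrite leeD2r.
Qed.

(** A closed subset of the union is compact, hence covered by finitely many of the open sets: this
    is where countable subadditivity comes from a finitely additive content. *)
Lemma inner_content_bigcup (F : nat -> set Y) : (forall i, open (F i)) ->
  inner_content (\bigcup_i F i) <= \sum_(i <oo) inner_content (F i).
Proof.
move=> oF; apply: ge_ereal_sup => _ [C [clC CF] <-].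
have [n Cn] : exists n, C `<=` \big[setU/set0]_(i < n) F i.
  apply: compact_monotone_cover.
  - exact: compact_closed_setT.
  - by move=> n; exact: open_bigsetU.
  - move=> k n kn x; rewrite -!bigcup_mkord => -[i /= ik Fi].
    by exists i => //=; exact: leq_trans kn.
  - move=> x /CF [i _ Fix]; exists i.+1 => //; rewrite -bigcup_mkord.
    by exists i => /=.
apply: le_trans (le_inner_content clC Cn) _.
apply: le_trans (inner_content_bigsetU n oF) _.
rewrite -(big_mkord xpredT (fun i => inner_content (F i))).
by apply: nneseries_lim_ge => k _ _; exact: inner_content_ge0.
Qed.

Lemma inner_content_disjoint (C U : set Y) : closed C -> open U -> C `<=` U ->
  (m C)%:E + inner_content (U `\` C) <= inner_content U.
Proof.
move=> clC oU CU; rewrite -leeBrDl//; apply: ge_ereal_sup => _ [D [clD DUC] <-].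
rewrite leeBrDl// -EFinD -m_add//; last first.
  by apply/disjoints_subset => x Cx /DUC [].
apply: le_inner_content; first exact: closedU.
by move=> x [/CU//|/DUC []].
Qed.

Lemma outer_content_open U : open U -> outer_content U = inner_content U.
Proof.
move=> oU; apply: le_anti; apply/andP; split.
  by apply: ereal_inf_lbound; exists U => //; split.
by apply: le_ereal_inf_tmp => _ [V [oV UV] <-]; exact: inner_content_le.
Qed.

Lemma outer_content0 : outer_content set0 = 0.
Proof.
rewrite outer_content_open; last exact: open0.
apply/eqP; rewrite eq_le inner_content_ge0 andbT.
apply: ge_ereal_sup => _ [C [_ C0] <-].
by have -> : C = set0 by [apply/seteqP; split]; rewrite closed_content0.
Qed.

Lemma outer_content_ge0 E : 0 <= outer_content E.
Proof. by apply: le_ereal_inf_tmp => _ [V _ <-]; exact: inner_content_ge0. Qed.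

Lemma outer_content_le : {homo outer_content : A B / A `<=` B >-> A <= B}.
Proof.
move=> A B AB; apply: ereal_inf_le_tmp => _ [V [oV BV] <-]; exists V => //.
by split => //; exact: subset_trans BV.
Qed.

Lemma outer_content_fin E : outer_content E \is a fin_num.
Proof.
rewrite ge0_fin_numE ?outer_content_ge0//.
rewrite (le_lt_trans (outer_content_le (@subsetT _ E)))//.
by rewrite outer_content_open ?inner_contentT ?ltry//; exact: openT.
Qed.

Lemma outer_content_approx E (e : R) : (0 < e)%R ->
  exists U, [/\ open U, E `<=` U & inner_content U <= outer_content E + e%:E].
Proof.
move=> e0; have [_ [U [oU EU] <-] Ue] :=
  lb_ereal_inf_adherent e0 (outer_content_fin E).
by exists U; split => //; exact: ltW.
Qed.

Lemma outer_content_sigma_subadditive : sigma_subadditive outer_content.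
Proof.
move=> F; apply/lee_addgt0Pr => e e0.
apply: le_trans (epsilon_trick xpredT _ (ltW e0)); last first.
  by move=> n; exact: outer_content_ge0.
have H n : exists U, [/\ open U, F n `<=` U &
    inner_content U <= outer_content (F n) + (e / (2 ^ n.+1)%:R)%:E].
  by apply: outer_content_approx; rewrite divr_gt0// ltr0n expn_gt0.
have [U HU] := choice H.
have oU n : open (U n) by have [] := HU n.
have oUU : open (\bigcup_n U n) by apply: bigcup_open => i _; exact: oU.
have FU : \bigcup_n F n `<=` \bigcup_n U n.
  by apply: subset_bigcup => n _; have [] := HU n.
apply: le_trans (outer_content_le FU) _; rewrite outer_content_open//.
apply: le_trans (inner_content_bigcup oU) _.
apply: lee_nneseries => n _; first by move=> _; exact: inner_content_ge0.
by have [] := HU n.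
Qed.

HB.instance Definition _ := isOuterMeasure.Build R Y outer_content
  outer_content0 outer_content_ge0 outer_content_le
  outer_content_sigma_subadditive.

(** One half of the error pays for an open [G] around [E], the other for a closed [C] nearly
    exhausting [G & U]. Then [E & U] is measured by [C], the rest of [E] lies in the open set
    [G \ C], and the content of [G] dominates the sum of both. *)
Lemma open_caratheodory U : open U -> outer_content.-caratheodory U.
Proof.
move=> oU; apply: le_caratheodory_measurable => E.
apply/lee_addgt0Pr => e e0; have e2 : (0 < e / 2)%R by rewrite divr_gt0.
have [G [oG EG GE]] := outer_content_approx E e2.
have oGU : open (G `&` U) by exact: openI.
have [_ [C [clC CGU] <-] Ce] :=
  ub_ereal_sup_adherent e2 (inner_content_fin (G `&` U)).
rewrite -/(inner_content _) in Ce.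
have CG : C `<=` G by move=> x /CGU [].
have le1 : outer_content (E `&` U) <= (m C)%:E + (e / 2)%:E.
  have sub : E `&` U `<=` G `&` U by exact: setSI.
  apply: le_trans (outer_content_le sub) _.
  by rewrite outer_content_open// -leeBlDr// ltW.
have le2 : outer_content (E `&` ~` U) <= inner_content (G `\` C).
  have sub : E `&` ~` U `<=` G `\` C.
    by move=> x [Ex nUx]; split; [exact: EG|move=> /CGU []].
  apply: le_trans (outer_content_le sub) _; rewrite outer_content_open//.
  by rewrite setDE; apply: openI => //; exact: closed_openC.
apply: le_trans (leeD le1 le2) _; rewrite addeAC.
apply: le_trans (leeD2r _ (inner_content_disjoint clC oG CG)) _.
apply: le_trans (leeD2r _ GE) _.
by rewrite -addeA -EFinD -splitr.
Qed.

Let outer_borel : set (borel y0) -> \bar R := outer_content.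

Lemma borel_caratheodory (B : set Y) :
  measurable (B : set (borel y0)) -> outer_content.-caratheodory B.
Proof.
apply: smallest_sub; last by move=> U oU; exact: open_caratheodory.
split.
- exact: caratheodory_measurable_set0.
- by move=> A cA; rewrite setTD; exact: caratheodory_measurable_setC.
- by move=> F cF; exact: caratheodory_measurable_bigcup.
Qed.

Lemma outer_borel_sigma_additive : semi_sigma_additive outer_borel.
Proof.
move=> F mF tF mUF.
pose mu : {outer_measure set (at_point y0) -> \bar R} := outer_content.
have := @caratheodory_measure_sigma_additive R (at_point y0) mu F.
apply => //.
- by move=> i; exact: borel_caratheodory.
- exact: borel_caratheodory.
Qed.

HB.instance Definition _ := isMeasure.Build _ _ _ outer_borel
  outer_content0 outer_content_ge0 outer_borel_sigma_additive.

Hypothesis mT : m setT = 1%R.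

Lemma outer_borelT : outer_borel setT = 1.
Proof.
by rewrite /outer_borel outer_content_open ?inner_contentT ?mT//; exact: openT.
Qed.

HB.instance Definition _ :=
  Measure_isProbability.Build _ _ _ outer_borel outer_borelT.

Definition content_probability : probability (borel y0) R := outer_borel.

Lemma content_probability_open U :
  open U -> content_probability U = inner_content U.
Proof. exact: outer_content_open. Qed.

End ClosedContent.

(** * Radon probability measures on Borel sets *)

Section BorelProbability.
Context {R : realType} {Y : topologicalType}.
Local Open Scope ereal_scope.

Lemma lee_1B (x y : \bar R) : x \is a fin_num -> y \is a fin_num ->
  (1 - x <= 1 - y) = (y <= x).
Proof.
by case: x => // x _; case: y => // y _; rewrite !lee_fin; apply/idP/idP; lra.
Qed.

Lemma open_borel (y0 : Y) (U : set Y) :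
  open U -> measurable (U : set (borel y0)).
Proof. by move=> oU; exact: sub_sigma_algebra. Qed.

Lemma closed_borel (y0 : Y) (C : set Y) :
  closed C -> measurable (C : set (borel y0)).
Proof.
by move=> clC; rewrite -(setCK C); apply: measurableC; apply: open_borel;
  exact: closed_openC.
Qed.

Arguments open_borel y0 [U].
Arguments closed_borel y0 [C].

Lemma compact_borel (y0 : Y) (C : set Y) : hausdorff_space Y ->
  compact C -> measurable (C : set (borel y0)).
Proof. by move=> hY cC; apply: closed_borel; exact: compact_closed. Qed.

Lemma continuous_borel {Z : topologicalType} (y0 : Y) (z0 : Z) (T : Y -> Z)
    (B : set Z) : continuous T -> measurable (B : set (borel z0)) ->
  measurable (T @^-1` B : set (borel y0)).
Proof.
move=> cT; move: B; apply: smallest_sub; last first.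
  by move=> U oU; apply: open_borel; exact: open_comp.
split.
- by rewrite preimage_set0; exact: measurable0.
- by move=> A mA; rewrite setTD preimage_setC; exact: measurableC.
- by move=> F mF; rewrite preimage_bigcup; exact: bigcup_measurable.
Qed.

Arguments compact_borel y0 [C].
Arguments continuous_borel {Z} y0 {z0} [T B].

Section OnePoint.
Context {y0 : Y}.
Implicit Types mu nu : probability (borel y0) R.

Lemma prob_setC mu (B : set Y) : measurable (B : set (borel y0)) ->
  mu (~` B) = 1 - mu B.
Proof. by move=> mB; exact: probability_setC. Qed.

Lemma prob_fin mu (B : set Y) : measurable (B : set (borel y0)) ->
  mu B \is a fin_num.
Proof. by move=> mB; exact: fin_num_measure. Qed.

(** Both total masses are 1, so the inequality at the complement is the reverse inequality. *)
Lemma prob_le_eq mu nu :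
  (forall B : set Y, measurable (B : set (borel y0)) -> nu B <= mu B) ->
  forall B : set Y, measurable (B : set (borel y0)) -> nu B = mu B.
Proof.
move=> H B mB; apply: le_anti; rewrite H//=.
have /H : measurable (~` B : set (borel y0)) by exact: measurableC.
rewrite (prob_setC nu mB) (prob_setC mu mB).
by rewrite lee_1B// prob_fin.
Qed.

Lemma radon_le mu nu : radon nu -> hausdorff_space Y ->
  (forall C : set Y, compact C -> nu C <= mu C) ->
  forall B : set Y, measurable (B : set (borel y0)) -> nu B <= mu B.
Proof.
move=> rnu hY H B mB; rewrite rnu//.
apply: ge_ereal_sup => _ [C [cC CB] <-]; apply: le_trans (H _ cC) _.
by apply: le_measure; rewrite ?inE//; exact: compact_borel.
Qed.

Lemma radon_eq mu nu : radon mu -> radon nu -> hausdorff_space Y ->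
  (forall C : set Y, compact C -> nu C = mu C) ->
  forall B : set Y, measurable (B : set (borel y0)) -> nu B = mu B.
Proof.
move=> rmu rnu hY H; apply: prob_le_eq; apply: radon_le => // C cC.
by rewrite H.
Qed.

Lemma radon_inner_approx mu (B : set Y) (e : R) : hausdorff_space Y ->
  radon mu -> measurable (B : set (borel y0)) -> (0 < e)%R ->
  exists C, [/\ compact C, C `<=` B & mu B <= mu C + e%:E].
Proof.
move=> hY rmu mB e0.
have fB : ereal_sup [set mu K | K in [set K | compact K /\ K `<=` B]]
    \is a fin_num by rewrite -rmu// prob_fin.
have [_ [C [cC CB] <-] Ce] := ub_ereal_sup_adherent e0 fB.
by exists C; split => //; rewrite -leeBlDr// rmu// ltW.
Qed.

Lemma radonP mu : hausdorff_space Y ->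
  (forall (B : set Y) (e : R), measurable (B : set (borel y0)) -> (0 < e)%R ->
    exists C, [/\ compact C, C `<=` B & mu B <= mu C + e%:E]) -> radon mu.
Proof.
move=> hY H B mB; apply: le_anti; apply/andP; split; last first.
  apply: ge_ereal_sup => _ [C [cC CB] <-].
  by apply: le_measure; rewrite ?inE//; exact: compact_borel.
apply/lee_addgt0Pr => e e0; have [C [cC CB Ce]] := H B e mB e0.
by apply: le_trans Ce _; rewrite leeD2r//; apply: ereal_sup_ubound; exists C.
Qed.

(** Complements turn the hypothesis into [mu (T^-1 C) <= mu C] for closed [C]. A compact [K] inside
    [T^-1 B] lies in [T^-1 (T K)], where [T K] is a closed subset of [B]; regularity extends the
    inequality to every Borel [B], and complements once more give equality. *)
Lemma open_preimage_invariant mu (T : Y -> Y) : hausdorff_space Y ->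
  compact [set: Y] -> continuous T -> radon mu ->
  (forall U : set Y, open U -> mu U <= mu (T @^-1` U)) ->
  forall B : set Y, measurable (B : set (borel y0)) -> mu (T @^-1` B) = mu B.
Proof.
move=> hY cY cT rmu HU.
have HC (C : set Y) : closed C -> mu (T @^-1` C) <= mu C.
  move=> clC; have := HU _ (closed_openC clC).
  have mC := closed_borel y0 clC.
  rewrite preimage_setC !prob_setC//; last exact: (continuous_borel y0 cT mC).
  by rewrite lee_1B ?prob_fin//; exact: (continuous_borel y0 cT mC).
have le (B : set Y) : measurable (B : set (borel y0)) ->
    mu (T @^-1` B) <= mu B.
  move=> mB; rewrite (rmu _ (continuous_borel y0 cT mB)).
  apply: ge_ereal_sup => _ [C [cC CB] <-].
  have cTC : compact (T @` C).
    by apply: continuous_compact => //; exact: continuous_subspaceT.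
  have clTC := compact_closed hY cTC.
  have mTC := closed_borel y0 clTC.
  apply: (@le_trans _ _ (mu (T @^-1` (T @` C)))).
    apply: le_measure; rewrite ?inE.
    - exact: compact_borel.
    - exact: (continuous_borel y0 cT mTC).
    - exact: preimage_image.
  apply: le_trans (HC _ clTC) _.
  apply: le_measure; rewrite ?inE//.
  by move=> _ [x /CB Bx <-].
move=> B mB; apply: le_anti; rewrite le//=.
have mTB := continuous_borel y0 cT mB.
have /le : measurable (~` B : set (borel y0)) by exact: measurableC.
by rewrite preimage_setC !prob_setC// lee_1B// prob_fin.
Qed.

End OnePoint.
End BorelProbability.

Arguments open_borel {Y} y0 [U].
Arguments closed_borel {Y} y0 [C].
Arguments compact_borel {Y} y0 [C].
Arguments continuous_borel {Y Z} y0 {z0} [T B].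

Section ContentProbability.
Context {R : realType} {Y : topologicalType}.
Hypotheses (hY : hausdorff_space Y) (cY : compact [set: Y]).
Context (y0 : Y).
Local Open Scope ereal_scope.

Definition closed_content (m : set Y -> R) : Prop :=
  [/\ forall C D, closed C -> closed D -> C `<=` D -> (m C <= m D)%R,
      forall C D, closed C -> closed D -> (m (C `|` D) <= m C + m D)%R,
      forall C D, closed C -> closed D -> C `&` D = set0 ->
        m (C `|` D) = (m C + m D)%R
    & m setT = 1%R].

Lemma closed_content_radon (m : set Y -> R) : closed_content m ->
  exists mu : probability (borel y0) R, radon mu /\
    forall U, open U -> mu U = inner_content m U.
Proof.
move=> [mle msub madd mT].
exists (content_probability hY cY y0 mle msub madd mT); set mu := (X in radon X).
split; last by move=> U oU; exact: content_probability_open.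
apply: radonP => // B e mB e0.
have [U [oU BU Ue]] := outer_content_approx mle madd (~` B) e0.
have mU := open_borel y0 oU.
exists (~` U); split.
- by apply: compact_closed_setT => //; exact: open_closedC.
- by move=> x nUx; apply: contrapT => /BU.
have -> : mu (~` U) = 1 - mu U by exact: prob_setC.
have : mu U <= mu (~` B) + e%:E.
  have -> : mu U = inner_content m U by exact: content_probability_open.
  exact: Ue.
have -> : mu (~` B) = 1 - mu B by exact: prob_setC.
have : mu B \is a fin_num by exact: prob_fin.
have : mu U \is a fin_num by exact: prob_fin.
by case: (mu U) => // u _; case: (mu B) => // b _; rewrite !lee_fin; lra.
Qed.

End ContentProbability.

(** * The compact space of invariant means *)

Section InvariantMeans.
Context {R : realType} {Y : topologicalType} (y0 : Y) (T : Y -> Y).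
Hypotheses (hY : hausdorff_space Y) (cY : compact [set: Y])
  (cT : continuous T).
Local Open Scope ereal_scope.

(* Only the values at Borel sets matter; the bounds are imposed at every set so
   that the invariant means form a closed subset of a product of intervals. *)
Definition invariant_mean (m : set Y -> R) : Prop :=
  [/\ forall B, (0 <= m B <= 1)%R, m setT = 1%R,
      forall A B, measurable (A : set (borel y0)) ->
        measurable (B : set (borel y0)) -> A `&` B = set0 ->
        m (A `|` B) = (m A + m B)%R
    & forall B, measurable (B : set (borel y0)) -> m (T @^-1` B) = m B].

Lemma invariant_mean_closed_content m : invariant_mean m -> closed_content m.
Proof.
move=> [m01 mT madd _].
have m0 B : (0 <= m B)%R by have /andP[] := m01 B.
have mD A B : closed A -> closed B -> m (A `|` B) = (m A + m (B `\` A))%R.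
  move=> clA clB; have -> : A `|` B = A `|` (B `\` A).
    by rewrite setUDr setDv setD0.
  rewrite madd ?setDIK//; first exact: closed_borel.
  by apply: measurableD; exact: closed_borel.
have mI A B : closed A -> closed B -> m B = (m (B `&` A) + m (B `\` A))%R.
  move=> clA clB; rewrite -madd ?setUIDK//.
  - by apply: measurableI; exact: closed_borel.
  - by apply: measurableD; exact: closed_borel.
  - by apply/seteqP; split=> x //= [[_ ?] []].
split => //.
- move=> A B clA clB AB.
  by rewrite (mI A B)// (setIidr AB) lerDl.
- by move=> A B clA clB; rewrite mD// lerD2l (mI A B)// lerDr.
- by move=> A B clA clB; apply: madd; exact: closed_borel.
Qed.

(** The map [rm] regularizes a finitely additive mean into a Radon measure; the Dirac mass is a
    default off the invariant means. Invariance survives because the preimage of a closed set is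
    closed, so inner contents of open sets do not decrease under preimages. *)
Lemma invariant_mean_measure : exists rm : (set Y -> R) -> probability (borel y0) R,
  forall m, invariant_mean m -> invariant_measures R y0 T (rm m) /\
    forall U, open U -> rm m U = inner_content m U.
Proof.
suff /choice[rm rmP] : forall m, exists mu : probability (borel y0) R,
    invariant_mean m -> invariant_measures R y0 T mu /\
    forall U, open U -> mu U = inner_content m U by exists rm.
move=> m.
have [im|nim] := pselect (invariant_mean m); last by exists (\d_ (y0 : borel y0)).
have [mu [rmu muU]] :=
  closed_content_radon hY cY y0 (invariant_mean_closed_content im).
exists mu => _; split => //; split => //.
apply: open_preimage_invariant => // U oU.
have oTU : open (T @^-1` U) by exact: open_comp.
rewrite !muU//; apply: ge_ereal_sup => _ [C [clC CU] <-].
have [_ _ _ <-] := im; last exact: closed_borel.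
apply: ereal_sup_ubound; exists (T @^-1` C) => //; split.
  exact: closed_comp.
exact: preimage_subset.
Qed.

(** The default 0 off the Borel sets respects the bounds that [invariant_mean] imposes at every
    set. *)
Definition mean_of (mu : probability (borel y0) R) (B : set Y) : R :=
  if pselect (measurable (B : set (borel y0))) then fine (mu B) else 0%R.

Lemma mean_ofE mu (B : set Y) : measurable (B : set (borel y0)) ->
  (mean_of mu B)%:E = mu B.
Proof.
by move=> mB; rewrite /mean_of; case: pselect => // ?; rewrite fineK// prob_fin.
Qed.

Lemma invariant_mean_of mu :
  invariant_measures R y0 T mu -> invariant_mean (mean_of mu).
Proof.
move=> [rmu imu]; split.
- move=> B; rewrite -!lee_fin /mean_of; case: pselect => mB; last first.
    by rewrite !lee_fin lexx ler01.
  by rewrite fineK ?prob_fin// measure_ge0 probability_le1.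
- by apply: EFin_inj; rewrite mean_ofE ?probability_setT//; exact: measurableT.
- move=> A B mA mB AB; apply: EFin_inj.
  rewrite EFinD !mean_ofE//; last exact: measurableU.
  by rewrite measureU.
- move=> B mB; apply: EFin_inj; rewrite !mean_ofE ?imu//.
  exact: continuous_borel mB.
Qed.

(** Closed and compact sets coincide in [Y], so this is inner regularity. Going from a Radon measure
    to its mean and back to a measure therefore loses nothing. *)
Lemma inner_content_mean_of mu (U : set Y) : radon mu -> open U ->
  inner_content (mean_of mu) U = mu U.
Proof.
move=> rmu oU; rewrite (rmu _ (open_borel y0 oU)); congr ereal_sup.
apply/seteqP; split=> _ [C [cC CU] <-]; exists C.
- by split => //; exact: compact_closed_setT.
- by rewrite mean_ofE//; exact: closed_borel.
- by split => //; exact: compact_closed.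
- by rewrite mean_ofE//; exact: compact_borel.
Qed.

Lemma open_agree_measure (mu nu : probability (borel y0) R) :
  radon mu -> radon nu -> (forall U : set Y, open U -> mu U = nu U) ->
  forall B : set Y, measurable (B : set (borel y0)) -> mu B = nu B.
Proof.
move=> rmu rnu H; apply: (radon_eq rnu rmu hY) => C cC.
have clC := compact_closed hY cC.
have oC := closed_openC clC; have mC := open_borel y0 oC.
have := prob_setC mu mC; have := prob_setC nu mC.
by rewrite setCK => -> ->; rewrite H.
Qed.

Local Notation means := ([set m | invariant_mean m] : set {ptws set Y -> R}).

Lemma continuous_eval (B : set Y) :
  continuous (fun m : {ptws set Y -> R} => m B : R).
Proof. exact: (@proj_continuous (set Y) (fun=> R) B). Qed.

Lemma closed_eval_eq (B C : set Y) :
  closed [set m : {ptws set Y -> R} | m B = m C].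
Proof.
have -> : [set m : {ptws set Y -> R} | m B = m C] =
    (fun m : {ptws set Y -> R} => m B - m C : R)%R @^-1` [set 0%R].
  apply/seteqP; split=> m /=; first by move=> ->; rewrite subrr.
  by move=> /eqP; rewrite subr_eq0 => /eqP.
apply: closed_comp; last exact: closed_eq.
by move=> m _; apply: continuousB; exact: continuous_eval.
Qed.

(** Each axiom is an equation between, or a bound on, finitely many evaluations, hence a closed
    condition inside the cube of all functions with values in [[0, 1]]. Countable additivity would
    not be such a condition. *)
Lemma compact_invariant_means : compact means.
Proof.
pose cube : set {ptws set Y -> R} :=
  [set m | forall B, `[0%R, 1%R]%classic (m B)].
apply: (@subclosed_compact _ _ cube); last 2 first.
- apply: (@tychonoff (set Y) (fun=> R) (fun=> `[0%R, 1%R]%classic)) => B.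
  exact: segment_compact.
- move=> m [m01 _ _ _] B. rewrite /= in_itv /=; exact: m01.
have -> : means = cube `&`
   [set m | m setT = 1%R] `&`
   \bigcap_(AB in [set AB : set Y * set Y |
     [/\ measurable (AB.1 : set (borel y0)), measurable (AB.2 : set (borel y0))
      & AB.1 `&` AB.2 = set0]])
     [set m | m (AB.1 `|` AB.2) = (m AB.1 + m AB.2)%R] `&`
   \bigcap_(B in [set B : set Y | measurable (B : set (borel y0))])
     [set m | m (T @^-1` B) = m B].
  apply/seteqP; split=> m.
    move=> [m01 mT madd mi]; do 3?split=> //.
    by move=> [A B] [mA mB AB]; exact: (madd _ _ mA mB AB).
  move=> [[[m01 mT] madd] mi]; split => //.
  by move=> A B mA mB AB; exact: (madd (A, B)).
apply: closedI; last by apply: closed_bigI => B _; exact: closed_eval_eq.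
apply: closedI; [apply: closedI|].
- have -> : cube =
     \bigcap_B ((fun m : {ptws set Y -> R} => m B : R) @^-1` `[0%R, 1%R]%classic).
    by apply/seteqP; split=> m H B; [move=> _|]; exact: H.
  apply: closed_bigI => B _; apply: closed_comp.
    by move=> m _; exact: continuous_eval.
  exact: interval_closed.
- have -> : [set m : {ptws set Y -> R} | m setT = 1%R] =
     (fun m : {ptws set Y -> R} => m setT : R) @^-1` [set 1%R] by [].
  apply: closed_comp; last exact: closed_eq.
  by move=> m _; exact: continuous_eval.
- apply: closed_bigI => -[A B] _ /=.
  have -> : [set m : {ptws set Y -> R} | m (A `|` B) = m A + m B]%R =
      (fun m : {ptws set Y -> R} => m (A `|` B) - (m A + m B) : R)%R
        @^-1` [set 0%R].
    apply/seteqP; split=> m /=; first by move=> ->; rewrite subrr.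
    by move=> /eqP; rewrite subr_eq0 => /eqP.
  apply: closed_comp; last exact: closed_eq.
  move=> m _; exact: (cvgB (@continuous_eval (A `|` B) m)
    (cvgD (@continuous_eval A m) (@continuous_eval B m))).
Qed.

End InvariantMeans.

(** * Integrals of lower semicontinuous functions against regularized means *)

Section LowerSemicontinuousIntegral.
Context {R : realType} {Y : topologicalType} (y0 : Y) (T : Y -> Y).
Hypotheses (hY : hausdorff_space Y) (cY : compact [set: Y])
  (cT : continuous T).
Local Open Scope ereal_scope.

Lemma lsc_measurable (g : Y -> \bar R) :
  lower_semicontinuous g -> measurable_fun setT (g : borel y0 -> \bar R).
Proof.
move=> /lower_semicontinuousP lg.
apply: (measurability _ (ErealGenOInfty.measurableE R)).
move=> _ [_ [a ->] <-]; rewrite setTI preimage_itvoy; apply: open_borel.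
exact: lg.
Qed.

Arguments lsc_measurable [g].

Definition superlevel (g : Y -> \bar R) (t : R) : set Y :=
  [set z | t%:E < g z].

(** A staircase below [g], with [K] steps of height [d], which is within [d] of [g] truncated at
    [K d]. For a lower semicontinuous [g] its integral involves measures of open sets only. *)
Definition level_steps (g : Y -> \bar R) (d : R) (K : nat) (y : Y) : \bar R :=
  \sum_(k < K) (d * \1_(superlevel g (k.+1%:R * d)) y)%:E.

Lemma level_steps_le (g : Y -> \bar R) (d : R) K y : (0 < d)%R -> 0 <= g y ->
  level_steps g d K y <= g y.
Proof.
move=> d0 gy0; rewrite /level_steps.
(* The bound by [K d] strengthens the induction: the next step is added only where [g] exceeds
   [(K + 1) d]. *)
suff [] : level_steps g d K y <= (K%:R * d)%:E /\ level_steps g d K y <= g y.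
  by [].
rewrite /level_steps; elim: K => [|K [IH1 IH2]].
  by rewrite big_ord0 mul0r.
rewrite big_ord_recr/= indicE; have [gK|gK] := ltP ((K.+1%:R * d)%:E) (g y).
  have -> : y \in superlevel g (K.+1%:R * d) by rewrite inE.
  rewrite mulr1; have le : \sum_(k < K)
      (d * \1_(superlevel g (k.+1%:R * d)) y)%:E + d%:E <= (K.+1%:R * d)%:E.
    by rewrite -natr1 mulrDl mul1r EFinD leeD2r.
  by split => //; apply: le_trans le (ltW gK).
have -> : (y \in superlevel g (K.+1%:R * d)) = false.
  by apply/negbTE; rewrite notin_setE /= => /lt_geF; rewrite gK.
rewrite mulr0 adde0; split => //; apply: le_trans IH1 _.
by rewrite lee_fin ler_pM2r// ler_nat.
Qed.

Lemma level_steps_ge (g : Y -> \bar R) (d : R) K y : (0 < d)%R -> 0 <= g y ->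
  mine (g y) (K%:R * d)%:E <= level_steps g d K y + d%:E.
Proof.
move=> d0 gy0; rewrite /level_steps.
set S := fun K => \sum_(k < K) (d * \1_(superlevel g (k.+1%:R * d)) y)%:E.
(* Either the staircase has come within one step of [g], or all its steps so far were taken. *)
suff H : g y <= S K + d%:E \/ S K = (K%:R * d)%:E.
  rewrite -/(S K); rewrite ge_min; case: H => [->//|->].
  by rewrite -EFinD lee_fin lerDl (ltW d0) orbT.
elim: K => [|K [IH|IH]]; first by right; rewrite /S big_ord0 mul0r.
  left; apply: le_trans IH _; rewrite leeD2r// /S big_ord_recr/=.
  by rewrite leeDl// lee_fin mulr_ge0// ltW.
have [gK|gK] := ltP ((K.+1%:R * d)%:E) (g y); [right|left].
  rewrite /S big_ord_recr/= -/(S K) IH indicE.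
  have -> : y \in superlevel g (K.+1%:R * d) by rewrite inE.
  by rewrite mulr1 -EFinD -natr1 mulrDl mul1r.
apply: le_trans gK _; rewrite -natr1 mulrDl mul1r EFinD leeD2r// -IH.
by rewrite /S big_ord_recr/= leeDl// lee_fin mulr_ge0// ltW.
Qed.

Lemma level_steps_ge0 (g : Y -> \bar R) (d : R) K y : (0 <= d)%R ->
  0 <= level_steps g d K y.
Proof. by move=> d0; apply: sume_ge0 => k _; rewrite lee_fin mulr_ge0. Qed.

Lemma measurable_level_steps (g : Y -> \bar R) (d : R) K :
  lower_semicontinuous g ->
  measurable_fun setT (level_steps g d K : borel y0 -> \bar R).
Proof.
move=> /lower_semicontinuousP lg; apply: emeasurable_sum => k.
apply/measurable_EFinP; apply: measurable_funM => //.
by apply: measurable_indic; apply: open_borel; exact: lg.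
Qed.

Lemma integral_level_steps (mu : probability (borel y0) R)
    (g : Y -> \bar R) (d : R) K : (0 <= d)%R -> lower_semicontinuous g ->
  \int[mu]_y level_steps g d K y =
    \sum_(k < K) d%:E * mu (superlevel g (k.+1%:R * d)).
Proof.
move=> d0 /lower_semicontinuousP lg.
have mU (t : R) : measurable (superlevel g t : set (borel y0)).
  by apply: open_borel; exact: lg.
rewrite /level_steps.
rewrite (@ge0_integral_sum _ (borel y0) R mu setT measurableT _
  (fun (k : 'I_K) y => (d * \1_(superlevel g (k.+1%:R * d)) y)%:E)); last 2 first.
- by move=> k; apply/measurable_EFinP; apply: measurable_funM.
- by move=> k x _; rewrite lee_fin mulr_ge0.
apply: eq_bigr => k _; under eq_integral do rewrite EFinM.
rewrite ge0_integralZl_EFin//.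
- by rewrite integral_indic// setIT.
- by apply/measurable_EFinP; exact: measurable_indic.
Qed.

(** A single staircase with enough steps of height [e] approximates the truncation of [g] at height
    [n] up to [e]; monotone convergence then removes the truncation. *)
Lemma integral_le_level_steps (mu : probability (borel y0) R)
    (g : Y -> \bar R) (s : \bar R) : (forall y, 0 <= g y) ->
  lower_semicontinuous g ->
  (forall (d : R) K, (0 < d)%R -> \int[mu]_y level_steps g d K y <= s) ->
  \int[mu]_y g y <= s.
Proof.
move=> g0 lg H; have mg := lsc_measurable lg.
pose h (n : nat) y := mine (g y) n%:R%:E.
have h0 n y : 0 <= h n y by rewrite /h le_min g0 lee_fin ler0n.
have mh n : measurable_fun setT (h n : borel y0 -> \bar R).
  by apply: measurable_mine.
have ndh y : {homo h ^~ y : n m / (n <= m)%N >-> n <= m}.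
  move=> n m nm; rewrite /h le_min ge_min lexx/= ge_min.
  by rewrite lee_fin ler_nat nm orbT.
have hg y : limn (h ^~ y) = g y.
  apply/cvg_lim => //; have -> : g y = ereal_sup (range (h ^~ y)).
    apply: le_anti; apply/andP; split; last first.
      by apply: ge_ereal_sup => _ [n _ <-]; rewrite /h ge_min lexx.
    rewrite leNgt; apply/negP => lt.
    have [r rs] : exists r : R, ereal_sup (range (h ^~ y)) <= r%:E /\ r%:E < g y.
      have s0 : 0 <= ereal_sup (range (h ^~ y)).
        apply: le_ereal_sup_tmp; exists (h 0%N y) => //; by exists 0%N.
      move: s0 lt; case: (ereal_sup _) => [r _ rg|_|//]; first by exists r.
      by rewrite ltNge leey.
    have [r1 r2] := rs.
    have rn := archi_boundP (normr_ge0 r); set n := Num.bound _ in rn.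
    have : h n y <= r%:E.
      by apply: le_trans r1; apply: ereal_sup_ubound; exists n.
    rewrite /h ge_min leNgt r2/= lee_fin leNgt.
    by rewrite (le_lt_trans (ler_norm _) rn).
  exact: ereal_nondecreasing_cvgn.
have cvgI : \int[mu]_y h n y @[n --> \oo] --> \int[mu]_y g y.
  have -> : \int[mu]_y g y = \int[mu]_y limn (h ^~ y).
    by apply: eq_integral => y _; rewrite hg.
  by apply: cvg_monotone_convergence => //= y _; exact: ndh.
have hs n : \int[mu]_y h n y <= s.
  apply/lee_addgt0Pr => e e0.
  have [K Ke] : exists K : nat, (n%:R <= K%:R * e)%R.
    exists (Num.bound (n%:R / e)%R); rewrite -ler_pdivrMr//.
    by apply: ltW; apply: archi_boundP; rewrite divr_ge0// ltW.
  apply: (@le_trans _ _ (\int[mu]_y (level_steps g e K y + e%:E))).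
    apply: ge0_le_integral => //.
    - by apply: emeasurable_funD; [exact: measurable_level_steps|].
    - move=> y _; apply: le_trans (level_steps_ge K e0 (g0 y)).
      by rewrite le_min ge_min lexx/= ge_min lee_fin Ke orbT.
  rewrite ge0_integralD//.
  - rewrite integral_cst// [X in _ * X](probability_setT mu) mule1 leeD2r//.
    exact: H.
  - by move=> y _; apply: level_steps_ge0; exact: ltW.
  - exact: measurable_level_steps.
  - by move=> y _; rewrite lee_fin ltW.
by apply: (cvge_to_le cvgI); apply: nearW.
Qed.

Variable rm : (set Y -> R) -> probability (borel y0) R.
Hypothesis rmP : forall m, invariant_mean y0 T m ->
  invariant_measures R y0 T (rm m) /\
  forall U, open U -> rm m U = inner_content m U.

(** The superlevel sets of [g] are open, so [rm m] measures each of them as a supremum of values of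
    [m] at closed subsets. A bound on the integral thus becomes a family of bounds on finite sums of
    values of [m], which are closed conditions for pointwise convergence; no continuity of [rm] is
    asked for. *)
Lemma integral_mean_leP m (g : Y -> \bar R) (s : \bar R) :
  invariant_mean y0 T m -> (forall y, 0 <= g y) -> lower_semicontinuous g ->
  (\int[rm m]_y g y <= s <-> forall (d : R) K (C : nat -> set Y), (0 < d)%R ->
    (forall k, closed (C k) /\ C k `<=` (superlevel g (k.+1%:R * d))) ->
    (\sum_(k < K) d * m (C k))%:E <= s).
Proof.
move=> im g0 lg; have [_ rmU] := rmP im.
have oU t : open (superlevel g t) by move/lower_semicontinuousP : lg; exact.
split=> [Is d K C d0 HC|H].
  apply: le_trans Is; apply: (@le_trans _ _ (\int[rm m]_y level_steps g d K y)).
    rewrite integral_level_steps ?(ltW d0)// -sumEFin; apply: lee_sum => k _.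
    rewrite EFinM lee_pmul2l// (rmU _ (oU _)).
    by have [clC CU] := HC k; exact: le_inner_content.
  apply: ge0_le_integral => //.
  - by move=> y _; apply: level_steps_ge0; exact: ltW.
  - exact: measurable_level_steps.
  - exact: lsc_measurable.
  - by move=> y _; exact: level_steps_le.
apply: integral_le_level_steps => // d K d0.
rewrite integral_level_steps ?(ltW d0)//.
apply/lee_addgt0Pr => e e0.
(* The [K] inner approximations, each weighted by [d], cost at most [e] together; [K.+1] keeps the
   quotient meaningful for [K = 0]. *)
have e'0 : (0 < e / (K.+1%:R * d))%R by rewrite divr_gt0// mulr_gt0.
have rfin U : open U -> inner_content m U \is a fin_num.
  by move=> oV; rewrite -rmU// prob_fin//; exact: open_borel.
have /choice[C HC] k : exists C, [/\ closed C,
    C `<=` (superlevel g (k.+1%:R * d)) &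
    rm m (superlevel g (k.+1%:R * d)) <=
      (m C + e / (K.+1%:R * d))%:E].
  rewrite (rmU _ (oU _)); have [_ [C [clC CU] <-] Ce] :=
    ub_ereal_sup_adherent e'0 (rfin _ (oU (k.+1%:R * d)%R)).
  exists C; split => //.
  by rewrite EFinD -leeBlDr// ltW.
apply: (@le_trans _ _ ((\sum_(k < K) d * m (C k))%:E + e%:E)); last first.
  by rewrite leeD2r//; apply: H => // k; have [] := HC k.
apply: (@le_trans _ _ (\sum_(k < K) (d * (m (C k) + e / (K.+1%:R * d)))%:E)).
  apply: lee_sum => k _; rewrite EFinM lee_pmul2l//.
  by have [] := HC k.
rewrite sumEFin -EFinD lee_fin.
under eq_bigr do rewrite mulrDr; rewrite big_split/= lerD2l.
rewrite sumr_const card_ord -(mulr_natl _ K).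
rewrite (_ : _ * _ = (K%:R / K.+1%:R) * e)%R; last first.
  have : (K.+1%:R : R) != 0%R by rewrite pnatr_eq0.
  by move: K.+1%:R => N N0; field; rewrite N0 gt_eqF.
by rewrite ger_pMl// ler_pdivrMr// mul1r ler_nat.
Qed.

Lemma continuous_weighted_eval (d : R) K (C : nat -> set Y) :
  continuous (fun m : {ptws set Y -> R} => \sum_(k < K) d * m (C k))%R.
Proof.
elim: K => [|K IH] m.
  have -> : (fun m : {ptws set Y -> R} => \sum_(k < 0) d * m (C k))%R =
      cst 0%R by apply/funext => ?; rewrite big_ord0.
  exact: (@cst_continuous {ptws set Y -> R} R 0%R m).
have -> : (fun m : {ptws set Y -> R} => \sum_(k < K.+1) d * m (C k))%R =
    (fun m => \sum_(k < K) d * m (C k) + d * m (C K))%R.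
  by apply/funext => m'; rewrite big_ord_recr.
exact: (cvgD (IH m) (cvgM (cvg_cst d) (@continuous_eval R Y (C K) m))).
Qed.

(** This is lower semicontinuity of the integral as a function of the mean: the criterion by finite
    sums writes the set as an intersection of closed conditions. *)
Lemma closed_integral_mean_le (g : Y -> \bar R) (s : \bar R) :
  (forall y, 0 <= g y) -> lower_semicontinuous g ->
  closed ([set m | invariant_mean y0 T m /\ \int[rm m]_y g y <= s]
    : set {ptws set Y -> R}).
Proof.
move=> g0 lg.
have -> : [set m | invariant_mean y0 T m /\ \int[rm m]_y g y <= s] =
  ([set m | invariant_mean y0 T m] : set {ptws set Y -> R}) `&`
  \bigcap_(c in [set c : R * nat * (nat -> set Y) | (0 < c.1.1)%R /\
    forall k, closed (c.2 k) /\ c.2 k `<=` (superlevel g (k.+1%:R * c.1.1))])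
    [set m | (\sum_(k < c.1.2) c.1.1 * m (c.2 k))%:E <= s].
  apply/seteqP; split=> m [im H]; split => //.
    move=> [[d K] C] [/= d0 HC].
    by have [+ _] := integral_mean_leP s im g0 lg; apply.
  have [_] := integral_mean_leP s im g0 lg; apply => d K C d0 HC.
  exact: (H ((d, K), C)).
apply: closedI.
  apply: compact_closed; last exact: compact_invariant_means.
  by apply: hausdorff_product => _; exact: Rhausdorff.
apply: closed_bigI => -[[d K] C] _ /=.
have cS := @continuous_weighted_eval d K C.
case: s => [s| |].
- under eq_set do rewrite lee_fin.
  have -> : [set m : {ptws set Y -> R} | (\sum_(k < K) d * m (C k) <= s)%R] =
    (fun m : {ptws set Y -> R} => \sum_(k < K) d * m (C k))%R @^-1`
      [set x | (x <= s)%R] by [].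
  by apply: closed_comp; [move=> m _; exact: cS|exact: closed_le].
- rewrite (_ : mkset _ = setT); first exact: closedT.
  by apply/seteqP; split=> m //= _; rewrite leey.
- rewrite (_ : mkset _ = set0); first exact: closed0.
  by apply/seteqP; split=> m //=; rewrite leeNy_eq.
Qed.

End LowerSemicontinuousIntegral.

Arguments lsc_measurable {R Y} y0 [g].

(** The sets [K & F i] generate a proper filter because the family is directed downwards; any
    cluster point of it lies in every closed [F i]. *)
Lemma compact_directed_nonempty {Y : topologicalType} {I : Type} (K : set Y)
    (D : set I) (F : I -> set Y) :
  compact K -> D !=set0 -> (forall i, D i -> closed (F i)) ->
  (forall i, D i -> K `&` F i !=set0) ->
  (forall i j, D i -> D j -> exists2 k, D k & F k `<=` F i `&` F j) ->
  K `&` \bigcap_(i in D) F i !=set0.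
Proof.
move=> cK [i0 Di0] clF F0 dir.
have fF : Filter (filter_from D (fun i => K `&` F i)).
  apply: filter_from_filter; first by exists i0.
  move=> i j Di Dj; have [k Dk Hk] := dir _ _ Di Dj; exists k => //.
  by move=> x [Kx /Hk []]; split.
have pF := filter_from_proper fF F0.
have [|x [Kx clx]] := cK _ pF; first by exists i0.
exists x; split => // i Di; apply: clF => //.
move=> B Bx; have [|y [[_ Fy] By]] := clx (K `&` F i) B _ Bx; first by exists i.
by exists y.
Qed.

(** The average of [x] and [y] does not exceed [y]; since [p > 0], neither does [x], which is then
    below the average. Infinite values are treated apart, with [0 * +oo = 0] when [p = 1]. *)
Lemma convex_comb_min {R : realType} (p : R) (x y : \bar R) :
  0 < p -> p <= 1 -> (0 <= x)%E -> (0 <= y)%E ->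
  (p%:E * x + (1 - p)%:E * y <= y)%E -> (x <= p%:E * x + (1 - p)%:E * y)%E.
Proof.
move=> p0 p1; case: x => [x| |] // x0; case: y => [y| |] // y0.
- rewrite -!EFinM -!EFinD !lee_fin => le.
  have xy : x <= y by rewrite -(ler_pM2l p0); lra.
  have : (1 - p) * x <= (1 - p) * y by rewrite ler_wpM2l// subr_ge0.
  lra.
- have [->|np1] := eqVneq p 1; first by rewrite subrr mul0e adde0 mul1e.
  have q0 : (0 < (1 - p)%:E)%E by rewrite lte_fin subr_gt0 lt_neqAle np1.
  by rewrite (gt0_muley q0) -EFinM addey ?leey.
- by rewrite gt0_muley ?lte_fin// -EFinM addye ?leey.
- have [->|np1] := eqVneq p 1; first by rewrite subrr mul0e adde0 mul1e.
  have q0 : (0 < (1 - p)%:E)%E by rewrite lte_fin subr_gt0 lt_neqAle np1.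
  by rewrite (gt0_muley q0) !gt0_muley ?lte_fin.
Qed.

(** * Ergodic minimizers of lower semicontinuous integrals *)

Section ErgodicMinimizer.
Context {R : realType} {Y : topologicalType} (y0 : Y) (T : Y -> Y).
Hypotheses (hY : hausdorff_space Y) (cY : compact [set: Y])
  (cT : continuous T).
Local Open Scope ereal_scope.

(** Conditioning on [w] keeps invariance because [w] is its own preimage, so that
    [T^-1 (B & w) = T^-1 B & w]. Regularity at [B] is regularity of [mu] at [B & w] with the error
    scaled by [mu w]. *)
Lemma conditional_invariant_measure (mu : probability (borel y0) R)
    (w : set Y) : invariant_measures R y0 T mu ->
  measurable (w : set (borel y0)) -> T @^-1` w = w -> 0 < mu w ->
  exists nu, invariant_measures R y0 T nu /\
    forall B : set Y, measurable (B : set (borel y0)) ->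
      mu (B `&` w) = mu w * nu B.
Proof.
move=> [rmu imu] mw iw w0.
pose nu : probability (borel y0) R := mnormalize (mrestr mu mw) mu.
have fw := prob_fin mu mw.
have w'0 : (0 < fine (mu w))%R by rewrite -lte_fin fineK.
have nuE (B : set Y) : nu B = mu (B `&` w) * (fine (mu w))^-1%:E.
  rewrite /nu/= /mnormalize/= /mrestr setTI gt_eqF//=.
  by rewrite lt_eqF//= -ge0_fin_numE.
have E (B : set Y) : measurable (B : set (borel y0)) ->
    mu (B `&` w) = mu w * nu B.
  move=> mB; rewrite nuE muleCA -[X in X * _%:E](fineK fw) -EFinM divff ?gt_eqF//.
  by rewrite mule1.
exists nu; split => //; split.
  apply: radonP => // B e mB e0.
  have mBw : measurable (B `&` w : set (borel y0)) by exact: measurableI.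
  have e'0 : (0 < e * fine (mu w))%R by rewrite mulr_gt0.
  have [C [cC CB Ce]] := radon_inner_approx hY rmu mBw e'0.
  exists C; split => //; first by move=> x /CB [].
  rewrite !nuE (_ : C `&` w = C); last by apply/setIidl => x /CB [].
  have fC : mu C \is a fin_num by apply: prob_fin; exact: compact_borel.
  have fB := prob_fin mu mBw.
  move: Ce; rewrite -(fineK fC) -(fineK fB) -!EFinM -!EFinD !lee_fin => Ce.
  by rewrite ler_pdivrMr// mulrDl mulfVK ?gt_eqF.
move=> B mB; rewrite !nuE; congr (_ * _).
by rewrite -{1}iw -preimage_setI imu//; exact: measurableI.
Qed.

Lemma integral_probD (mu nu1 nu2 : probability (borel y0) R) (p q : R)
    (g : Y -> \bar R) : (0 <= p)%R -> (0 <= q)%R -> (forall y, 0 <= g y) ->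
  measurable_fun setT (g : borel y0 -> \bar R) ->
  (forall B : set Y, measurable (B : set (borel y0)) ->
    mu B = p%:E * nu1 B + q%:E * nu2 B) ->
  \int[mu]_y g y = p%:E * \int[nu1]_y g y + q%:E * \int[nu2]_y g y.
Proof.
move=> p0 q0 g0 mg H.
rewrite (eq_measure_integral
  (measure_add (mscale (NngNum p0) nu1) (mscale (NngNum q0) nu2))); last first.
  move=> B mB _; transitivity (p%:E * nu1 B + q%:E * nu2 B).
    exact: H.
  exact/esym/(measure_addE (mscale (NngNum p0) nu1) (mscale (NngNum q0) nu2)).
by rewrite ge0_integral_measure_add// !ge0_integral_mscale.
Qed.

Lemma lsc_indic (U : set Y) : open U ->
  lower_semicontinuous (fun y => (\1_U y : R)%:E).
Proof.
move=> oU; apply/lower_semicontinuousP => t.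
have [t0|t0] := ltP t 0%R; [|have [t1|t1] := ltP t 1%R].
- rewrite (_ : mkset _ = setT); first exact: openT.
  by apply/seteqP; split=> // y _; rewrite /= lte_fin (lt_le_trans t0).
- rewrite (_ : mkset _ = U) => //; apply/seteqP; split=> y /=.
    rewrite indicE; have [/set_mem//|_] := boolP (y \in U).
    by rewrite lte_fin ltNge t0.
  by move=> Uy; rewrite indicE mem_set// lte_fin.
- rewrite (_ : mkset _ = set0); first exact: open0.
  apply/seteqP; split=> // y /=; rewrite lte_fin ltNge (le_trans _ t1)//.
Qed.

Variable rm : (set Y -> R) -> probability (borel y0) R.
Hypothesis rmP : forall m, invariant_mean y0 T m ->
  invariant_measures R y0 T (rm m) /\
  forall U, open U -> rm m U = inner_content m U.

Lemma mean_measureK (nu : probability (borel y0) R) :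
  invariant_measures R y0 T nu ->
  forall B : set Y, measurable (B : set (borel y0)) ->
    rm (mean_of nu) B = nu B.
Proof.
move=> inu; have [[rrm _] rmU] := rmP (invariant_mean_of cT inu).
have [rnu _] := inu.
apply: open_agree_measure => // U oU.
by rewrite rmU// inner_content_mean_of.
Qed.

Lemma integral_mean_measureK (nu : probability (borel y0) R)
    (g : Y -> \bar R) : invariant_measures R y0 T nu ->
  \int[rm (mean_of nu)]_y g y = \int[nu]_y g y.
Proof.
move=> inu; apply: eq_measure_integral => B mB _; exact: mean_measureK.
Qed.

(* The substitute for a closed face of the simplex of invariant measures: only
   decompositions along invariant Borel sets are needed. *)
Definition mean_face (G : set {ptws set Y -> R}) : Prop :=
  [/\ closed G, G !=set0, forall m, G m -> invariant_mean y0 T m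
    & forall m (w : set Y) nu, G m -> measurable (w : set (borel y0)) ->
      T @^-1` w = w -> 0 < rm m w -> invariant_measures R y0 T nu ->
      (forall B : set Y, measurable (B : set (borel y0)) ->
        rm m (B `&` w) = rm m w * nu B) -> G (mean_of nu)].

Lemma compact_mean_face G : mean_face G -> compact G.
Proof.
move=> [clG _ Gm _].
exact: (subclosed_compact clG (@compact_invariant_means R Y y0 T) Gm).
Qed.

Definition argmin_face (G : set {ptws set Y -> R}) (g : Y -> \bar R) :=
  [set m | G m /\ forall m', G m' -> \int[rm m]_y g y <= \int[rm m']_y g y].

(** The minimum is attained since the sublevel sets are closed, nonempty and totally ordered in a
    compact set. For stability, split a minimizer along [w] and its complement: its integral is the
    average of the two conditional integrals, both components stay in [G], and by minimality the
    average does not exceed the second one, hence the first is minimal too. *)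
Lemma argmin_faceP (G : set {ptws set Y -> R}) (g : Y -> \bar R) :
  mean_face G -> (forall y, 0 <= g y) -> lower_semicontinuous g ->
  mean_face (argmin_face G g).
Proof.
move=> fG g0 lg; have [clG G0 Gm Gs] := fG.
have mg := lsc_measurable y0 lg.
pose F m' : set {ptws set Y -> R} :=
  [set m | invariant_mean y0 T m /\ \int[rm m]_y g y <= \int[rm m']_y g y].
have clF m' : closed (F m') by exact: closed_integral_mean_le.
have E : argmin_face G g = G `&` \bigcap_(m' in G) F m'.
  apply/seteqP; split=> m [Gm1 H]; split => //.
    by move=> m' Gm'; split; [exact: Gm|exact: H].
  by move=> m' Gm'; have [] := H _ Gm'.
split.
- by rewrite E; apply: closedI => //; apply: closed_bigI => m' _.
- rewrite E; apply: compact_directed_nonempty => //.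
  + exact: compact_mean_face.
  + by move=> m Gm1; exists m; split => //; split => //; exact: Gm.
  + move=> m1 m2 G1 G2.
    have [le|/ltW le] := leP (\int[rm m1]_y g y) (\int[rm m2]_y g y).
      by exists m1 => // m [im Hm]; do 2?split => //; exact: le_trans le.
    by exists m2 => // m [im Hm]; do 2?split => //; exact: le_trans le.
- by move=> m [Gm1 _]; exact: Gm.
move=> m w nu [Gm1 mmin] mw iw w0 inu nuE; have Gnu := Gs _ _ _ Gm1 mw iw w0 inu nuE.
split => // m' Gm'; rewrite integral_mean_measureK//.
apply: le_trans (mmin _ Gm').
have [imu _] := rmP (Gm _ Gm1).
have fw := prob_fin (rm m) mw.
have mw' : measurable (~` w : set (borel y0)) by exact: measurableC.
have w'E := prob_setC (rm m) mw.
set p := fine (rm m w); have pE : rm m w = p%:E by rewrite fineK.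
have p0 : (0 < p)%R by rewrite -lte_fin -pE.
have w'q : rm m (~` w) = (1 - p)%:E by rewrite w'E pE.
have q0 : (0 <= 1 - p)%R by rewrite -lee_fin -w'q.
have dec (B : set Y) : measurable (B : set (borel y0)) ->
    rm m B = rm m (B `&` w) + rm m (B `&` ~` w).
  move=> mB; have {1}-> : B = (B `&` w) `|` (B `&` ~` w).
    by rewrite -setIUr setUv setIT.
  rewrite measureU//.
  - exact: measurableI.
  - exact: measurableI.
  - by rewrite setIACA setICr setI0.
(* The second component is the conditional measure on the complement of [w]; if that set is null,
   its weight [1 - p] vanishes and [nu] itself can take its place. *)
have [nu2 [Gnu2 nu2E]] : exists nu2 : probability (borel y0) R,
    G (mean_of nu2) /\ \int[rm m]_y g y =
      p%:E * \int[nu]_y g y + (1 - p)%:E * \int[rm (mean_of nu2)]_y g y.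
  have [q'0|q'0] := eqVneq (1 - p)%R 0%R.
    exists nu; split => //; apply: integral_probD => //; first exact: ltW.
    move=> B mB; rewrite dec// nuE// -pE q'0 mul0e adde0.
    rewrite [X in _ + X](_ : _ = 0) ?adde0//; apply: le_anti.
    rewrite measure_ge0 andbT -[leRHS]/(0%R%:E) -q'0 -w'q.
    by apply: le_measure; rewrite ?inE//; exact: measurableI.
  have q''0 : 0 < rm m (~` w) by rewrite w'q lte_fin lt_neqAle eq_sym q'0.
  have iw' : T @^-1` (~` w) = ~` w by rewrite -preimage_setC iw.
  have [nu2 [inu2 nu2E]] := conditional_invariant_measure imu mw' iw' q''0.
  exists nu2; split; first exact: (Gs _ _ _ Gm1 mw' iw' q''0 inu2 nu2E).
  rewrite integral_mean_measureK//; apply: integral_probD => //; first exact: ltW.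
  by move=> B mB; rewrite dec// nuE// nu2E// pE w'q.
have le2 := mmin _ Gnu2; rewrite nu2E in le2 *.
by apply: convex_comb_min le2; rewrite ?integral_ge0// -lee_fin -pE probability_le1.
Qed.

End ErgodicMinimizer.

Section ErgodicMinimizerExistence.
Context {R : realType} {Y : topologicalType} (y0 : Y) (T : Y -> Y).
Hypotheses (hY : hausdorff_space Y) (cY : compact [set: Y])
  (cT : continuous T).
Local Open Scope ereal_scope.

Section Faces.
Variable rm : (set Y -> R) -> probability (borel y0) R.
Hypothesis rmP : forall m, invariant_mean y0 T m ->
  invariant_measures R y0 T (rm m) /\
  forall U, open U -> rm m U = inner_content m U.

(** Zorn's lemma for reverse inclusion: the intersection of a nonempty chain of faces is nonempty by
    compactness, and [G0] bounds the empty chain. *)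
Lemma minimal_mean_face (G0 : set {ptws set Y -> R}) :
  mean_face T rm G0 -> exists G, [/\ mean_face T rm G, G `<=` G0 &
    forall G', mean_face T rm G' -> G' `<=` G -> G' = G].
Proof.
move=> fG0; pose S := {G : set {ptws set Y -> R} | mean_face T rm G /\ G `<=` G0}.
pose r (s t : S) : bool := `[< sval t `<=` sval s >].
have [||||G Gmax] := @Zorn S r.
- by move=> t; apply/asboolP.
- move=> s t u /asboolP ts /asboolP ut; apply/asboolP.
  exact: subset_trans ut ts.
- move=> [s Ps] [t Pt] /asboolP/= ts /asboolP/= st.
  have E : s = t by exact/seteqP.
  by rewrite -E in Pt *; congr exist; exact: Prop_irrelevance.
- move=> A totA; have [A0|A0] := pselect (A !=set0); last first.
    exists (exist _ G0 (conj fG0 (@subset_refl _ G0))) => s As.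
    by exfalso; apply: A0; exists s.
  pose G := \bigcap_(s in A) sval s.
  have GG0 : G `<=` G0.
    by move=> m Gm; have [s As] := A0; apply: (svalP s).2; exact: Gm.
  suff fG : mean_face T rm G.
    exists (exist _ G (conj fG GG0)) => s As; apply/asboolP => m /=; exact.
  split.
  + by apply: closed_bigI => s As; have [[]] := svalP s.
  + have [|||||m [_ Gm]] := @compact_directed_nonempty {ptws set Y -> R} S
        [set m | invariant_mean y0 T m] A sval; last by exists m.
    * exact: (@compact_invariant_means R Y y0 T).
    * exact: A0.
    * by move=> s As; have [[]] := svalP s.
    * move=> s As; have [[_ [m sm] ims _] _] := svalP s; exists m; split => //.
      exact: ims.
    * move=> s t As At; have [/asboolP ts|/asboolP st] := totA _ _ As At.
        by exists t => // m tm; split => //; exact: ts.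
      by exists s => // m sm; split => //; exact: st.
  + by move=> m Gm; have [s As] := A0; have [[_ _ ims _] _] := svalP s;
      apply: ims; exact: Gm.
  + move=> m w nu Gm mw iw w0 inu nuE s As.
    have [[_ _ _ Gs] _] := svalP s; apply: (Gs m w) => //; exact: Gm.
case: G Gmax => G [fG GG0] Gmax; exists G; split => // G' fG' G'G.
have G'G0 := subset_trans G'G GG0.
have := Gmax (exist _ G' (conj fG' G'G0)).
move=> /(_ _)/(congr1 sval)/=; apply; exact/asboolP.
Qed.

(** Minimizing the measure of an open set over [G] gives a face inside [G], hence [G]: all members
    have the same measure at open sets, and so at Borel sets. If [w] is invariant of positive
    measure, the conditional measure [nu] also comes from [G], so [nu w = mu w]; together with
    [mu w = mu w * nu w] this gives [mu w = 1]. *)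
Lemma minimal_mean_face_ergodic (G : set {ptws set Y -> R}) :
  mean_face T rm G ->
  (forall G', mean_face T rm G' -> G' `<=` G -> G' = G) ->
  forall m, G m -> ergodic_measures R y0 T (rm m).
Proof.
move=> fG Gmin; have [_ _ Gim Gs] := fG.
have open_const m m' (U : set Y) : G m -> G m' -> open U -> rm m U <= rm m' U.
  move=> Gm Gm' oU; pose g y : \bar R := (\1_U y : R)%:E.
  have g0 y : 0 <= g y by rewrite lee_fin.
  have E : argmin_face rm G g = G.
    by apply: Gmin; [apply: argmin_faceP => //; exact: lsc_indic|move=> ? []].
  have : argmin_face rm G g m by rewrite E.
  move=> [_ /(_ _ Gm')]; have mU := open_borel y0 oU.
  by rewrite !integral_indic// !setIT.
have agree m m' : G m -> G m' -> forall B : set Y,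
    measurable (B : set (borel y0)) -> rm m B = rm m' B.
  move=> Gm Gm'; apply: open_agree_measure => //.
  - by have [[]] := rmP (Gim _ Gm).
  - by have [[]] := rmP (Gim _ Gm').
  - by move=> U oU; apply: le_anti; rewrite !open_const.
move=> m Gm; have [im _] := rmP (Gim _ Gm); split => // w mw iw.
have [->|w0] := eqVneq (rm m w) 0; [by left|right].
have w'0 : 0 < rm m w by rewrite lt_neqAle eq_sym w0 measure_ge0.
have [nu [inu nuE]] := conditional_invariant_measure hY im mw iw w'0.
have Gnu := Gs _ _ _ Gm mw iw w'0 inu nuE.
have nuw : nu w = rm m w.
  by rewrite -(mean_measureK hY cY cT rmP inu mw); exact: agree.
have := nuE w mw; rewrite setIid nuw.
have := prob_fin (rm m) mw; move: w'0; case: (rm m w) => // p.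
rewrite lte_fin => p0 _; rewrite -EFinM => -[/eqP].
by rewrite -subr_eq0 -{1}(mulr1 p) -mulrBr mulf_eq0 gt_eqF//= subr_eq0 => /eqP <-.
Qed.

End Faces.

Lemma ergodic_minimizer (g : Y -> \bar R) :
  (forall y, 0 <= g y) -> lower_semicontinuous g ->
  invariant_measures R y0 T !=set0 ->
  exists mu, ergodic_measures R y0 T mu /\
    forall nu, invariant_measures R y0 T nu ->
      \int[mu]_y g y <= \int[nu]_y g y.
Proof.
move=> g0 lg [nu0 inu0].
have [rm rmP] := @invariant_mean_measure R Y y0 T hY cY cT.
pose means : set {ptws set Y -> R} := [set m | invariant_mean y0 T m].
have f0 : mean_face T rm means.
  split => //.
  - apply: compact_closed; last exact: (@compact_invariant_means R Y y0 T).
    by apply: hausdorff_product => _; exact: Rhausdorff.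
  - by exists (mean_of nu0); exact: invariant_mean_of.
  - by move=> m w nu _ _ _ _ inu _; exact: invariant_mean_of.
have fg := argmin_faceP hY cY cT rmP f0 g0 lg.
have [G [fG Gg Gmin]] := minimal_mean_face fg.
have [_ [m Gm] _ _] := fG.
exists (rm m); split; first exact: (minimal_mean_face_ergodic rmP fG Gmin).
move=> nu inu; have [_ mmin] := Gg _ Gm.
by rewrite -(integral_mean_measureK hY cY cT rmP _ inu); apply: mmin;
  exact: invariant_mean_of.
Qed.

End ErgodicMinimizerExistence.

(** * Invariant measures carried by an orbit *)

Section OrbitMeasure.
Context {R : realType} {Y : topologicalType} (y0 : Y) (T : Y -> Y).
Hypotheses (hY : hausdorff_space Y) (cY : compact [set: Y])
  (cT : continuous T).

(** The Krylov-Bogolyubov averages, over [n + 1] points so that there is always something to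
    average. *)
Definition orbit_mean (y : Y) (n : nat) : {ptws set Y -> R} :=
  fun B => n.+1%:R^-1 * \sum_(i < n.+1) \1_B (iter i T y).

Lemma orbit_mean_ge0 y n B : 0 <= orbit_mean y n B.
Proof. by rewrite mulr_ge0 ?invr_ge0// sumr_ge0. Qed.

Lemma orbit_mean_le1 y n B : orbit_mean y n B <= 1.
Proof.
rewrite /orbit_mean mulrC ler_pdivrMr ?ltr0n// mul1r.
apply: (@le_trans _ _ (\sum_(i < n.+1) 1)).
  by apply: ler_sum => i _; rewrite indicE; case: (_ \in _).
by rewrite sumr_const card_ord.
Qed.

Lemma orbit_mean_preimage y n B :
  `|orbit_mean y n (T @^-1` B) - orbit_mean y n B| <= n.+1%:R^-1.
Proof.
rewrite /orbit_mean -mulrBr normrM ger0_norm ?invr_ge0// ler_piMr ?invr_ge0//.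
have -> : \sum_(i < n.+1) \1_(T @^-1` B) (iter i T y) =
    \sum_(i < n) \1_B (iter i.+1 T y) + \1_B (iter n.+1 T y) :> R.
  by rewrite big_ord_recr.
have -> : \sum_(i < n.+1) \1_B (iter i T y) =
    \1_B y + \sum_(i < n) \1_B (iter i.+1 T y) :> R.
  by rewrite big_ord_recl.
rewrite (_ : _ - _ = \1_B (iter n.+1 T y) - \1_B y :> R); last by ring.
rewrite !indicE.
by case: (_ \in _); case: (_ \in _);
  rewrite ?subrr ?subr0 ?sub0r ?normrN ?normr0 ?normr1.
Qed.

(** A cluster point [m] of the orbit means satisfies every closed condition that they satisfy
    eventually. Additivity holds for each of them, invariance up to [1 / (n + 1)]. The finite sums
    that characterize the bound on the integral are dominated by the averages of [g] along the
    orbit, hence by [c]. *)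
Lemma exists_orbit_measure (y : Y) (g : Y -> \bar R) (c : R) :
  (forall y, 0 <= g y)%E -> lower_semicontinuous g ->
  (forall n, \sum_(i < n) g (iter i T y) <= (n%:R * c)%:E)%E ->
  exists mu, invariant_measures R y0 T mu /\ (\int[mu]_x g x <= c%:E)%E.
Proof.
move=> g0 lg gc.
have [rm rmP] := @invariant_mean_measure R Y y0 T hY cY cT.
pose cube : set {ptws set Y -> R} := [set m | forall B, `[0%R, 1%R]%classic (m B)].
have ccube : compact cube.
  apply: (@tychonoff (set Y) (fun=> R) (fun=> `[0%R, 1%R]%classic)) => B.
  exact: segment_compact.
have acube n : cube (orbit_mean y n).
  by move=> B; rewrite /= in_itv/= orbit_mean_ge0 orbit_mean_le1.
have Fcube : (orbit_mean y @ \oo) cube by exists 0%N => // n _; exact: acube.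
have [m [cm clm]] := ccube _ (fmap_proper_filter _ eventually_filter) Fcube.
have closedm (C : set {ptws set Y -> R}) : closed C ->
    (\forall n \near \oo, C (orbit_mean y n)) -> C m.
  by move=> clC FC; apply: clC => B Bm; exact: clm.
have im : invariant_mean y0 T m.
  split.
  - by move=> B; have := cm B; rewrite /= in_itv.
  - apply: (closedm [set m | m setT = 1]).
      have -> : [set m : {ptws set Y -> R} | m setT = 1%R] =
        (fun m : {ptws set Y -> R} => m setT : R) @^-1` [set 1%R] by [].
      apply: closed_comp; last exact: closed_eq.
      by move=> m' _; exact: (@continuous_eval R Y setT m').
    apply: nearW => n /=; rewrite /orbit_mean.
    under eq_bigr do rewrite indicE in_setT.
    by rewrite sumr_const card_ord mulVf ?pnatr_eq0.
  - move=> A B mA mB AB.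
    apply: (closedm [set m | m (A `|` B) = m A + m B]).
      have -> : [set m : {ptws set Y -> R} | m (A `|` B) = m A + m B]%R =
          (fun m : {ptws set Y -> R} => m (A `|` B) - (m A + m B) : R)%R
            @^-1` [set 0%R].
        apply/seteqP; split=> m' /=; first by move=> ->; rewrite subrr.
        by move=> /eqP; rewrite subr_eq0 => /eqP.
      apply: closed_comp; last exact: closed_eq.
      move=> m' _; exact: (cvgB (@continuous_eval R Y (A `|` B) m')
        (cvgD (@continuous_eval R Y A m') (@continuous_eval R Y B m'))).
    apply: nearW => n /=; rewrite /orbit_mean -mulrDr -big_split/=.
    congr (_ * _); apply: eq_bigr => i _; rewrite !indicE in_setU.
    have [/set_mem Ax|_] := boolP (iter i T y \in A); last by rewrite add0r.
    rewrite /= memNset ?addr0// => Bx.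
    by have : (A `&` B) (iter i T y) by []; rewrite AB.
  - move=> B mB; apply/eqP; rewrite -subr_eq0 -normr_eq0 eq_le normr_ge0 andbT.
    apply/ler_addgt0Pr => e e0; rewrite add0r.
    apply: (closedm [set m | `|m (T @^-1` B) - m B| <= e]).
      have -> : [set m : {ptws set Y -> R} | `|m (T @^-1` B) - m B| <= e] =
        (fun m : {ptws set Y -> R} => `|m (T @^-1` B) - m B| : R)%R
            @^-1` [set x | x <= e]%R by [].
      apply: closed_comp; last exact: closed_le.
      move=> m' _; exact: (cvg_norm (cvgB
        (@continuous_eval R Y (T @^-1` B) m') (@continuous_eval R Y B m'))).
    near=> n; apply: le_trans (orbit_mean_preimage y n B) _.
    rewrite invf_ple ?posrE//.
    have : e^-1 < n%:R by near: n; exact: nbhs_infty_gtr.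
    by move=> /ltW/le_trans; apply; rewrite ler_nat.
exists (rm m); split; first by have [] := rmP _ im.
have [_] := integral_mean_leP rmP c%:E im g0 lg; apply=> d K C d0 HC.
rewrite lee_fin.
apply: (closedm [set m | \sum_(k < K) d * m (C k) <= c]).
  have -> : [set m : {ptws set Y -> R} | \sum_(k < K) d * m (C k) <= c] =
    (fun m : {ptws set Y -> R} => \sum_(k < K) d * m (C k) : R)
      @^-1` [set x | x <= c] by [].
  apply: closed_comp; last exact: closed_le.
  by move=> m' _; exact: (@continuous_weighted_eval R Y d K C m').
apply: nearW => n /=.
rewrite /orbit_mean; under eq_bigr do rewrite mulrCA.
rewrite -mulr_sumr mulrC ler_pdivrMr ?ltr0n// mulrC -lee_fin.
apply: le_trans (gc n.+1); under eq_bigr do rewrite mulr_sumr.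
rewrite exchange_big/= -sumEFin; apply: lee_sum => i _.
apply: le_trans (level_steps_le K d0 (g0 _)).
rewrite -sumEFin; apply: lee_sum => k _; rewrite lee_fin ler_pM2l//.
have [_ CU] := HC k; rewrite !indicE.
have [/set_mem/CU Ux|_] := boolP (_ \in C k); last by [].
by rewrite mem_set.
Unshelve. all: by end_near. Qed.

Lemma exists_invariant_measure : invariant_measures R y0 T !=set0.
Proof.
have lsc0 : lower_semicontinuous (fun _ : Y => 0%E : \bar R).
  apply/lower_semicontinuousP => t; have [t0|t0] := ltP t%:E (0%E : \bar R).
    by rewrite (_ : mkset _ = setT); [exact: openT|apply/seteqP; split].
  rewrite (_ : mkset _ = set0); first exact: open0.
  by apply/seteqP; split=> // x /=; rewrite ltNge t0.
have [//|n|mu [imu _]] := @exists_orbit_measure y0 (fun=> 0%E) 0 _ lsc0.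
  by rewrite big1// mulr0.
by exists mu.
Qed.

End OrbitMeasure.

(** * Complex moduli and norms as real numbers *)

Section ComplexModulus.
Context {R : realType}.
Implicit Types z w : R[i].

Lemma cmodE z : `|z| = (cmod z)%:C.
Proof. by rewrite /cmod RRe_real// normr_real. Qed.

Lemma cmod_ge0 z : 0 <= cmod z.
Proof. by rewrite -ler0c -cmodE. Qed.

Lemma cmodM z w : cmod (z * w) = cmod z * cmod w.
Proof. by apply: complexI; rewrite rmorphM/= -!cmodE normrM. Qed.

Lemma cmodX z n : cmod (z ^+ n) = cmod z ^+ n.
Proof. by apply: complexI; rewrite rmorphXn/= -!cmodE normrX. Qed.

Lemma cmodN z : cmod (- z) = cmod z.
Proof. by apply: complexI; rewrite -!cmodE normrN. Qed.

Lemma cmodD z w : cmod (z + w) <= cmod z + cmod w.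
Proof. by rewrite -lecR rmorphD/= -!cmodE ler_normD. Qed.

Lemma cmodB z w : cmod (z - w) = cmod (w - z).
Proof. by rewrite -cmodN opprB. Qed.

Lemma cmod_eq0 z : (cmod z == 0) = (z == 0).
Proof.
by rewrite -(inj_eq (@complexI R)) -cmodE rmorph0 normr_eq0.
Qed.

Lemma cmod0 : cmod (0 : R[i]) = 0.
Proof. by apply/eqP; rewrite cmod_eq0. Qed.

Lemma cmod_gt0 z : (0 < cmod z) = (z != 0).
Proof. by rewrite lt_neqAle cmod_ge0 andbT eq_sym cmod_eq0. Qed.

Lemma cmod_real (x : R) : cmod x%:C = `|x|.
Proof.
by apply: complexI; rewrite -cmodE normc_def/= expr0n/= addr0 sqrtr_sqr.
Qed.

Lemma cmod1 : cmod (1 : R[i]) = 1.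
Proof. by rewrite (_ : 1 = 1%:C)// cmod_real normr1. Qed.

Lemma cmodV z : cmod z^-1 = (cmod z)^-1.
Proof. by apply: complexI; rewrite fmorphV/= -!cmodE normfV. Qed.

Lemma cmod_dist z w : `|cmod z - cmod w| <= cmod (z - w).
Proof.
rewrite ler_norml; apply/andP; split; last first.
  by rewrite lerBlDr -{1}(subrK w z) cmodD.
by rewrite lerNl opprB lerBlDr cmodB -{1}(subrK z w) cmodD.
Qed.

Lemma cmod_le_sum (x y : R) : cmod (x +i* y) <= `|x| + `|y|.
Proof.
rewrite (complexE (x +i* y)) /=; apply: le_trans (cmodD _ _) _.
rewrite cmodM !cmod_real (_ : cmod 'i%C = 1) ?mul1r//.
by apply: complexI; rewrite -cmodE normc_def/= expr0n/= expr1n add0r sqrtr1.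
Qed.

Lemma cmod_ge_Re (x y : R) : `|x| <= cmod (x +i* y).
Proof. by rewrite -lecR -cmodE; exact: (normc_ge_Re (x +i* y)). Qed.

Lemma cmod_ge_Im (x y : R) : `|y| <= cmod (x +i* y).
Proof.
have <- : cmod (- 'i%C * (x +i* y)) = cmod (x +i* y).
  rewrite cmodM cmodN (_ : cmod 'i%C = 1) ?mul1r//.
  by apply: complexI; rewrite -cmodE normc_def/= expr0n/= expr1n add0r sqrtr1.
rewrite (_ : - 'i%C * (x +i* y) = y +i* (- x)); first exact: cmod_ge_Re.
by rewrite mulNr/=; apply/eqP; rewrite eq_complex/=; simpc.
Qed.

Lemma cvg_cmodP {T : Type} (F : set_system T) (FF : Filter F)
    (f : T -> R[i]^o) (l : R[i]^o) :
  f @ F --> l <-> forall e : R, 0 < e -> \forall t \near F, cmod (l - f t) < e.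
Proof.
split=> [/cvgrPdist_lt fl e e0|H].
  have e0' : 0 < e%:C :> R[i] by rewrite ltcR.
  by apply: filterS (fl _ e0') => t; rewrite cmodE ltcR.
apply/cvgrPdist_lt => e; case: e => e e'; rewrite ltcE/= => /andP[/eqP-> e0].
by apply: filterS (H _ e0) => t; rewrite cmodE complexr0 ltcR.
Qed.

Lemma cmod_continuous : continuous (fun z : R[i]^o => cmod z : R).
Proof.
move=> z; have FF : Filter (nbhs (z : R[i]^o)) := nbhs_filter _.
apply: (proj2 (@cvgrPdist_lt _ _ _ _ FF _ _)) => e e0.
have [H _] := @cvg_cmodP (R[i]^o) (nbhs z) (nbhs_filter z) id z.
near=> w; apply: le_lt_trans (cmod_dist _ _) _; near: w.
exact: (H (@cvg_id _ _)).
Unshelve. all: by end_near. Qed.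

Lemma complex_of_pair_continuous :
  continuous (fun u : R * R => (u.1 +i* u.2 : R[i]^o)).
Proof.
move=> u; apply/cvg_cmodP => e e0; have e20 : 0 < e / 2 by rewrite divr_gt0.
have near_dist (x : R) : \forall x' \near x, `|x - x'| < e / 2.
  by apply: (proj1 (cvgrPdist_lt id x) (@cvg_id _ _)).
exists ([set x | `|u.1 - x| < e / 2], [set y | `|u.2 - y| < e / 2]).
  by split; exact: near_dist.
move=> [x y] /= [Hx Hy].
have -> : (u.1 +i* u.2) - (x +i* y) = (u.1 - x) +i* (u.2 - y) by [].
by apply: le_lt_trans (cmod_le_sum _ _) _; rewrite [ltRHS]splitr; exact: ltrD.
Qed.

(** For [a <= 0] this is a closed disc; annuli carry the resolvents, discs the values of
    characters. *)
Lemma compact_annulus (a b : R) :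
  compact [set z : R[i]^o | a <= cmod z <= b].
Proof.
pose f (u : R * R) : R[i]^o := u.1 +i* u.2.
apply: (@subclosed_compact _ _ (f @` (`[- b, b]%classic `*` `[- b, b]%classic))).
- rewrite (_ : mkset _ = (fun z : R[i]^o => cmod z : R) @^-1` `[a, b]%classic).
    apply: closed_comp; last exact: interval_closed.
    by move=> z _; exact: cmod_continuous.
  by apply/seteqP; split=> z /=; rewrite in_itv.
- apply: continuous_compact.
    by apply: continuous_subspaceT; exact: complex_of_pair_continuous.
  by apply: compact_setX; exact: segment_compact.
- move=> [x y] /= /andP[_ zb]; exists (x, y) => //.
  split; rewrite /= in_itv/= -ler_norml; apply: le_trans zb.
    exact: cmod_ge_Re.
  exact: cmod_ge_Im.
Qed.

Lemma complex_hausdorff : hausdorff_space (R[i]^o).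
Proof. exact: norm_hausdorff. Qed.

End ComplexModulus.

Section RealNorm.
Context {R : realType} {V : normedModType R[i]}.
Implicit Types u v : V.

Lemma rnormE v : `|v| = (rnorm v)%:C.
Proof. by rewrite /rnorm RRe_real// normr_real. Qed.

Lemma rnorm_ge0 v : 0 <= rnorm v.
Proof. by rewrite -ler0c -rnormE. Qed.

Lemma rnormZ (z : R[i]) v : rnorm (z *: v) = cmod z * rnorm v.
Proof. by apply: complexI; rewrite rmorphM/= -cmodE -!rnormE normrZ. Qed.

Lemma rnormD u v : rnorm (u + v) <= rnorm u + rnorm v.
Proof. by rewrite -lecR rmorphD/= -!rnormE ler_normD. Qed.

Lemma rnormN v : rnorm (- v) = rnorm v.
Proof. by apply: complexI; rewrite -!rnormE normrN. Qed.

Lemma rnorm_eq0 v : (rnorm v == 0) = (v == 0).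
Proof. by rewrite -(inj_eq (@complexI R)) -rnormE rmorph0 normr_eq0. Qed.

Lemma rnorm0 : rnorm (0 : V) = 0.
Proof. by apply/eqP; rewrite rnorm_eq0. Qed.

End RealNorm.

(** * Bounds on powers from bounds on the resolvent *)

Section ResolventPowerBound.
Context {R : realType} {V : lmodType R[i]} (p : V -> R).
Hypotheses (p_ge0 : forall v, 0 <= p v)
  (pZ : forall z v, p (z *: v) = cmod z * p v)
  (pD : forall u v, p (u + v) <= p u + p v).
Context (T : V -> V) (S : R[i] -> V -> V) (rho MT : R).
Hypotheses (T_lin : linear T) (T_bnd : forall v, p (T v) <= MT * p v)
  (rho0 : 0 < rho)
  (S_lin : forall z, rho <= cmod z -> linear (S z))
  (S_bnd : forall z, rho <= cmod z -> exists K, forall v, p (S z v) <= K * p v)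
  (S_left : forall z v, rho <= cmod z -> p (S z (z *: v - T v) - v) = 0)
  (S_right : forall z v, rho <= cmod z -> p (z *: S z v - T (S z v) - v) = 0).

Lemma seminormN v : p (- v) = p v.
Proof. by rewrite -scaleN1r pZ cmodN cmod1 mul1r. Qed.

Lemma seminormB u v : p (u - v) = p (v - u).
Proof. by rewrite -seminormN opprB. Qed.

Lemma seminorm_le_dist u v : p u <= p (u - v) + p v.
Proof. by rewrite -{1}(subrK v u). Qed.

Lemma seminorm_dist3 u v w : p (u - w) <= p (u - v) + p (v - w).
Proof. by rewrite -(subrKA v u (- w)). Qed.

Lemma linear_B (f : V -> V) : linear f -> forall u v, f (u - v) = f u - f v.
Proof. by move=> fl u v; rewrite -scaleN1r addrC fl addrC scaleN1r. Qed.

Lemma linear_Z (f : V -> V) : linear f -> forall z v, f (z *: v) = z *: f v.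
Proof.
move=> fl z v; have f0 : f 0 = 0.
  by have := linear_B fl 0 0; rewrite !subrr.
by rewrite -[z *: v]addr0 fl f0 addr0.
Qed.

Lemma linear_D (f : V -> V) : linear f -> forall u v, f (u + v) = f u + f v.
Proof. by move=> fl u v; rewrite -{1}[u]scale1r fl scale1r. Qed.

Lemma iter_linear (f : V -> V) n : linear f -> linear (iter n f).
Proof. by move=> fl; elim: n => [|n IH] a u v //=; rewrite IH fl. Qed.

(** Apply [S w] to [(w - T) S z = (w - z) S z + 1]. As [p] is a seminorm, inverses and identities
    hold up to [p]-null vectors; in this form the argument serves both the norm of [A] and the
    quotient norm modulo a maximal ideal. *)
Lemma resolvent_identity z w v K : rho <= cmod z -> rho <= cmod w ->
  (forall v, p (S w v) <= K * p v) ->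
  p (S z v - S w ((w - z) *: S z v + v)) = 0.
Proof.
move=> hz hw HK; apply: le_anti; rewrite p_ge0 andbT.
pose x := w *: S z v - T (S z v).
apply: le_trans (seminorm_dist3 _ (S w x) _) _.
rewrite seminormB S_left// add0r -(linear_B (S_lin hw)).
apply: le_trans (HK _) _.
rewrite (_ : x - _ = z *: S z v - T (S z v) - v) ?S_right ?mulr0//.
rewrite /x scalerBl opprD addrA opprB; congr (_ - _).
by rewrite addrC addrA subrK.
Qed.

(** In the resolvent identity the term [(w - z) S z v] contributes at most half of [p (S z v)],
    which is absorbed on the left. *)
Lemma resolvent_bound_near z w K : 0 <= K -> rho <= cmod z -> rho <= cmod w ->
  (forall v, p (S w v) <= K * p v) -> cmod (w - z) * K <= 2^-1 ->
  forall v, p (S z v) <= 2 * K * p v.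
Proof.
move=> K0 hz hw HK near_zw v.
have := seminorm_le_dist (S z v) (S w ((w - z) *: S z v + v)).
rewrite (resolvent_identity _ hz hw HK) add0r => le1.
have := le_trans le1 (HK _).
have := pD ((w - z) *: S z v) v; rewrite pZ => le2 le3.
have := ler_wpM2l K0 le2 => le4; have := le_trans le3 le4.
have := ler_wpM2r (p_ge0 (S z v)) near_zw; rewrite mulrDr => le5.
have -> : K * (cmod (w - z) * p (S z v)) = cmod (w - z) * K * p (S z v) by ring.
move: (cmod _ * _ * _) le5 => c.
move: (p_ge0 (S z v)); lra.
Qed.

(** The bound available at each single point persists nearby up to a factor 2, and compactness of
    the annulus makes it uniform. *)
Lemma resolvent_bound_annulus M : exists2 K, 0 <= K &
  forall z, rho <= cmod z <= M -> forall v, p (S z v) <= K * p v.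
Proof.
have /compact_near_coveringP cA := @compact_annulus R rho M.
have [n _ Hn] : \forall n \near \oo, [set z : R[i]^o | rho <= cmod z <= M] `<=`
    [set z : R[i]^o | rho <= cmod z -> forall v, p (S z v) <= n%:R * p v].
  apply: cA => w /= /andP[hw _].
  have [K' HK'] := S_bnd hw; pose K := `|K'| + 1.
  have K0 : 0 < K by rewrite ltr_wpDl.
  have HK v : p (S w v) <= K * p v.
    apply: le_trans (HK' v) _; apply: ler_wpM2r => //.
    by rewrite /K (le_trans (ler_norm _))// lerDl.
  exists ([set z | cmod ((w : R[i]^o) - z) < (2 * K)^-1],
          [set n | (Num.bound (2 * K) <= n)%N]).
    split; last by exists (Num.bound (2 * K)).
    have [H _] := @cvg_cmodP R (R[i]^o) (nbhs (w : R[i]^o)) (nbhs_filter _) id w.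
    by apply: (H (@cvg_id _ _)); rewrite invr_gt0 mulr_gt0.
  move=> [z n] /= [zw nK] hz v.
  apply: le_trans (resolvent_bound_near (ltW K0) hz hw HK _ v) _.
    rewrite -ler_pdivlMr// (le_trans (ltW zw))// invfM.
    by rewrite lexx.
  apply: ler_wpM2r => //; apply: le_trans (_ : (Num.bound (2 * K))%:R <= _).
    by apply/ltW/archi_boundP; rewrite mulr_ge0// ltW.
  by rewrite ler_nat.
exists n%:R => // z hz; apply: (Hn n) => //=.
by have /andP[] := hz.
Qed.

(** A primitive [2^(k+1)]-th root of unity: multiplying the [2^k]-th roots by it yields exactly the
    remaining [2^(k+1)]-th roots. *)
Fixpoint dyadic_root (k : nat) : R[i] :=
  if k is k'.+1 then sqrtc (dyadic_root k') else -1.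

Lemma dyadic_rootE k : dyadic_root k ^+ (2 ^ k) = -1.
Proof.
elim: k => [|k IH]; first by rewrite expn0 expr1.
by rewrite expnS exprM sqr_sqrtc.
Qed.

Lemma cmod_dyadic_root k : cmod (dyadic_root k) = 1.
Proof.
elim: k => [|k IH]; first by rewrite /= cmodN cmod1.
apply/eqP; rewrite -(@eqrXn2 _ 2)// ?cmod_ge0//.
by rewrite -cmodX /= sqr_sqrtc IH expr1n.
Qed.

(* The average of [(1 - T / (z w))^-1] over the [2 ^ k]-th roots of unity [w],
   that is, [(1 - (T / z) ^ (2 ^ k))^-1]. *)
Fixpoint averaged_resolvent (k : nat) (z : R[i]) (v : V) : V :=
  if k is k'.+1 then
    2^-1 *: (averaged_resolvent k' z v +
             averaged_resolvent k' (dyadic_root k' * z) v)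
  else z *: S z v.

Lemma cmod_half : cmod (2^-1 : R[i]) = 2^-1.
Proof.
rewrite cmodV; congr (_^-1).
by rewrite (_ : 2 = 2%:C) ?cmod_real ?ger0_norm// rmorph_nat.
Qed.

Lemma averaged_resolvent_linear k z :
  rho <= cmod z -> linear (averaged_resolvent k z).
Proof.
elim: k z => [|k IH] z hz a u v /=.
  by rewrite S_lin// scalerDr !scalerA mulrC.
rewrite !IH ?cmodM ?cmod_dyadic_root ?mul1r//.
rewrite addrACA -scalerDr [LHS]scalerDr; congr (_ + _).
by rewrite !scalerA mulrC.
Qed.

(** Put [u = z^(2^k)] and [W = T^(2^k)]. The vector [(u^2 - W^2) v] is both [(u - W) (u + W) v] and
    [(- u - W) (W - u) v], so the induction hypothesis applies at [z] and at the rotated point,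
    whose power is [- u]. It returns [u (u + W) v] and [- u (W - u) v], with average [u^2 v]. *)
Lemma averaged_resolvent_left k z v : rho <= cmod z ->
  p (averaged_resolvent k z (z ^+ (2 ^ k) *: v - iter (2 ^ k) T v) -
     z ^+ (2 ^ k) *: v) = 0.
Proof.
elim: k z v => [|k IH] z v hz /=.
  by rewrite expn0 expr1 -scalerBr pZ S_left// mulr0.
have hwz : rho <= cmod (dyadic_root k * z).
  by rewrite cmodM cmod_dyadic_root mul1r.
set u := z ^+ (2 ^ k); pose W := iter (2 ^ k) T.
have Wl : linear W by exact: iter_linear.
have wzE : (dyadic_root k * z) ^+ (2 ^ k) = - u.
  by rewrite exprMn dyadic_rootE mulN1r.
have -> : z ^+ (2 ^ k.+1) = u * u by rewrite expnS mulnC exprM expr2.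
have -> : iter (2 ^ k.+1) T v = W (W v).
  by rewrite expnS mul2n -addnn iterD.
have := IH z (u *: v + W v) hz; have := IH _ (W v - u *: v) hwz.
rewrite wzE -/u -/W !(linear_B Wl) !(linear_D Wl) !(linear_Z Wl).
set y := (u * u) *: v - W (W v).
have -> : - u *: (W v - u *: v) - (W (W v) - u *: W v) = y.
  rewrite scaleNr scalerBr opprB scalerA opprB -addrA; congr (_ + _).
  by rewrite addrA addNr add0r.
have -> : u *: (u *: v + W v) - (u *: W v + W (W v)) = y.
  rewrite scalerDr scalerA opprD -addrA; congr (_ + _).
  by rewrite addrA subrr add0r.
set g1 := averaged_resolvent k z y; set g2 := averaged_resolvent k _ y.
move=> h2 h1; apply: le_anti; rewrite p_ge0 andbT.
rewrite (_ : _ - _ = 2^-1 *: ((g1 - u *: (u *: v + W v)) +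
    (g2 - (- u *: (W v - u *: v))))).
  rewrite pZ; apply: le_trans (ler_wpM2l (cmod_ge0 _) (pD _ _)) _.
  by rewrite h1 h2 addr0 mulr0.
have half2 : (2^-1 : R[i]) * 2 = 1 by rewrite mulVf.
rewrite addrACA -opprD scalerBr; congr (_ - _).
have -> : u *: (u *: v + W v) + (- u) *: (W v - u *: v) = 2 *: ((u * u) *: v).
  rewrite scaleNr [u *: (W v - _)]scalerBr opprB [u *: (_ + W v)]scalerDr.
  by rewrite scalerA addrACA subrr addr0 scaler_nat mulr2n.
by rewrite [RHS]scalerA half2 scale1r.
Qed.

Section Annulus.
Context (K M : R).
Hypotheses (K0 : 0 <= K)
  (SK : forall z, rho <= cmod z <= M -> forall v, p (S z v) <= K * p v).

Lemma averaged_resolvent_bound k z v : rho <= cmod z <= M ->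
  p (averaged_resolvent k z v) <= M * K * p v.
Proof.
elim: k z => [|k IH] z hz /=.
  rewrite pZ -mulrA; have /andP[_ zM] := hz.
  by apply: ler_pM => //; [exact: cmod_ge0|exact: SK].
rewrite pZ cmod_half; have := pD (averaged_resolvent k z v)
  (averaged_resolvent k (dyadic_root k * z) v).
have := IH z hz; have := IH (dyadic_root k * z).
rewrite cmodM cmod_dyadic_root mul1r => /(_ hz); lra.
Qed.

Lemma resolvent_lipschitz z w v : rho <= cmod z <= M -> rho <= cmod w <= M ->
  p (z *: S z v - w *: S w v) <= (K + M * K * K) * cmod (z - w) * p v.
Proof.
move=> hz hw; have /andP[hz1 hz2] := hz; have /andP[hw1 hw2] := hw.
have d1 : p (S z v - S w v) <= K * (cmod (z - w) * (K * p v)).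
  apply: le_trans (seminorm_dist3 _ (S w ((w - z) *: S z v + v)) _) _.
  rewrite (resolvent_identity _ hz1 hw1 (SK hw)) add0r.
  rewrite (linear_D (S_lin hw1)) addrK; apply: le_trans (SK hw _) _.
  by apply: ler_wpM2l => //; rewrite pZ cmodB ler_wpM2l ?cmod_ge0// SK.
rewrite (_ : _ - _ = (z - w) *: S z v + w *: (S z v - S w v)); last first.
  by rewrite scalerBl scalerBr addrA subrK.
apply: le_trans (pD _ _) _; rewrite !pZ.
have e1 : cmod (z - w) * p (S z v) <= cmod (z - w) * (K * p v).
  by rewrite ler_wpM2l ?cmod_ge0// SK.
have e2 : cmod w * p (S z v - S w v) <= M * (K * (cmod (z - w) * (K * p v))).
  by apply: ler_pM => //; exact: cmod_ge0.
by apply: le_trans (lerD e1 e2) _; rewrite le_eqVlt; apply/orP; left; apply/eqP; ring.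
Qed.

(** Rotations preserve distances, so averaging does not increase the Lipschitz constant of [z S z].
    Its independence of [k] is what allows a descent by steps of fixed length. *)
Lemma averaged_resolvent_lipschitz k z t v :
  rho <= cmod z <= M -> rho <= cmod (t * z) <= M ->
  p (averaged_resolvent k z v - averaged_resolvent k (t * z) v) <=
    (K + M * K * K) * cmod (z - t * z) * p v.
Proof.
elim: k z => [|k IH] z hz htz /=; first exact: resolvent_lipschitz.
rewrite -scalerBr pZ cmod_half opprD addrACA.
set x1 := _ - _; set x2 := _ - _.
have h1 : p x1 <= (K + M * K * K) * cmod (z - t * z) * p v by exact: IH.
have h2 : p x2 <= (K + M * K * K) * cmod (z - t * z) * p v.
  have hw y : cmod (dyadic_root k * y) = cmod y.
    by rewrite cmodM cmod_dyadic_root mul1r.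
  by have := IH (dyadic_root k * z); rewrite (mulrCA t) -mulrBr !hw => /(_ hz htz).
have := pD x1 x2; lra.
Qed.

(** That is, [T^(2^k) = o(l^(2^k))] uniformly in the vector. *)
Definition power_small (l : R) : Prop := forall e, 0 < e -> exists k0,
  forall k, (k0 <= k)%N -> forall v,
    p (iter (2 ^ k) T v) <= e * l ^+ (2 ^ k) * p v.

(** Smallness at [l] puts the averaged resolvent at [l] within [1/4] of the identity, and the
    Lipschitz bound moves it to [m] at the cost of another [1/4]. Being within [1/2] of the
    identity, it bounds [x = (m^(2^k) - T^(2^k)) v] by [2 m^(2^k) p v], whence the constant 3. *)
Lemma power_small_step l m : rho <= m -> m <= l -> l <= M ->
  (K + M * K * K) * (l - m) <= 4^-1 -> power_small l ->
  exists k0, forall k, (k0 <= k)%N -> forall v,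
    p (iter (2 ^ k) T v) <= 3 * m ^+ (2 ^ k) * p v.
Proof.
move=> rm ml lM Llm sml.
have m0 : 0 < m by exact: lt_le_trans rm.
have l0 : 0 < l by exact: lt_le_trans ml.
have M0 : 0 < M by exact: lt_le_trans lM.
have cl : cmod l%:C = l by rewrite cmod_real gtr0_norm.
have cm : cmod m%:C = m by rewrite cmod_real gtr0_norm.
have MK0 : 0 <= M * K by rewrite mulr_ge0// ltW.
(* With this tolerance the bound [M K] on the averaged resolvent produces the factor [1/4]. *)
have e0 : 0 < (4 * (M * K + 1))^-1 by rewrite invr_gt0 mulr_gt0// ltr_wpDl.
have [k0 Hk0] := sml _ e0; exists k0 => k kk0 v.
have hl : rho <= cmod l%:C <= M by rewrite cl (le_trans rm ml).
have hm : rho <= cmod m%:C <= M by rewrite cm rm (le_trans ml lM).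
have /andP[hl1 _] := hl; have /andP[hm1 _] := hm.
have near1 x : p (averaged_resolvent k l%:C x - x) <= 4^-1 * p x.
  set u := l%:C ^+ (2 ^ k).
  have cu : cmod u = l ^+ (2 ^ k) by rewrite cmodX cl.
  have u0 : 0 < cmod u by rewrite cu exprn_gt0.
  have gl := averaged_resolvent_linear k hl1.
  rewrite -(ler_pM2l u0) -pZ scalerBr.
  have := averaged_resolvent_left k x hl1; rewrite -/u => h0.
  have h1 := averaged_resolvent_bound k (iter (2 ^ k) T x) hl.
  have := seminorm_dist3 (u *: averaged_resolvent k l%:C x)
    (averaged_resolvent k l%:C (u *: x - iter (2 ^ k) T x)) (u *: x).
  rewrite h0 addr0 => /le_trans; apply.
  rewrite (linear_B gl) (linear_Z gl) opprB addrC subrK.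
  apply: le_trans h1 _; apply: le_trans (ler_wpM2l MK0 (Hk0 k kk0 x)) _.
  rewrite cu !mulrA -[leRHS]mulrA; rewrite mulrA.
  apply: ler_wpM2r => //; rewrite -mulrA mulrA [leRHS]mulrC.
  apply: ler_wpM2r; first by rewrite exprn_ge0// ltW.
  rewrite ler_pdivrMr ?mulr_gt0 ?ltr_wpDl// mulrA mulVf// mul1r.
  by rewrite lerDl.
have near2 x : p (averaged_resolvent k m%:C x - x) <= 2^-1 * p x.
  have mlE : (m / l)%:C * l%:C = m%:C by rewrite -rmorphM/= divfK ?gt_eqF.
  have := @averaged_resolvent_lipschitz k l%:C (m / l)%:C x hl.
  rewrite mlE => /(_ hm).
  rewrite -rmorphB/= cmod_real ger0_norm ?subr_ge0// => h1.
  have := seminorm_dist3 (averaged_resolvent k m%:C x)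
    (averaged_resolvent k l%:C x) x.
  rewrite [X in _ <= X + _]seminormB.
  have := ler_wpM2r (p_ge0 x) Llm; have := near1 x; lra.
set u := m%:C ^+ (2 ^ k).
have cu : cmod u = m ^+ (2 ^ k) by rewrite cmodX cm.
pose x := u *: v - iter (2 ^ k) T v.
have := averaged_resolvent_left k v hm1; rewrite -/u -/x => h0.
have h1 := seminorm_le_dist (averaged_resolvent k m%:C x) (u *: v).
rewrite h0 add0r pZ cu in h1.
have h2 := seminorm_le_dist x (averaged_resolvent k m%:C x).
rewrite (seminormB x) in h2; have h3 := near2 x.
have h4 := seminorm_le_dist (iter (2 ^ k) T v) (u *: v).
rewrite (seminormB _ (u *: v)) -/x pZ cu in h4; lra.
Qed.

Lemma power_small_gt m l : 0 < m -> m < l ->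
  (exists k0, forall k, (k0 <= k)%N -> forall v,
    p (iter (2 ^ k) T v) <= 3 * m ^+ (2 ^ k) * p v) -> power_small l.
Proof.
move=> m0 ml [k0 Hk0] e e0; have l0 := lt_trans m0 ml.
have q0 : 0 <= m / l by rewrite divr_ge0// ltW.
have q1 : m / l < 1 by rewrite ltr_pdivrMr// mul1r.
have [N _ HN] : \forall n \near \oo, (m / l) ^+ n < e / 3.
  have := @cvg_expr R (m / l); rewrite ger0_norm// => /(_ q1) /cvgr0_norm_lt.
  move=> /(_ (e / 3)); rewrite divr_gt0// => /(_ isT); apply: filterS => n.
  by rewrite ger0_norm// exprn_ge0.
exists (maxn k0 N) => k; rewrite geq_max => /andP[kk0 kN] v.
apply: le_trans (Hk0 k kk0 v) _; apply: ler_wpM2r => //.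
have := HN (2 ^ k)%N; rewrite /= (leq_trans kN (ltnW (ltn_expl _ _)))//.
move=> /(_ isT)/ltW; rewrite expr_div_n ler_pdivrMr ?exprn_gt0//.
lra.
Qed.

(** At [M], above the bound [MT] of [T], smallness is geometric decay. From there one descends by
    steps of [d / 2], where [d] is so small that the Lipschitz constant times [d] is at most [1/4];
    [j] counts the steps. *)
Lemma power_small_down : MT < M -> rho < M ->
  forall l, rho < l -> l <= M -> power_small l.
Proof.
move=> MTM rM.
have M0 := lt_trans rho0 rM.
pose L := K + M * K * K + 1.
have L0 : 0 < L by rewrite ltr_wpDl// addr_ge0// !mulr_ge0// ltW.
pose d := (4 * L)^-1; have d0 : 0 < d by rewrite invr_gt0 mulr_gt0.
have Ld x : x <= d -> 0 <= x -> (K + M * K * K) * x <= 4^-1.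
  move=> xd x0; apply: (@le_trans _ _ (L * d)).
    by apply: ler_pM => //; [rewrite addr_ge0// !mulr_ge0// ltW|rewrite lerDl].
  by rewrite /d invfM mulrCA mulfV ?gt_eqF// mulr1.
have smM : power_small M.
  pose m := Num.max (Num.max MT rho) 0 ; have m0 : 0 < m by rewrite !lt_max rho0 orbT.
  apply: (@power_small_gt m) => //; first by rewrite !gt_max MTM rM M0.
  exists 0%N => k _ v; apply: (@le_trans _ _ (m ^+ (2 ^ k) * p v)).
    elim: (2 ^ k)%N => [|n IH] /=; first by rewrite expr0 mul1r.
    apply: le_trans (T_bnd _) _; rewrite exprS -mulrA.
    apply: (@le_trans _ _ (m * p (iter n T v))).
      by apply: ler_wpM2r => //; rewrite /m !le_max lexx.
    by apply: ler_wpM2l => //; exact: ltW.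
  by apply: ler_wpM2r => //; rewrite ler_peMl ?exprn_ge0 ?ltW// ltr1n.
suff H j l : rho < l -> l <= M -> M - j%:R * (d / 2) <= l -> power_small l.
  move=> l rl lM; apply: (H (Num.bound (M / (d / 2)))) => //.
  apply: le_trans (ltW (lt_trans rho0 rl)).
  rewrite subr_le0 -ler_pdivrMr ?divr_gt0//; apply/ltW/archi_boundP.
  by rewrite !divr_ge0// ltW// divr_gt0.
elim: j l => [|j IH] l rl lM hl.
  by have -> : l = M by apply/eqP; rewrite eq_le lM; move: hl; rewrite mul0r subr0.
(* The level [l'] is settled by induction and [m] lies strictly below [l]: the gap between [m] and
   [l] absorbs the factor 3, while [l' - m <= d]. *)
pose l' := Num.min (l + d / 2) M; pose m := Num.max rho (l - d / 2).
have d20 : 0 < d / 2 by rewrite divr_gt0.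
have ll' : l <= l' by rewrite le_min lM lerDl ltW.
have ml : m < l by rewrite gt_max rl gtrBl.
apply: (@power_small_gt m) => //; first by rewrite lt_max rho0.
apply: (@power_small_step l') => //.
- by rewrite le_max lexx.
- exact: ltW (lt_le_trans ml ll').
- by rewrite ge_min lexx orbT.
- apply: Ld; last by rewrite subr_ge0 ltW// (lt_le_trans ml).
  have : l' <= l + d / 2 by rewrite ge_min lexx.
  have : l - d / 2 <= m by rewrite le_max lexx orbT.
  lra.
- apply: IH; [exact: lt_le_trans ll'|by rewrite ge_min lexx orbT|].
  rewrite le_min; apply/andP; split; first by move: hl; rewrite -natr1; lra.
  by rewrite gerBl mulr_ge0// ltW.
Qed.

End Annulus.

Lemma resolvent_power_small l : rho < l -> power_small l.
Proof.
move=> rl; pose M := Num.max (Num.max (MT + 1) (rho + 1)) l.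
have [K K0 SK] := resolvent_bound_annulus M.
apply: (power_small_down K0 SK) => //.
- by rewrite !lt_max ltrDl ltr01.
- by rewrite !lt_max ltrDl ltr01 orbT.
- by rewrite le_max lexx orbT.
Qed.

End ResolventPowerBound.

(** * Nonempty spectra and Neumann series *)

Section EntireResolvent.
Context {R : realType} {V : lmodType R[i]} (p : V -> R).
Hypotheses (p_ge0 : forall v, 0 <= p v)
  (pZ : forall z v, p (z *: v) = cmod z * p v)
  (pD : forall u v, p (u + v) <= p u + p v).
Context (T : V -> V) (S : R[i] -> V -> V) (MT : R).
Hypotheses (T_lin : linear T) (T_bnd : forall v, p (T v) <= MT * p v)
  (S_lin : forall z, linear (S z))
  (S_bnd : forall z, exists K, forall v, p (S z v) <= K * p v)
  (S_left : forall z v, p (S z (z *: v - T v) - v) = 0)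
  (S_right : forall z v, p (z *: S z v - T (S z v) - v) = 0).

(** The resolvent at 0 makes [T] bounded below: [p v <= K^n p (T^n v)]. A resolvent everywhere makes
    [T^(2^k)] smaller than [l^(2^k)] for every [l > 0]; the choice [l = 1 / (2 K)] is contradictory
    unless [p] vanishes. This replaces Liouville's theorem. *)
Lemma entire_resolvent_trivial v : p v = 0.
Proof.
apply: le_anti; rewrite p_ge0 andbT leNgt; apply/negP => v0.
have [K' HK'] := S_bnd 0; pose K := `|K'| + 1.
have K0 : 0 < K by rewrite ltr_wpDl.
have HK u : p u <= K * p (T u).
  have := seminorm_le_dist pD u (S 0 (0 *: u - T u)).
  rewrite (seminormB pZ) S_left add0r scale0r sub0r => /le_trans; apply.
  apply: le_trans (HK' _) _; rewrite (seminormN pZ); apply: ler_wpM2r => //.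
  by rewrite (le_trans (ler_norm _))// lerDl.
pose l := (2 * K)^-1; have l0 : 0 < l by rewrite invr_gt0 mulr_gt0.
have l20 : 0 < l / 2 by rewrite divr_gt0.
have l2l : l / 2 < l by rewrite ltr_pdivrMr// ltr_pMr// ltr1n.
have [k0 Hk0] := @resolvent_power_small R V p p_ge0 pZ pD T S (l / 2) MT T_lin
  T_bnd l20 (fun z _ => S_lin z) (fun z _ => S_bnd z)
  (fun z v _ => S_left z v) (fun z v _ => S_right z v) l l2l 1 ltr01.
have HKn n : p v <= K ^+ n * p (iter n T v).
  elim: n => [|n IH]; first by rewrite expr0 mul1r.
  apply: le_trans IH _; rewrite exprSr -mulrA.
  by apply: ler_wpM2l; [exact/exprn_ge0/ltW|exact: HK].
have := le_trans (HKn (2 ^ k0)%N)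
  (ler_wpM2l (exprn_ge0 _ (ltW K0)) (Hk0 k0 (leqnn _) v)).
rewrite mul1r mulrA -exprMn (_ : K * l = 2^-1); last first.
  by rewrite /l invfM mulrCA mulfV ?mulr1// gt_eqF.
rewrite -{1}[p v]mul1r ler_pM2r// => h.
suff : (2^-1 : R) ^+ (2 ^ k0) < 1 by rewrite ltNge h.
by rewrite exprn_ilt1 ?expn_eq0//; lra.
Qed.

End EntireResolvent.

Section Neumann.
Context {R : realType} {V : completeNormedModType R[i]}.

(** The inverse of [1 - U] at [b] is the fixed point of [x |-> b + U x], the limit of its iterates
    from 0; uniqueness of fixed points gives linearity and the left inverse. *)
Lemma contraction_inverse (U : V -> V) (q : R) : linear U -> 0 <= q -> q < 1 ->
  (forall v, rnorm (U v) <= q * rnorm v) ->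
  exists S : V -> V, [/\ linear S, forall v, rnorm (S v) <= (1 - q)^-1 * rnorm v,
    forall v, S (v - U v) = v & forall v, S v - U (S v) = v].
Proof.
move=> Ul q0 q1 Uq.
have uniq_fix b x y : x = b + U x -> y = b + U y -> x = y.
  move=> hx hy; apply/eqP; rewrite -subr_eq0 -rnorm_eq0 eq_le rnorm_ge0 andbT.
  have := Uq (x - y); rewrite (linear_B Ul).
  have -> : U x - U y = x - y by rewrite [in RHS]hx [in RHS]hy opprD addrACA subrr add0r.
  have := rnorm_ge0 (x - y); nra.
have fix_ex b : exists x, x = b + U x.
  pose u := fix u n := if n is n'.+1 then b + U (u n') else 0.
  have du n j : rnorm (u (n + j)%N - u n) <= q ^+ n * (rnorm b / (1 - q)).
    elim: n j => [|n IH] j /=.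
      rewrite expr0 mul1r subr0 add0n; elim: j => [|j IH] /=.
        by rewrite rnorm0 divr_ge0 ?rnorm_ge0// subr_ge0 ltW.
      apply: le_trans (rnormD _ _) _.
      have := le_trans (Uq (u j)) (ler_wpM2l q0 IH); set c := rnorm b / _ => h.
      have : c * (1 - q) = rnorm b by rewrite divfK// gt_eqF// subr_gt0.
      lra.
    rewrite opprD addrACA subrr add0r -(linear_B Ul); apply: le_trans (Uq _) _.
    by rewrite exprS -mulrA ler_wpM2l.
  have cu : cvg (u @ \oo).
    apply: cauchy_cvg; apply: cauchy_exP => e e0.
    have [e' e'E] : exists e' : R, e = e'%:C.
      by case: e e0 => x y; rewrite ltcE/= => /andP[/eqP-> _]; exists x.
    rewrite e'E ltcR in e0.
    have c1 : 0 < rnorm b / (1 - q) + 1.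
      by rewrite ltr_wpDl// divr_ge0 ?rnorm_ge0// subr_ge0 ltW.
    have [N _ HN] : \forall n \near \oo, q ^+ n < e' / (rnorm b / (1 - q) + 1).
      have := @cvg_expr R q; rewrite ger0_norm// => /(_ q1) /cvgr0_norm_lt.
      move=> /(_ (e' / (rnorm b / (1 - q) + 1))); rewrite divr_gt0// => /(_ isT).
      by apply: filterS => n; rewrite ger0_norm// exprn_ge0.
    exists (u N), N => // n /= Nn.
    rewrite -ball_normE/= e'E -opprB normrN rnormE ltcR -(subnKC Nn).
    apply: le_lt_trans (du _ _) _.
    have := HN N (leqnn _); rewrite /= ltr_pdivlMr//; apply: le_lt_trans.
    by rewrite ler_wpM2l ?exprn_ge0// lerDl.
  exists (lim (u @ \oo)); set s := lim _.
  apply/eqP; rewrite -subr_eq0 -rnorm_eq0 eq_le rnorm_ge0 andbT.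
  apply/ler_addgt0Pr => e e0; rewrite add0r.
  have e20 : 0 < (e / 2)%:C by rewrite ltcR divr_gt0.
  have /cvgrPdist_lt/(_ _ e20) [N _ HN] : u @ \oo --> s by [].
  have close n : (N <= n)%N -> rnorm (s - u n) < e / 2.
    by move=> Nn; have := HN n Nn; rewrite rnormE ltcR.
  have h1 := close N.+1 (leqnSn N); have h2 := close N (leqnn N).
  have -> : s - (b + U s) = (s - u N.+1) - U (s - u N).
    by rewrite (linear_B Ul) /= opprB !opprD !addrA subrK.
  apply: le_trans (rnormD _ _) _; rewrite rnormN.
  have := Uq (s - u N); have := rnorm_ge0 (s - u N); nra.
have [S HS] := choice fix_ex; exists S; split.
- move=> a u v; apply: (uniq_fix (a *: u + v)) => //.
  by rewrite Ul addrACA -scalerDr -HS -HS.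
- move=> v; have := rnormD v (U (S v)); rewrite -HS.
  have := Uq (S v); rewrite ler_pdivlMl ?subr_gt0//; lra.
- move=> v; apply: (uniq_fix (v - U v)) => //.
  by rewrite subrK.
- by move=> v; rewrite {1}HS addrK.
Qed.

(* A two-sided inverse [W] of [z ^+ n - T ^ n] gives one of [z - T], since
   [z ^+ n - T ^ n = (z - T) Q = Q (z - T)]. *)
Lemma resolvent_of_power (T : V -> V) (z : R[i]) (M c : R) n :
  linear T -> (forall v, rnorm (T v) <= M * rnorm v) ->
  (forall v, rnorm (iter n T v) <= c * rnorm v) -> c < cmod z ^+ n -> 0 <= c ->
  exists S : V -> V, [/\ linear S, exists K, forall v, rnorm (S v) <= K * rnorm v,
    forall v, S (z *: v - T v) = v & forall v, z *: S v - T (S v) = v].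
Proof.
move=> Tl TM Tn cz c0.
pose u := z ^+ n; have cu : cmod u = cmod z ^+ n by rewrite cmodX.
have u0 : 0 < cmod u by rewrite cu; exact: le_lt_trans cz.
have un0 : u != 0 by rewrite -cmod_gt0.
have Tnl : linear (iter n T) by exact: iter_linear.
have [||||W [Wl Wb Wleft Wright]] :=
  @contraction_inverse (fun v => u^-1 *: iter n T v) (c / cmod u).
- by move=> a x y; rewrite Tnl scalerDr !scalerA mulrC.
- by rewrite divr_ge0// ltW.
- by rewrite ltr_pdivrMr// mul1r cu.
- move=> v; rewrite rnormZ cmodV [leRHS]mulrAC [leRHS]mulrC.
  by apply: ler_wpM2l; [rewrite invr_ge0 ltW|exact: Tn].
(* Explicitly, [Q k] is the sum of [z^(k-1-i) T^i] over [i < k]. *)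
pose Q := fix Q k v := if k is k'.+1 then z *: Q k' v + iter k' T v else 0 : V.
have Ql k : linear (Q k).
  elim: k => [|k IH] a x y /=; first by rewrite scaler0 addr0.
  by rewrite IH (iter_linear k Tl) !scalerDr !scalerA mulrC addrACA.
have Qright k v : z *: Q k v - T (Q k v) = z ^+ k *: v - iter k T v.
  elim: k => [|k IH] /=.
    have T0 : T 0 = 0 by have := linear_Z Tl 0 0; rewrite !scale0r.
    by rewrite T0 scaler0 expr0 scale1r !subrr.
  rewrite Tl scalerDr opprD addrACA -scalerBr IH exprS -scalerA scalerBr.
  by rewrite addrA subrK.
have Qleft k v : Q k (z *: v - T v) = z ^+ k *: v - iter k T v.
  elim: k => [|k IH] /=; first by rewrite expr0 scale1r subrr.
  rewrite IH (linear_B (iter_linear k Tl)) (linear_Z (iter_linear k Tl)).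
  by rewrite scalerBr addrA subrK scalerA -exprS -iterSr.
have Qb k : exists2 K, 0 <= K & forall v, rnorm (Q k v) <= K * rnorm v.
  have Tk j : exists2 K, 0 <= K & forall v, rnorm (iter j T v) <= K * rnorm v.
    exists (`|M| ^+ j) => [|v]; first by rewrite exprn_ge0.
    elim: j => [|j IH] /=; first by rewrite expr0 mul1r.
    apply: le_trans (TM _) _; rewrite exprS -mulrA.
    apply: (@le_trans _ _ (`|M| * rnorm (iter j T v))).
      by apply: ler_wpM2r; [exact: rnorm_ge0|exact: ler_norm].
    by apply: ler_wpM2l.
  elim: k => [|k [K K0 HK]] /=; first by exists 0 => // v; rewrite rnorm0 mul0r.
  have [K' K'0 HK'] := Tk k; exists (cmod z * K + K').
    by rewrite addr_ge0// mulr_ge0// cmod_ge0.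
  move=> v; apply: le_trans (rnormD _ _) _; rewrite rnormZ mulrDl -mulrA.
  by apply: lerD => //; apply: ler_wpM2l => //; exact: cmod_ge0.
pose S v := u^-1 *: Q n (W v); pose S' v := u^-1 *: W (Q n v).
have Sright v : z *: S v - T (S v) = v.
  rewrite /S (linear_Z Tl) scalerA mulrC -scalerA -scalerBr Qright -/u scalerBr.
  by rewrite scalerA mulVf// scale1r; exact: Wright.
have S'left v : S' (z *: v - T v) = v.
  rewrite /S' Qleft -/u -(linear_Z Wl) scalerBr scalerA mulVf// scale1r.
  exact: Wleft.
have SS' v : S v = S' v by rewrite -[in RHS](Sright v) S'left.
have [K K0 HK] := Qb n.
exists S; split => //.
- move=> a x y; rewrite /S Wl Ql scalerDr !scalerA mulrC.
  by [].
- exists (cmod u^-1 * (K * (1 - c / cmod u)^-1)) => v.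
  rewrite /S rnormZ -!mulrA; apply: ler_wpM2l; first exact: cmod_ge0.
  by apply: le_trans (HK _) _; apply: ler_wpM2l.
- by move=> v; rewrite SS' S'left.
Qed.

End Neumann.

(** * Characters of commutative Banach algebras *)

Section BanachAlgebra.
Context {R : realType} {A : comBanachAlgType R[i]}.
Implicit Types a b c : A.
Local Notation one := (@bone R[i] A).

Lemma bmulDr a b c : bmul a (b + c) = bmul a b + bmul a c.
Proof. by rewrite bmulC bmulDl !(bmulC a). Qed.

Lemma bmulZr (z : R[i]) a b : bmul a (z *: b) = z *: bmul a b.
Proof. by rewrite bmulC bmulZl (bmulC b). Qed.

Lemma bmul1r a : bmul a one = a.
Proof. by rewrite bmulC bmul1l. Qed.

Lemma bmul_linear a : linear (bmul a).
Proof. by move=> z u v; rewrite bmulDr bmulZr. Qed.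

Lemma bmulBl a b c : bmul (a - b) c = bmul a c - bmul b c.
Proof. by rewrite bmulDl -scaleN1r bmulZl scaleN1r. Qed.

Lemma bmulNN a b : bmul (- a) (- b) = bmul a b.
Proof.
by rewrite -(scaleN1r a) -(scaleN1r b) bmulZl bmulZr scalerA mulrNN mulr1 scale1r.
Qed.

Lemma bmul0l a : bmul 0 a = 0.
Proof. by have := bmulZl (0 : R[i]) (0 : A) a; rewrite !scale0r. Qed.

Lemma rnormM a b : rnorm (bmul a b) <= rnorm a * rnorm b.
Proof. by rewrite -lecR rmorphM/= -!rnormE bnormM. Qed.

Lemma resolvent_gt_norm a (z : R[i]) : rnorm a < cmod z ->
  exists b, bmul (z *: one - a) b = one.
Proof.
move=> az; have [||||S [_ _ _ Sr]] :=
  @resolvent_of_power R A (bmul a) z (rnorm a) (rnorm a) 1 (bmul_linear a).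
- exact: rnormM.
- exact: rnormM.
- by rewrite expr1.
- exact: rnorm_ge0.
by exists (S one); rewrite bmulBl bmulZl bmul1l.
Qed.

Section Character.
Context (chi : A -> R[i]) (chi_char : is_character chi).

Lemma characterZD z a b : chi (z *: a + b) = z * chi a + chi b.
Proof. by have [-> _ _] := chi_char. Qed.

Lemma characterM a b : chi (bmul a b) = chi a * chi b.
Proof. by have [_ -> _] := chi_char. Qed.

Lemma character1 : chi one = 1.
Proof.
have [_ _ [a a0]] := chi_char.
by apply: (mulIf a0); rewrite mul1r -characterM bmul1l.
Qed.

Lemma character0 : chi 0 = 0.
Proof.
by have := characterZD 1 0 0; rewrite scale1r mul1r addr0 => /eqP;
  rewrite -subr_eq subrr => /eqP <-.
Qed.

Lemma characterZ z a : chi (z *: a) = z * chi a.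
Proof. by rewrite -[z *: a]addr0 characterZD character0 addr0. Qed.

Lemma characterD a b : chi (a + b) = chi a + chi b.
Proof. by rewrite -{1}[a]scale1r characterZD mul1r. Qed.

Lemma characterB a b : chi (a - b) = chi a - chi b.
Proof. by rewrite characterD -scaleN1r characterZ mulN1r. Qed.

(** Otherwise [chi a - a] would be invertible, although [chi] vanishes on it. *)
Lemma character_bound a : cmod (chi a) <= rnorm a.
Proof.
rewrite leNgt; apply/negP => /resolvent_gt_norm[b /(congr1 chi)].
rewrite characterM characterB characterZ character1 mulr1 subrr mul0r.
by move/esym/eqP; rewrite oner_eq0.
Qed.

End Character.

Definition proper_ideal (I : set A) : Prop :=
  [/\ I 0, forall a b, I a -> I b -> I (a + b),
      forall a b, I b -> I (bmul a b) & ~ I one].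

Lemma maximal_ideal (I : set A) : proper_ideal I ->
  exists J, [/\ proper_ideal J, I `<=` J &
    forall b, ~ J b -> exists c i, J i /\ bmul b c + i = one].
Proof.
move=> pI; have [I0 _ _ _] := pI.
pose P (J : set A) := J = set0 \/ (proper_ideal J /\ I `<=` J).
have [F FP totF|J [PJ Jmax]] := @Zorn_bigcup A P.
  have [F0|] := pselect (exists2 J, F J & J !=set0); last first.
    move=> F0; left; apply/seteqP; split => // x [J FJ Jx].
    by apply: F0; exists J => //; exists x.
  have [J FJ [x Jx]] := F0.
  have pF K y : F K -> K y -> proper_ideal K /\ I `<=` K.
    by move=> FK Ky; have [K0|//] := FP _ FK; rewrite K0 in Ky.
  have [[J0 _ _ _] IJ] := pF J x FJ Jx.
  right; split; last by move=> y /IJ Jy; exists J.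
  split.
  - by exists J.
  - move=> a b [K FK Ka] [L FL Lb].
    have [[_ Kadd _ _] _] := pF _ _ FK Ka.
    have [[_ Ladd _ _] _] := pF _ _ FL Lb.
    have [KL|LK] := totF _ _ FK FL.
      by exists L => //; apply: Ladd => //; exact: KL.
    by exists K => //; apply: Kadd => //; exact: LK.
  - move=> a b [K FK Kb]; exists K => //.
    by have [[_ _ Kmul _] _] := pF _ _ FK Kb; exact: Kmul.
  - move=> [K FK K1]; by have [[_ _ _ nK1] _] := pF _ _ FK K1; exact: nK1.
have J0 : J 0.
  case: (PJ) => [JE|[[]//]]; exfalso.
  apply: (Jmax I); last by right; split.
  rewrite JE; split => //.
  by move=> /(_ _ I0).
have [pJ IJ] : proper_ideal J /\ I `<=` J.
  by case: PJ => // JE; rewrite JE in J0.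
have [_ Jadd Jmul J1] := pJ.
exists J; split => // b nJb; apply: contrapT => nb.
pose J' : set A := [set x | exists c i, J i /\ bmul b c + i = x].
have JJ' : J `<=` J'.
  by move=> x Jx; exists 0, x; rewrite bmulC bmul0l add0r.
apply: (Jmax J'); last first.
  right; split; last exact: subset_trans JJ'.
  split.
  - exact: JJ'.
  - move=> _ _ [c [i [Ji <-]]] [d [j [Jj <-]]]; exists (c + d), (i + j).
    by split; [exact: Jadd|rewrite bmulDr addrACA].
  - move=> x _ [c [i [Ji <-]]]; exists (bmul x c), (bmul x i).
    by split; [exact: Jmul|rewrite bmulDr !bmulA (bmulC b)].
  - by move=> [c [i H]]; apply: nb; exists c, i.
split => //; move=> /(_ b) J'J; apply: nJb; apply: J'J.
by exists one, 0; rewrite bmul1r addr0.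
Qed.

Section Quotient.
Context (J : set A) (pJ : proper_ideal J).

Lemma idealZ (z : R[i]) a : J a -> J (z *: a).
Proof.
have [_ _ Jmul _] := pJ.
by move=> Ja; have := Jmul (z *: one) a Ja; rewrite bmulZl bmul1l.
Qed.

(** The norm of the quotient by [J], kept as a seminorm on [A] so that no quotient space has to be
    formed. *)
Definition quotient_norm (x : A) : R := inf [set rnorm (x + i) | i in J].

Let has_inf_norm x : has_inf [set rnorm (x + i) | i in J].
Proof.
have [J0 _ _ _] := pJ; split; first by exists (rnorm (x + 0)), 0.
by exists 0 => _ [i _ <-]; exact: rnorm_ge0.
Qed.

Lemma quotient_norm_le x i : J i -> quotient_norm x <= rnorm (x + i).
Proof. by move=> Ji; apply: (inf_lbound (has_inf_norm x).2); exists i. Qed.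

Lemma quotient_norm_ge x (c : R) : (forall i, J i -> c <= rnorm (x + i)) ->
  c <= quotient_norm x.
Proof.
move=> H; apply: lb_le_inf; first exact: (has_inf_norm x).1.
by move=> _ [i Ji <-]; exact: H.
Qed.

Lemma quotient_norm_ge0 x : 0 <= quotient_norm x.
Proof. by apply: quotient_norm_ge => i _; exact: rnorm_ge0. Qed.

Lemma quotient_norm_ideal x : J x -> quotient_norm x = 0.
Proof.
move=> Jx; apply: le_anti; rewrite quotient_norm_ge0 andbT.
have JNx : J (- x) by rewrite -scaleN1r; exact: idealZ.
by have := quotient_norm_le x JNx; rewrite subrr rnorm0.
Qed.

Lemma quotient_normD x y :
  quotient_norm (x + y) <= quotient_norm x + quotient_norm y.
Proof.
have [_ Jadd _ _] := pJ.
rewrite -lerBlDr; apply: quotient_norm_ge => i Ji.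
rewrite lerBlDr [leRHS]addrC -lerBlDr; apply: quotient_norm_ge => j Jj.
rewrite lerBlDr; apply: le_trans (quotient_norm_le _ (Jadd _ _ Ji Jj)) _.
by rewrite addrACA [leRHS]addrC rnormD.
Qed.

Lemma quotient_normM a x : quotient_norm (bmul a x) <= rnorm a * quotient_norm x.
Proof.
have [_ _ Jmul _] := pJ.
have [a0|a0] := eqVneq (rnorm a) 0.
  rewrite a0 mul0r; move/eqP : a0; rewrite rnorm_eq0 => /eqP ->.
  by rewrite bmul0l quotient_norm_ideal//; have [] := pJ.
have a1 : 0 < rnorm a by rewrite lt_neqAle eq_sym a0 rnorm_ge0.
rewrite mulrC -ler_pdivrMr//; apply: quotient_norm_ge => i Ji.
rewrite ler_pdivrMr// mulrC; apply: le_trans (rnormM _ _).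
by rewrite bmulDr; apply: quotient_norm_le; exact: Jmul.
Qed.

Lemma quotient_normZ (z : R[i]) x :
  quotient_norm (z *: x) = cmod z * quotient_norm x.
Proof.
have le w y : quotient_norm (w *: y) <= cmod w * quotient_norm y.
  have [->|w0] := eqVneq w 0.
    by rewrite scale0r cmod0 mul0r quotient_norm_ideal//; have [] := pJ.
  have cw : 0 < cmod w by rewrite cmod_gt0.
  rewrite mulrC -ler_pdivrMr//; apply: quotient_norm_ge => i Ji.
  rewrite ler_pdivrMr// mulrC -rnormZ scalerDr.
  by apply: quotient_norm_le; exact: idealZ.
have [->|z0] := eqVneq z 0.
  by rewrite scale0r cmod0 mul0r quotient_norm_ideal//; have [] := pJ.
apply: le_anti; rewrite le/=; have cz : 0 < cmod z by rewrite cmod_gt0.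
rewrite -ler_pdivlMl// -cmodV; apply: le_trans (le _ _).
by rewrite scalerA mulVf// scale1r.
Qed.

(** If [1 + i] had norm less than 1 for some [i] in [J], then [- i = 1 - (1 + i)] would be an
    invertible element of a proper ideal. *)
Lemma quotient_norm1 : 0 < quotient_norm one.
Proof.
apply: (@lt_le_trans _ _ 1) => //; apply: quotient_norm_ge => i Ji.
rewrite leNgt; apply/negP => lt1.
have [|b] := @resolvent_gt_norm (one + i) 1; first by rewrite cmod1.
rewrite scale1r opprD addrA subrr add0r => hb.
have [_ _ Jmul J1] := pJ; apply: J1; rewrite -hb bmulC.
by apply: Jmul; rewrite -scaleN1r; exact: idealZ.
Qed.

Hypothesis Jmax : forall b, ~ J b -> exists c i, J i /\ bmul b c + i = one.

(** If no [b - z] lay in [J], each would be invertible modulo [J]. Multiplication by the inverses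
    would be an entire resolvent for multiplication by [b] and the quotient seminorm, which would
    then vanish at the unit. *)
Lemma gelfand_mazur b : exists z, J (b - z *: one).
Proof.
have [J0 Jadd Jmul J1] := pJ.
apply: contrapT => nz.
have /choice[c Hc] z : exists c, exists2 i, J i & bmul (b - z *: one) c + i = one.
  have [c [i [Ji E]]] := Jmax (fun Jb => nz (ex_intro _ z Jb)).
  by exists c, i.
pose S z v := bmul (- c z) v.
have key z v : quotient_norm (bmul (z *: one - b) (S z v) - v) = 0.
  have [i Ji E] := Hc z; apply: quotient_norm_ideal.
  rewrite /S bmulA -{2}[v]bmul1l -bmulBl -[X in _ - X]E.
  rewrite -(opprB b) bmulNN opprD addrA subrr add0r bmulC; apply: Jmul.
  by rewrite -scaleN1r; exact: idealZ.
suff : quotient_norm one = 0 by move=> E; have := quotient_norm1; rewrite E ltxx.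
apply: (@entire_resolvent_trivial R A quotient_norm quotient_norm_ge0
  quotient_normZ quotient_normD (bmul b) S (rnorm b)).
- exact: bmul_linear.
- exact: quotient_normM.
- by move=> z; exact: bmul_linear.
- by move=> z; exists (rnorm (- c z)) => v; exact: quotient_normM.
- move=> z v; have := key z v.
  by rewrite /S bmulA (bmulC (_ - b)) -bmulA bmulBl bmulZl bmul1l.
- by move=> z v; have := key z v; rewrite bmulBl bmulZl bmul1l.
Qed.

Lemma maximal_ideal_character :
  exists chi : A -> R[i], is_character chi /\ forall b, J (b - chi b *: one).
Proof.
have [J0 Jadd Jmul J1] := pJ.
have [chi Hchi] := choice gelfand_mazur.
have uniq z b : J (b - z *: one) -> chi b = z.
  move=> Jz; apply/eqP; rewrite -subr_eq0; apply/negPn/negP => nz; apply: J1.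
  have : J ((chi b - z) *: one).
    rewrite scalerBl (_ : _ - _ = (b - z *: one) + (-1) *: (b - chi b *: one)).
      by apply: Jadd => //; exact: idealZ.
    by rewrite scaleN1r opprB [RHS]addrC addrA subrK.
  by move/(idealZ (chi b - z)^-1); rewrite scalerA mulVf// scale1r.
exists chi; split => //; split.
- move=> z a b; apply: uniq.
  rewrite (_ : _ - _ = z *: (a - chi a *: one) + (b - chi b *: one)).
    by apply: Jadd; [apply: idealZ; exact: Hchi|exact: Hchi].
  by rewrite scalerDl -scalerA scalerBr opprD addrACA.
- move=> a b; apply: uniq.
  rewrite (_ : _ - _ = bmul b (a - chi a *: one) +
      chi a *: (b - chi b *: one)).
    by apply: Jadd; [apply: Jmul; exact: Hchi|apply: idealZ; exact: Hchi].
  by rewrite (bmulC b) bmulBl bmulZl bmul1l scalerBr scalerA addrA subrK.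
- by exists one; rewrite (uniq 1) ?oner_neq0// scale1r subrr.
Qed.

End Quotient.

Lemma spectrum_character a z : spectrum a z ->
  exists2 chi : A -> R[i], is_character chi & chi a = z.
Proof.
move=> sz; pose I : set A := [set x | exists b, bmul (z *: one - a) b = x].
have pI : proper_ideal I.
  split.
  - by exists 0; rewrite bmulC bmul0l.
  - by move=> _ _ [b <-] [c <-]; exists (b + c); rewrite bmulDr.
  - by move=> x _ [b <-]; exists (bmul x b); rewrite !bmulA (bmulC x).
  - exact: sz.
have [J [pJ IJ Jmax]] := maximal_ideal pI.
have [chi [chi_char Hchi]] := maximal_ideal_character pJ Jmax.
exists chi => //; have [_ Jadd _ J1] := pJ.
have Jz : J (z *: one - a) by apply: IJ; exists one; rewrite bmul1r.
apply/eqP; rewrite -subr_eq0; apply/negPn/negP => nz; apply: J1.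
have : J ((chi a - z) *: one).
  rewrite scalerBl (_ : _ - _ = (-1) *: (z *: one - a) + (-1) *: (a - chi a *: one)).
    by apply: Jadd; exact: idealZ.
  by rewrite !scaleN1r !opprB [RHS]addrC addrA subrK.
by move/(idealZ pJ (chi a - z)^-1); rewrite scalerA mulVf// scale1r.
Qed.

End BanachAlgebra.

(** * The Gelfand spectrum as a compact Hausdorff space *)

Section SetTypeTopology.
Context {X : topologicalType} (D : set X).

Lemma nbhs_set_type (x : D) (B : set D) :
  nbhs x B -> exists W : set X, [/\ open W, W (set_val x) & set_val @^-1` W `<=` B].
Proof. by case=> _ [[W oW <-] Wx WB]; exists W. Qed.

Lemma set_val_continuous : continuous (set_val : D -> X).
Proof. exact: initial_continuous. Qed.

Lemma set_type_compact : compact D -> compact [set: D].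
Proof.
move=> cD F PF _.
have PG : ProperFilter (set_val @ F) by exact: fmap_proper_filter.
have GD : (set_val @ F) D by apply: (@filterS _ F _ setT) filterT => x _; exact: set_valP.
have [x [Dx clx]] := cD _ PG GD.
pose y : D := exist _ x (mem_set Dx); exists y; split => //.
move=> B C FB /nbhs_set_type[W [oW Wy WC]].
have GB : (set_val @ F) (set_val @` B) by apply: (@filterS _ F _ B) FB => z Bz; exists z.
have [_ [[z Bz <-] Wz]] := clx _ W GB (open_nbhs_nbhs (conj oW Wy)).
by exists z; split => //; exact: WC.
Qed.

Lemma set_type_hausdorff : hausdorff_space X -> hausdorff_space D.
Proof.
move=> hX x y clxy; apply: val_inj; apply: hX => B C Bx Cy.
have [||z [Bz Cz]] := clxy (set_val @^-1` B) (set_val @^-1` C).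
- exact: (@set_val_continuous x B).
- exact: (@set_val_continuous y C).
- by exists (set_val z).
Qed.

End SetTypeTopology.

Section GelfandSpace.
Context {R : realType} {A : comBanachAlgType R[i]}.
Local Notation X := (gelfand_spectrum A).
Local Notation one := (@bone R[i] A).

Lemma gelfand_character (x : X) : is_character (set_val x : A -> R[i]).
Proof. exact: set_valP x. Qed.

Lemma gelfand_bound a (x : X) : cmod (gelfand a x) <= rnorm a.
Proof. exact: character_bound (gelfand_character x) a. Qed.

Lemma gelfandM a b (x : X) : gelfand (bmul a b) x = gelfand a x * gelfand b x.
Proof. exact: characterM (gelfand_character x) a b. Qed.

Lemma gelfand1 (x : X) : gelfand one x = 1.
Proof. exact: character1 (gelfand_character x). Qed.

Lemma eval_continuous a :
  continuous (fun m : {ptws A -> R[i]^o} => m a : R[i]^o).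
Proof. exact: (@proj_continuous A (fun=> R[i]^o) a). Qed.

Lemma gelfand_continuous a : continuous (gelfand a : X -> R[i]^o).
Proof.
by move=> x; apply: (@continuous_comp _ _ _ _ _ x
  (@set_val_continuous {ptws A -> R[i]^o} _ x) (@eval_continuous a _)).
Qed.

Lemma cmod_gelfand_continuous a : continuous (fun x : X => cmod (gelfand a x) : R).
Proof.
move=> x; exact: (@continuous_comp X (R[i]^o) R (gelfand a)
  (fun z : R[i]^o => cmod z) x (@gelfand_continuous a x) (@cmod_continuous R _)).
Qed.

Lemma closed_cmod_dist (Z : topologicalType) (f g : Z -> R[i]^o) :
  continuous f -> continuous g -> closed [set z | f z = g z].
Proof.
move=> cf cg.
rewrite (_ : mkset _ = (fun z => cmod (f z - g z) : R) @^-1` [set x | x <= 0]).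
  apply: closed_comp; last exact: closed_le.
  move=> z _; exact: (@continuous_comp Z (R[i]^o) R (fun z => f z - g z)
    (fun w : R[i]^o => cmod w) z (cvgB (cf z) (cg z)) (@cmod_continuous R _)).
apply/seteqP; split=> z /=; first by move=> ->; rewrite subrr cmod0.
move=> le0; have : cmod (f z - g z) == 0 by rewrite eq_le le0 cmod_ge0.
by rewrite cmod_eq0 subr_eq0 => /eqP.
Qed.

(** Characters lie in a product of discs by [character_bound]. Being nonzero is not visibly a closed
    condition; it is replaced by the equation [chi 1 = 1], equivalent for multiplicative
    functionals. *)
Lemma compact_gelfand : compact [set: X].
Proof.
apply: set_type_compact.
pose ball : set {ptws A -> R[i]^o} :=
  [set m | forall a, [set z : R[i]^o | 0 <= cmod z <= rnorm a] (m a)].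
apply: (@subclosed_compact _ _ ball); last 2 first.
- apply: (@tychonoff A (fun=> R[i]^o)
    (fun a => [set z : R[i]^o | 0 <= cmod z <= rnorm a])) => a.
  exact: compact_annulus.
- by move=> chi chi_char a; rewrite /= cmod_ge0 character_bound.
rewrite (_ : mkset _ =
  \bigcap_(c in [set: R[i] * A * A])
    [set m : {ptws A -> R[i]^o} | m (c.1.1 *: c.1.2 + c.2) =
      (c.1.1 * m c.1.2 + m c.2 : R[i]^o)] `&`
  \bigcap_(c in [set: A * A])
    [set m : {ptws A -> R[i]^o} | m (bmul c.1 c.2) = (m c.1 * m c.2 : R[i]^o)] `&`
  [set m : {ptws A -> R[i]^o} | m one = (1 : R[i]^o)]).
  apply: closedI; [apply: closedI|].
  - apply: closed_bigI => -[[z a] b] _ /=; apply: closed_cmod_dist.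
      exact: eval_continuous.
    move=> m; exact: (cvgD (cvgM (@cst_continuous _ _ (z : R[i]^o) m)
      (@eval_continuous a m)) (@eval_continuous b m)).
  - apply: closed_bigI => -[a b] _ /=; apply: closed_cmod_dist.
      exact: eval_continuous.
    move=> m; exact: (cvgM (@eval_continuous a m) (@eval_continuous b m)).
  - apply: closed_cmod_dist; first exact: eval_continuous.
    by move=> m; exact: (@cst_continuous _ _ (1 : R[i]^o) m).
apply/seteqP; split=> chi /=.
  move=> chi_char; split; [split|] => /=.
  - by move=> [[z a] b] _ /=; exact: characterZD.
  - by move=> [a b] _ /=; exact: characterM.
  - exact: character1.
move=> [[H1 H2] H3]; split.
- by move=> z a b; exact: (H1 ((z, a), b) I).
- by move=> a b; exact: (H2 (a, b) I).
- by exists one; rewrite H3 oner_neq0.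
Qed.

Lemma gelfand_hausdorff : hausdorff_space X.
Proof.
apply: set_type_hausdorff; apply: (@hausdorff_product A (fun=> R[i]^o)) => _.
exact: complex_hausdorff.
Qed.

Lemma uniform_algebra_norm_le (uniformA : uniform_algebra A) a (c : R) : 0 <= c ->
  (forall x : X, cmod (gelfand a x) <= c) -> rnorm a <= c.
Proof.
move=> c0 H; rewrite -lee_fin uniformA; apply: ge_ereal_sup => _ [z sz <-].
have [chi chi_char chia] := spectrum_character sz.
by rewrite lee_fin -chia;
  exact: (H (exist _ (chi : {ptws A -> R[i]^o}) (mem_set chi_char))).
Qed.

End GelfandSpace.

(** * Products along orbits of a partial map *)

Section OrbitProducts.
Context {R : realType} {X : Type} (phi : X -> X) (u : X -> R).

Definition orbit_prod (n : nat) (x : X) : R := \prod_(i < n) u (iter i phi x).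

Lemma orbit_prodD i j x :
  orbit_prod (i + j) x = orbit_prod i x * orbit_prod j (iter i phi x).
Proof.
rewrite /orbit_prod big_split_ord/=; congr (_ * _); apply: eq_bigr => k _.
by rewrite addnC iterD.
Qed.

Lemma orbit_prod_ge0 n x : (forall x, 0 <= u x) -> 0 <= orbit_prod n x.
Proof. by move=> u0; apply: prodr_ge0. Qed.

End OrbitProducts.

Section PartialMap.
Context {X : choiceType} (Delta : set X) (phi : X -> X).

Lemma iter_domD i j x :
  iter_dom Delta phi (i + j) x <->
  iter_dom Delta phi i x /\ iter_dom Delta phi j (iter i phi x).
Proof.
elim: i x => [|i IH] x; first by rewrite add0n /=; split=> [|[]].
rewrite addSn iterSr /=; split.
  by move=> [Dx /IH [di dj]]; split.
by move=> [[Dx di] dj]; split=> //; apply/IH.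
Qed.

Lemma iter_dom_le m n : (m <= n)%N ->
  iter_dom Delta phi n `<=` iter_dom Delta phi m.
Proof. by move=> mn x; rewrite -(subnKC mn) => /iter_domD []. Qed.

Definition iter_image (n : nat) : set X := iter n phi @` iter_dom Delta phi n.

Lemma iter_image_le m n : (m <= n)%N -> iter_image n `<=` iter_image m.
Proof.
move=> mn _ [x dx <-]; exists (iter (n - m) phi x).
  by move: dx; rewrite -{1}(subnK mn) => /iter_domD [].
by rewrite -iterD subnKC.
Qed.

Lemma essential_domainP x : essential_domain Delta phi x <->
  forall n, iter_dom Delta phi n x /\ iter_image n x.
Proof.
split=> [Dx n|H [n|n] _]; last 2 first.
- exact: (H n).1.
- exact: (H n.+1).2.
split; first exact: (Dx (Posz n) I).
by case: n => [|n]; [exists x|exact: (Dx (Negz n) I)].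
Qed.

End PartialMap.

Section PartialDynamics.
Context {R : realType} {X : topologicalType} (Delta : set X) (phi : X -> X).
Hypotheses (hX : hausdorff_space X) (cX : compact [set: X])
  (Delta_clopen : clopen Delta) (phi_cont : {within Delta, continuous phi}).
Context (u : X -> R) (c : R).
Hypotheses (u_cont : continuous u) (u_bnd : forall x, 0 <= u x <= c).

Local Notation D := (iter_dom Delta phi).
Local Notation P := (orbit_prod phi u).

(** Continuity is asked for at the points of the closed set [F] only, because [phi] has arbitrary
    values outside [Delta]. *)
Lemma closed_preimage_at {Z : topologicalType} (F : set X) (f : X -> Z) (C : set Z) :
  closed F -> (forall x, F x -> {for x, continuous f}) -> closed C ->
  closed (F `&` f @^-1` C).
Proof.
move=> clF cf clC x clx; have Fx : F x by apply: clF; apply: closure_subset clx => ? [].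
split => //; apply: clC => B Bfx.
by have [y [[Fy Cfy] By]] := clx _ (cf x Fx B Bfx); exists (f y).
Qed.

Lemma phi_continuous_at x : Delta x -> {for x, continuous phi}.
Proof.
have [oD _] := Delta_clopen; move=> Dx.
by move: phi_cont; rewrite continuous_open_subspace// => H; apply: H; rewrite inE.
Qed.

Lemma iter_phi_continuous_at n x : D n x -> {for x, continuous (iter n phi)}.
Proof.
elim: n x => [|n IH] x dx; first exact: cvg_id.
have -> : iter n.+1 phi = iter n phi \o phi.
  by apply/funext => y; rewrite iterSr.
have [Dx dpx] := dx.
by apply: continuous_comp; [exact: phi_continuous_at|exact: IH].
Qed.

Lemma iter_dom_closed n : closed (D n).
Proof.
elim: n => [|n IH]; first exact: closedT.
have [_ clD] := Delta_clopen.
by apply: closed_preimage_at => // x; exact: phi_continuous_at.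
Qed.

Lemma iter_image_closed n : closed (iter_image Delta phi n).
Proof.
apply: (compact_closed hX); apply: continuous_compact.
  apply: continuous_in_subspaceT => x /set_mem dx.
  exact: iter_phi_continuous_at.
exact: (compact_closed_setT cX (@iter_dom_closed n)).
Qed.

Lemma essential_domain_closed : closed (essential_domain Delta phi).
Proof.
rewrite (_ : essential_domain _ _ =
    \bigcap_n (D n `&` iter_image Delta phi n)).
  apply: closed_bigI => n _; apply: closedI.
    exact: iter_dom_closed.
  exact: iter_image_closed.
apply/seteqP; split=> x.
  by move=> /essential_domainP H n _; exact: H.
by move=> H; apply/essential_domainP => n; exact: (H n I).
Qed.

Lemma orbit_prod_continuous_at n x : D n x -> {for x, continuous (P n)}.
Proof.
elim: n x => [|n IH] x dx.
  rewrite (_ : P 0 = cst 1); first exact: (@cst_continuous X R 1 x).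
  by apply/funext => y; rewrite /orbit_prod big_ord0.
rewrite (_ : P n.+1 = (fun y => P n y * u (iter n phi y))); last first.
  by apply/funext => y; rewrite /orbit_prod big_ord_recr.
have dn : D n x := iter_dom_le (leqnSn n) dx.
exact: (cvgM (IH x dn) (@continuous_comp X X R (iter n phi) u x
  (iter_phi_continuous_at dn) (@u_cont _))).
Qed.

(* Start the orbit at the minimum of [P j x / l ^ j] over [N <= j <= n]: from
   there on all products dominate the powers of [l], and the bound on [u]
   forces the minimum to be attained at least [k] steps before [n]. *)
Lemma pliss_time (l l' : R) (k N : nat) : 0 < l -> l < l' ->
  (forall n, exists2 x, D n x & l' ^+ n <= P n x) ->
  exists y, [/\ D k y, iter_image Delta phi N y &
    forall j, (j <= k)%N -> l ^+ j <= P j y].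
Proof.
move=> l0 ll' Hx; pose C := Num.max (c / l) 1.
have C1 : 1 <= C by rewrite le_max lexx orbT.
have C0 : 0 < C by exact: lt_le_trans C1.
have uC x : u x / l <= C.
  by rewrite le_max ler_pM2r ?invr_gt0//; have /andP[_ ->] := u_bnd x.
have q1 : 1 < l' / l by rewrite ltr_pdivlMr// mul1r.
(* The constant [C] bounds the growth of [P j x / l^j] in one step. In the exponent, [N] accounts
   for the steps before the minimum is sought and [k] for those that must remain after it. *)
have [n [nN Hn]] : exists n, (N <= n)%N /\ C ^+ (N + k) < (l' / l) ^+ n.
  have [n0 _ Hn0] : \forall n \near \oo, (l' / l) ^- n < (C ^+ (N + k))^-1.
    have iq : `|(l' / l)^-1| < 1.
      by rewrite ger0_norm ?invr_ge0 ?(le_trans ler01 (ltW q1))// invf_lt1// (lt_trans ltr01).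
    have := cvg_expr iq => /cvgr0_norm_lt/(_ (C ^+ (N + k))^-1).
    rewrite invr_gt0 exprn_gt0// => /(_ isT); apply: filterS => n.
    rewrite exprVn ger0_norm// invr_ge0 exprn_ge0//.
    exact: le_trans ler01 (ltW q1).
  exists (maxn n0 N); rewrite leq_maxr; split => //.
  have := Hn0 (maxn n0 N); rewrite /= leq_maxl => /(_ isT).
  by rewrite ltf_pV2// posrE exprn_gt0// (lt_trans ltr01).
have [x dx Px] := Hx n.
pose q j := P j x / l ^+ j.
have qS j : q j.+1 <= q j * C.
  rewrite /q /orbit_prod big_ord_recr/= -/(P j x) exprSr invfM mulrACA.
  apply: ler_wpM2l; last exact: uC.
  by rewrite divr_ge0 ?exprn_ge0 ?(ltW l0)// orbit_prod_ge0// => z;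
    have /andP[] := u_bnd z.
have qD i j : q (i + j)%N <= q i * C ^+ j.
  elim: j => [|j IH]; first by rewrite addn0 expr0 mulr1.
  rewrite addnS; apply: le_trans (qS _) _; rewrite exprSr mulrA.
  by rewrite ler_pM2r.
have qn : C ^+ (N + k) < q n.
  apply: lt_le_trans Hn _; rewrite /q expr_div_n ler_pM2r// invr_gt0.
  exact: exprn_gt0.
pose I := [pred j : 'I_n.+1 | (N <= j)%N].
have I0 : I (ord_max : 'I_n.+1) by rewrite /I /= nN.
case: (@arg_minP _ _ _ (ord_max : 'I_n.+1) I (fun j => q j) I0) => i /= Ni imin.
have iN : (N <= i)%N := Ni.
have i_le : (i <= n)%N by rewrite -ltnS.
have qiN : q i <= q N.
  have Nlt : (N < n.+1)%N by rewrite ltnS.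
  by apply: (imin (Ordinal Nlt)); rewrite /= leqnn.
have q00 : q 0%N = 1 by rewrite /q /orbit_prod big_ord0 expr0 divr1.
have qN : q N <= C ^+ N by have := qD 0%N N; rewrite add0n q00 mul1r.
have in_k : (k <= n - i)%N.
  rewrite leqNgt; apply/negP => lt.
  have := qD i (n - i)%N; rewrite subnKC// leNgt => /negP; apply.
  apply: le_lt_trans qn; rewrite exprD.
  apply: ler_pM => //; first by rewrite divr_ge0 ?exprn_ge0 ?(ltW l0)//
    orbit_prod_ge0// => z; have /andP[] := u_bnd z.
  - by rewrite exprn_ge0// ltW.
  - exact: le_trans qiN qN.
  - by rewrite ler_weXn2l// ltnW.
have qi0 : 0 < q i.
  have := qD i (n - i)%N; rewrite subnKC// => h.
  have : 0 < q i * C ^+ (n - i).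
    by apply: lt_le_trans h; apply: lt_trans qn; rewrite exprn_gt0.
  by rewrite pmulr_lgt0// exprn_gt0.
have li0 : 0 < l ^+ i by rewrite exprn_gt0.
have Pi0 : 0 < P i x by move: qi0; rewrite /q pmulr_lgt0// invr_gt0.
exists (iter i phi x); split.
- have := dx; rewrite -{1}(subnKC i_le) => /iter_domD [_].
  exact: iter_dom_le.
- apply: (iter_image_le iN); exists x => //; exact: iter_dom_le dx.
- move=> j jk; have jn : (i + j < n.+1)%N.
    by rewrite ltnS -leq_subRL// (leq_trans jk).
  have /imin : I (Ordinal jn) by rewrite /= (leq_trans iN)// leq_addr.
  rewrite /q /= orbit_prodD exprD invfM mulrACA -/(q i).
  rewrite ler_pMr// ler_pdivlMr ?exprn_gt0// mul1r; exact.
Qed.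

(** One compactness argument provides everything at once: the [k]-th closed set asks for [k] forward
    steps, a preimage of order [k], and products at least [l k ^ j] up to time [k], with [l k]
    increasing to [r]. The denominator [k.+2] keeps [l 0] positive. *)
Lemma pliss_point (r : R) : 0 < r ->
  (forall l n, 0 < l -> l < r -> exists2 x, D n x & l ^+ n <= P n x) ->
  exists2 y, essential_domain Delta phi y & forall k, r ^+ k <= P k y.
Proof.
move=> r0 Hx; pose l (k : nat) : R := r * (1 - k.+2%:R^-1).
have lr k : l k < r by rewrite /l gtr_pMr// gtrBl invr_gt0.
have l0 k : 0 < l k by rewrite mulr_gt0// subr_gt0 invf_lt1// ltr1n.
have ll m n : (m <= n)%N -> l m <= l n.
  by move=> mn; rewrite /l ler_pM2l// lerB// lef_pV2 ?posrE// ler_nat !ltnS.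
pose F k := [set y | D k y /\ forall j, (j <= k)%N -> l k ^+ j <= P j y] `&`
  iter_image Delta phi k.
have [|||y Fy] := @compact_nested_nonempty X F cX.
- move=> k; apply: closedI; last exact: iter_image_closed.
  rewrite (_ : mkset _ = \bigcap_(j in [set j | (j <= k)%N])
      (D k `&` P j @^-1` [set t | l k ^+ j <= t])).
    apply: closed_bigI => j jk; apply: closed_preimage_at; last exact: closed_ge.
      exact: iter_dom_closed.
    move=> x dx; apply: orbit_prod_continuous_at; exact: iter_dom_le jk _ dx.
  apply/seteqP; split=> y.
    by move=> [dy H] j jk; split => //; exact: H.
  by move=> H; split=> [|j jk]; [exact: (H 0%N (leq0n _)).1|exact: (H j jk).2].
- move=> m n mn y [[dy H] iy]; split; last exact: iter_image_le iy.
  split; first exact: iter_dom_le dy.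
  move=> j jm; apply: le_trans (H j (leq_trans jm mn)).
  by apply: lerXn2r; rewrite ?nnegrE ?(ltW (l0 _)) ?ll.
- move=> k; have [||n|y [dy iy Py]] := @pliss_time (l k) ((l k + r) / 2) k k.
  + exact: l0.
  + by have := lr k; lra.
  + by apply: Hx; have := lr k; have := l0 k; lra.
  + by exists y.
exists y; first by apply/essential_domainP => n; have [[dy _] iy] := Fy n I.
move=> k.
have lim : l n ^+ k @[n --> \oo] --> r ^+ k.
  have ch : n.+2%:R^-1 @[n --> \oo] --> (0 : R).
    by have := @cvg_harmonic R; rewrite -(cvg_shiftS (@harmonic R) _).
  have cl : l n @[n --> \oo] --> r * (1 - 0).
    by apply: cvgM; [exact: cvg_cst|apply: cvgB; [exact: cvg_cst|exact: ch]].
  rewrite subr0 mulr1 in cl.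
  elim: k => [|k IH]; first by under eq_fun do rewrite expr0; exact: cvg_cst.
  under eq_fun do rewrite exprS; rewrite exprS.
  exact: cvgM.
apply: (cvgr_to_le lim); exists k => // n /= kn.
by have [[_ H] _] := Fy n I; exact: H.
Qed.

End PartialDynamics.

(** * Weighted endomorphisms and their powers *)

Section WeightedEndomorphism.
Context {R : realType} {A : comBanachAlgType R[i]}.
Hypothesis uniformA : uniform_algebra A.
Context (alpha : A -> A) (Delta : set (gelfand_spectrum A))
  (phi : gelfand_spectrum A -> gelfand_spectrum A) (a : A).
Hypotheses (endo_alpha : algebra_endomorphism alpha)
  (dual_phi : dual_partial_system alpha Delta phi).

Local Notation X := (gelfand_spectrum A).
Local Notation T := (weighted_endo a alpha).
Local Notation r := (op_spectral_radius T).
Local Notation D := (iter_dom Delta phi).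
Local Notation P := (orbit_prod phi (fun x => cmod (gelfand a x))).

Lemma weighted_endo_linear : linear T.
Proof.
have [al _] := endo_alpha.
by move=> z u v; rewrite /weighted_endo al bmulDr bmulZr.
Qed.

Lemma endomorphism_contractive b : rnorm (alpha b) <= rnorm b.
Proof.
have [_ _ inD outD] := dual_phi.
apply: uniform_algebra_norm_le => //; first exact: rnorm_ge0.
move=> x; have [Dx|nDx] := pselect (Delta x).
  by rewrite inD// gelfand_bound.
by rewrite outD// cmod0 rnorm_ge0.
Qed.

Lemma weighted_endo_bound b : rnorm (T b) <= rnorm a * rnorm b.
Proof.
apply: le_trans (rnormM _ _) _; apply: ler_wpM2l; first exact: rnorm_ge0.
exact: endomorphism_contractive.
Qed.

Lemma cmod_iter_weighted_endo n b x : D n x ->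
  cmod (gelfand (iter n T b) x) = P n x * cmod (gelfand b (iter n phi x)).
Proof.
have [_ _ inD _] := dual_phi.
elim: n x => [|n IH] x; first by rewrite /orbit_prod big_ord0 mul1r.
move=> [Dx dpx] /=; rewrite gelfandM cmodM inD// IH//.
rewrite mulrA -[(_ * _ * _)]/(_ * _) -(iterS n phi x) iterSr.
rewrite -[n.+1]/(1 + n)%N orbit_prodD /=; congr (_ * _ * _).
by rewrite /orbit_prod big_ord1.
Qed.

Lemma gelfand_iter_weighted_endo0 n b x : ~ D n x ->
  gelfand (iter n T b) x = 0.
Proof.
have [_ _ inD outD] := dual_phi.
elim: n x => [|n IH] x; first by case.
move=> nD /=; rewrite gelfandM; have [Dx|nDx] := pselect (Delta x).
  by rewrite inD// IH ?mulr0// => dpx; apply: nD.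
by rewrite outD// mulr0.
Qed.

Lemma rnorm_iter_weighted_endo n (l : R) : 0 <= l ->
  (forall x, D n x -> P n x <= l) ->
  forall b, rnorm (iter n T b) <= l * rnorm b.
Proof.
move=> l0 H b; apply: uniform_algebra_norm_le => //.
  by rewrite mulr_ge0// rnorm_ge0.
move=> x; have [dx|ndx] := pselect (D n x).
  rewrite cmod_iter_weighted_endo//; apply: ler_pM => //.
  - by apply: orbit_prod_ge0 => y; exact: cmod_ge0.
  - exact: cmod_ge0.
  - exact: H.
  - exact: gelfand_bound.
by rewrite gelfand_iter_weighted_endo0// cmod0 mulr_ge0// rnorm_ge0.
Qed.

Lemma spectral_radius_le n (l : R) : (0 < n)%N -> 0 <= l ->
  (forall x, D n x -> P n x <= l ^+ n) -> (r <= l%:E)%E.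
Proof.
move=> n0 l0 H; apply: ge_ereal_sup => _ [z sz <-]; rewrite lee_fin leNgt.
apply/negP => lz; apply: sz.
have [|||S [Sl [K HK] Sleft Sright]] := @resolvent_of_power R A T z (rnorm a)
  (l ^+ n) n weighted_endo_linear weighted_endo_bound.
- by apply: rnorm_iter_weighted_endo => //; rewrite exprn_ge0.
- by rewrite ltr_pXn2r// ?nnegrE// (le_trans l0)// ltW.
- by rewrite exprn_ge0.
by exists S; split => //; split => //; exists K.
Qed.

Lemma spectral_radius_le_norm : (r <= (rnorm a)%:E)%E.
Proof.
apply: (@spectral_radius_le 1) => //; first exact: rnorm_ge0.
move=> x _; rewrite /orbit_prod big_ord1 expr1; exact: gelfand_bound.
Qed.

Lemma bounded_resolvent_choice (rho : R) :
  (forall z, rho <= cmod z -> ~ op_spectrum T z) ->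
  exists S : R[i] -> A -> A, forall z, rho <= cmod z ->
    [/\ linear (S z), exists K, forall b, rnorm (S z b) <= K * rnorm b,
     forall b, S z (z *: b - T b) = b & forall b, z *: S z b - T (S z b) = b].
Proof.
move=> H; suff /choice[S HS] : forall z, exists S : A -> A, rho <= cmod z ->
    [/\ linear S, exists K, forall b, rnorm (S b) <= K * rnorm b,
     forall b, S (z *: b - T b) = b & forall b, z *: S b - T (S b) = b].
  by exists S.
move=> z; have [zr|zr] := leP rho (cmod z); last by exists id.
have := H z zr; rewrite /op_spectrum /= => /contrapT[S [[Sl Sb] Sleft Sright]].
by exists S.
Qed.

(** A supremum over the empty set is [-oo], so the point is that the spectrum is nonempty: otherwise
    the resolvent would be entire and the unit of [A] would have norm 0. *)
Lemma spectral_radius_ge0 : (0 <= r)%E.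
Proof.
have [[z sz]|ne] := pselect (exists z, op_spectrum T z).
  apply: le_ereal_sup_tmp; exists (cmod z)%:E; first by exists z.
  by rewrite lee_fin cmod_ge0.
exfalso; have [|S HS] := @bounded_resolvent_choice 0.
  by move=> z _ sz; apply: ne; exists z.
have HS' z := HS z (cmod_ge0 z).
have : rnorm (@bone R[i] A) = 0.
  apply: (@entire_resolvent_trivial R A (@rnorm R A) (@rnorm_ge0 R A)
    (@rnormZ R A) (@rnormD R A) T S (rnorm a)).
  - exact: weighted_endo_linear.
  - exact: weighted_endo_bound.
  - by move=> z; have [] := HS' z.
  - by move=> z; have [] := HS' z.
  - by move=> z v; have [_ _ -> _] := HS' z; rewrite subrr rnorm0.
  - by move=> z v; have [_ _ _ ->] := HS' z; rewrite subrr rnorm0.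
by move/eqP; rewrite rnorm_eq0; apply/negP; exact: bone_neq0.
Qed.

Lemma spectral_radius_fin : r \is a fin_num.
Proof.
rewrite ge0_fin_numE ?spectral_radius_ge0//.
by rewrite (le_lt_trans spectral_radius_le_norm)// ltry.
Qed.

(** The power bound is applied outside a disc of radius strictly between [r] and [l], and evaluated
    at the unit: the modulus of the transform of [T^n 1] is [P n] on [D n], and the unit has norm at
    most 1. *)
Lemma spectral_radius_gt (l : R) : (r < l%:E)%E -> exists k0, forall k,
  (k0 <= k)%N -> forall x, D (2 ^ k) x -> P (2 ^ k) x <= l ^+ (2 ^ k).
Proof.
move=> rl; have := spectral_radius_ge0; have := spectral_radius_fin.
case rE : r rl => [s| |] // ; rewrite lte_fin lee_fin => sl _ s0.
pose rho := (s + l) / 2; have rho0 : 0 < rho by rewrite /rho; lra.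
have srho : s < rho by rewrite /rho; lra.
have rhol : rho < l by rewrite /rho; lra.
have [|S HS] := @bounded_resolvent_choice rho.
  move=> z zr sz; have : ((cmod z)%:E <= r)%E.
    by apply: ereal_sup_ubound; exists z.
  by rewrite rE lee_fin leNgt (lt_le_trans srho zr).
have [||||k0 Hk0] := @resolvent_power_small R A (@rnorm R A) (@rnorm_ge0 R A)
    (@rnormZ R A) (@rnormD R A) T S rho (rnorm a) weighted_endo_linear
    weighted_endo_bound rho0 _ _ _ _ l rhol 1 ltr01.
- by move=> z zr; have [] := HS z zr.
- by move=> z zr; have [] := HS z zr.
- by move=> z v zr; have [_ _ -> _] := HS z zr; rewrite subrr rnorm0.
- by move=> z v zr; have [_ _ _ ->] := HS z zr; rewrite subrr rnorm0.
exists k0 => k kk0 x dx.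
have := Hk0 k kk0 bone; rewrite mul1r => h.
have /esym := cmod_iter_weighted_endo bone dx; rewrite gelfand1 cmod1 mulr1 => ->.
apply: le_trans (gelfand_bound _ _) _; apply: le_trans h _.
rewrite ler_piMr ?exprn_ge0 ?(ltW (le_lt_trans s0 sl))//.
apply: uniform_algebra_norm_le => // y.
by rewrite gelfand1 cmod1.
Qed.

(** If [P n] stayed below [l^n] on all of [D n] for some [n > 0] and [l < r], the spectral radius
    would be at most [l]; so each such pair has a point as required by [pliss_point]. *)
Lemma spectral_radius_orbit : (0 < r)%E ->
  exists2 y, essential_domain Delta phi y & forall k, fine r ^+ k <= P k y.
Proof.
move=> r0; have fr := spectral_radius_fin.
have [cD ccD _ _] := dual_phi.
apply: (@pliss_point R X Delta phi (@gelfand_hausdorff R A)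
  (@compact_gelfand R A) cD ccD (fun x => cmod (gelfand a x)) (rnorm a)).
- exact: cmod_gelfand_continuous.
- by move=> x; rewrite cmod_ge0 gelfand_bound.
- by rewrite -lte_fin fineK.
move=> l n l0 lr.
have key k : (0 < k)%N -> exists2 x, D k x & l ^+ k <= P k x.
  move=> k0; apply: contrapT => nx.
  have H x : D k x -> P k x <= l ^+ k.
    move=> dx; rewrite leNgt; apply/negP => lP; apply: nx; exists x => //.
    exact: ltW.
  have := spectral_radius_le k0 (ltW l0) H.
  by rewrite -(fineK fr) lee_fin leNgt lr.
(* For [n = 0] any point of the spectrum will do, and the case of exponent 1 supplies one. *)
have [n0|] := posnP n; last exact: key.
have [x _ _] := key 1%N isT; exists x; rewrite n0//.
by rewrite /orbit_prod big_ord0 expr0.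
Qed.

End WeightedEndomorphism.

(** * Integrals of logarithms *)

Section LogDefect.
Context {R : realType} {Y : topologicalType} (y0 : Y).
Local Open Scope ereal_scope.

Lemma ge0_integral_image {Z : topologicalType} (z0 : Z)
    (mu : probability (borel y0) R) (nu : probability (borel z0) R) (f : Y -> Z)
    (g : Z -> \bar R) : continuous f ->
  (forall B : set Z, measurable (B : set (borel z0)) -> nu B = mu (f @^-1` B)) ->
  (forall z, 0 <= g z) -> measurable_fun setT (g : borel z0 -> \bar R) ->
  \int[nu]_z g z = \int[mu]_y g (f y).
Proof.
move=> cf nuE g0 mg.
have mf : measurable_fun setT (f : borel y0 -> borel z0).
  by move=> _ B mB; rewrite setTI; exact: (continuous_borel y0 cf mB).
rewrite -[RHS]/(\int[mu]_(y in (f : borel y0 -> borel z0) @^-1` setT)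
  ((g : borel z0 -> \bar R) \o f) y) -ge0_integral_pushforward//.
by apply: eq_measure_integral => B mB _; exact: nuE.
Qed.

Section Defect.
Context (v : Y -> R) (c : R).
Hypotheses (v_cont : continuous v) (v_bnd : forall y, (0 <= v y <= expR c)%R).

(** Nonnegative since [v <= exp c], and [+oo] at the zeros of [v]: maximizing the integral of [ln v]
    becomes minimizing that of a nonnegative lower semicontinuous function. *)
Definition log_defect (y : Y) : \bar R := c%:E - lne (v y)%:E.

Lemma lne_log_defect y : lne (v y)%:E = c%:E - log_defect y.
Proof.
rewrite /log_defect; case: (lne (v y)%:E) => //= x.
by congr EFin; lra.
Qed.

Lemma log_defect0 y : v y = 0%R -> log_defect y = +oo.
Proof. by move=> v0; rewrite /log_defect v0 le0_lneNy. Qed.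

Lemma log_defect_gt0 y : (0 < v y)%R -> log_defect y = (c - ln (v y))%:E.
Proof. by move=> v0; rewrite /log_defect lne_EFin. Qed.

Lemma log_defect_ge0 y : 0 <= log_defect y.
Proof.
have /andP[v0 vc] := v_bnd y; have [v1|] := eqVneq (v y) 0%R.
  by rewrite log_defect0// leey.
move=> v1; have v2 : (0 < v y)%R by rewrite lt_neqAle eq_sym v1.
rewrite log_defect_gt0// lee_fin subr_ge0 -[leRHS](@expRK R).
by rewrite ler_ln// posrE expR_gt0.
Qed.

Lemma log_defect_lsc : lower_semicontinuous log_defect.
Proof.
apply/lower_semicontinuousP => t.
rewrite (_ : mkset _ = v @^-1` [set x | (x < expR (c - t))%R]).
  by apply: open_comp; [move=> y _; exact: v_cont|exact: open_lt].
apply/seteqP; split=> y /=; have /andP[v0 _] := v_bnd y.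
  have [->|v1] := eqVneq (v y) 0%R; first by rewrite expR_gt0.
  have v2 : (0 < v y)%R by rewrite lt_neqAle eq_sym v1.
  rewrite log_defect_gt0// lte_fin => h.
  by rewrite -[ltLHS]lnK ?posrE// ltr_expR; lra.
have [v1 _|v1] := eqVneq (v y) 0%R; first by rewrite log_defect0// ltry.
have v2 : (0 < v y)%R by rewrite lt_neqAle eq_sym v1.
rewrite log_defect_gt0// lte_fin -{1}[v y]lnK ?posrE// ltr_expR; lra.
Qed.

Lemma log_defect_measurable :
  measurable_fun setT (log_defect : borel y0 -> \bar R).
Proof. exact: lsc_measurable log_defect_lsc. Qed.

(** For an integrable defect this is linearity. Otherwise the negative part of [ln v] has infinite
    integral while its positive part is at most [|c|], so the integral is [-oo] and not an
    undetermined difference. *)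
Lemma integral_lne (mu : probability (borel y0) R) :
  \int[mu]_y lne (v y)%:E = c%:E - \int[mu]_y log_defect y.
Proof.
have mh := log_defect_measurable; have h0 := log_defect_ge0.
have muT : mu setT = 1 := probability_setT mu.
pose f y : \bar R := lne (v y)%:E.
have fE : f = (fun y => c%:E - log_defect y).
  by apply/funext => y; exact: lne_log_defect.
have mf : measurable_fun setT (f : borel y0 -> \bar R).
  by rewrite fE; apply: emeasurable_funB => //; exact: measurable_cst.
have intc (b : R) : \int[mu]__ b%:E = b%:E.
  by rewrite integral_cst// [X in _ * X](probability_setT mu) mule1.
have [hoo|hfin] := eqVneq (\int[mu]_y log_defect y) +oo; last first.
  have ih : mu.-integrable setT (log_defect : borel y0 -> \bar R).
    apply/integrableP; split => //.
    under eq_integral => y _ do rewrite gee0_abs//.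
    by rewrite ltey.
  have ic : mu.-integrable setT (fun _ : borel y0 => c%:E).
    by apply: finite_measure_integrable_cst.
  rewrite -/(f _) -[LHS]/(\int[mu]_y f y) fE.
  by rewrite -[in RHS](intc c) -integralB.
rewrite hoo -[LHS]/(\int[mu]_y f y) integralE.
have neg : \int[mu]_y f^\- y = +oo.
  apply/eqP; rewrite -leye_eq.
  have : \int[mu]_y log_defect y <= \int[mu]_y (f^\- y + `|c|%:E).
    apply: ge0_le_integral => //.
    - by apply: emeasurable_funD => //; exact: measurable_funeneg.
    - move=> y _; rewrite funenegE /f lne_log_defect; have := h0 y.
      case: (log_defect y) => [x| |]//= x0.
      + rewrite -EFin_max -EFinD lee_fin.
        rewrite -lerBlDr le_max; apply/orP; left.
        have := ler_norm c; lra.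
  rewrite hoo ge0_integralD//; last exact: measurable_funeneg.
  rewrite intc; case: (\int[mu]_y f^\- y) => //= x.
rewrite neg; have : \int[mu]_y f^\+ y <= `|c|%:E.
  rewrite -(intc `|c|%R); apply: ge0_le_integral => //.
  - exact: measurable_funepos.
  - move=> y _; rewrite funeposE /f lne_log_defect; have := h0 y.
    case: (log_defect y) => [x| |]//= x0.
    + rewrite -EFin_max lee_fin ge_max normr_ge0 andbT.
      by have := ler_norm c; rewrite lee_fin in x0; lra.
    + by rewrite maxNye lee_fin.
have : 0 <= \int[mu]_y f^\+ y by exact: integral_ge0.
by case: (\int[mu]_y f^\+ y).
Qed.

Context (T : Y -> Y).

Lemma log_defect_sum y n : (0 < orbit_prod T v n y)%R ->
  \sum_(i < n) log_defect (iter i T y) =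
    (n%:R * c - ln (orbit_prod T v n y))%:E.
Proof.
elim: n => [|n IH].
  by rewrite big_ord0 /orbit_prod big_ord0 ln1 mul0r subrr.
rewrite /orbit_prod big_ord_recr/= -/(orbit_prod T v n y) => vn.
have v0 z : (0 <= v z)%R by have /andP[] := v_bnd z.
have P0 : (0 <= orbit_prod T v n y)%R by exact: orbit_prod_ge0.
have P1 : (0 < orbit_prod T v n y)%R.
  rewrite lt_neqAle P0 andbT; apply/eqP => P1.
  by move: vn; rewrite -P1 mul0r ltxx.
have v1 : (0 < v (iter n T y))%R by move: vn; rewrite pmulr_rgt0.
rewrite big_ord_recr/= IH// log_defect_gt0// lnM ?posrE// -EFinD; congr EFin.
by rewrite -natr1; ring.
Qed.

Lemma log_defect_sum_le y n (r : R) : (0 < r)%R ->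
  (r ^+ n <= orbit_prod T v n y)%R ->
  \sum_(i < n) log_defect (iter i T y) <= (n%:R * (c - ln r))%:E.
Proof.
move=> r0 rP; have P0 : (0 < orbit_prod T v n y)%R.
  by apply: lt_le_trans rP; rewrite exprn_gt0.
rewrite log_defect_sum// lee_fin mulrBr lerB// mulr_natl -lnXn//.
  by rewrite ler_ln// posrE exprn_gt0.
Qed.

Lemma log_defect_sum_ge y n (l : R) : (0 < l)%R ->
  (orbit_prod T v n y <= l ^+ n)%R ->
  (n%:R * (c - ln l))%:E <= \sum_(i < n) log_defect (iter i T y).
Proof.
move=> l0 Pl; have v0 z : (0 <= v z)%R by have /andP[] := v_bnd z.
have P0 : (0 <= orbit_prod T v n y)%R by exact: orbit_prod_ge0.
have [P1|P1] := eqVneq (orbit_prod T v n y) 0%R; last first.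
  have P2 : (0 < orbit_prod T v n y)%R by rewrite lt_neqAle eq_sym P1.
  rewrite log_defect_sum// lee_fin mulrBr lerB// mulr_natl -lnXn//.
  by rewrite ler_ln// posrE exprn_gt0.
move/eqP : P1; rewrite /orbit_prod prodf_seq_eq0 => /hasP[i _ /= /eqP vi].
rewrite (bigD1 i)//= log_defect0// addye ?leey//.
by rewrite -ltNye; apply: lt_le_trans (ltNyr 0) _; apply: sume_ge0 => j _;
  exact: log_defect_ge0.
Qed.

Hypothesis cT : continuous T.

Lemma iter_continuous n : continuous (iter n T).
Proof.
elim: n => [|n IH] y; first exact: cvg_id.
exact: (@continuous_comp Y Y Y (iter n T) T y (IH y) (@cT (iter n T y))).
Qed.

Lemma invariant_iter mu n (B : set Y) : invariant_measures R y0 T mu ->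
  measurable (B : set (borel y0)) -> mu (iter n T @^-1` B) = mu B.
Proof.
move=> [_ imu] mB; elim: n => [//|n IH].
have -> : iter n.+1 T @^-1` B = T @^-1` (iter n T @^-1` B).
  by apply/funext => y; rewrite /preimage /mkset iterSr.
rewrite imu//; exact: (continuous_borel y0 (@iter_continuous n) mB).
Qed.

(** By invariance, the defect summed over [n] iterates has [n] times the integral of the defect, and
    the sum is at least [n (c - ln l)] at every point. *)
Lemma invariant_integral_lne_le mu (l : R) n : invariant_measures R y0 T mu ->
  (0 < n)%N -> (0 < l)%R -> (forall y, orbit_prod T v n y <= l ^+ n)%R ->
  \int[mu]_y lne (v y)%:E <= (ln l)%:E.
Proof.
move=> imu n0 l0 Pl.
have mh := log_defect_measurable; have h0 := log_defect_ge0.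
have I0 : 0 <= \int[mu]_y log_defect y by exact: integral_ge0.
(* For [c <= ln l] nonnegativity of the defect suffices; otherwise [c - ln l] is positive, as the
   comparison of nonnegative integrals requires. *)
rewrite (integral_lne mu); have [cl|lc] := leP c (ln l).
  move: I0; case: (\int[mu]_y log_defect y) => [x| |]//=; last by rewrite leNye.
  by rewrite lee_fin -EFinB !lee_fin; lra.
have h : (n%:R * (c - ln l))%:E <= n%:R%:E * \int[mu]_y log_defect y.
  have -> : n%:R%:E * \int[mu]_y log_defect y =
      \int[mu]_y \sum_(i < n) log_defect (iter i T y).
    rewrite (@ge0_integral_sum _ (borel y0) R mu setT measurableT 'I_n
      (fun i y => log_defect (iter i T y))) /=.
    - rewrite (eq_bigr (fun=> \int[mu]_y log_defect y)); last first.
        move=> i _; apply/esym; apply: ge0_integral_image => //.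
          exact: iter_continuous.
        by move=> B mB; rewrite (invariant_iter i imu).
      by rewrite sumr_const card_ord mule_natl.
    - move=> i; apply: (measurableT_comp mh) => _ B mB; rewrite setTI.
      exact: (continuous_borel y0 (@iter_continuous i) mB).
    - by move=> i y _; exact: h0.
  have -> : (n%:R * (c - ln l))%:E = \int[mu]_y (n%:R * (c - ln l))%:E.
    by rewrite integral_cst// [X in _ * X](probability_setT mu) mule1.
  apply: ge0_le_integral => //.
  - by move=> y _; rewrite lee_fin mulr_ge0// subr_ge0 ltW.
  - apply: emeasurable_sum => i; apply: (measurableT_comp mh) => _ B mB.
    by rewrite setTI; exact: (continuous_borel y0 (@iter_continuous i) mB).
  - by move=> y _; exact: log_defect_sum_ge.
rewrite EFinM lee_pmul2l// in h; last by rewrite lte_fin ltr0n.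
move: h; case: (\int[mu]_y log_defect y) => [x| |]//=; last by rewrite leNye.
by rewrite lee_fin -EFinB lee_fin; lra.
Qed.

End Defect.
End LogDefect.

Lemma prob_setI1 {R : realType} {Y : topologicalType} {y0 : Y}
    (mu : probability (borel y0) R) (B C : set Y) :
  measurable (B : set (borel y0)) -> measurable (C : set (borel y0)) ->
  mu C = 1%E -> mu (B `&` C) = mu B.
Proof.
move=> mB mC muC; have nC : mu (~` C) = 0%E.
  by rewrite (prob_setC mu mC) muC subee.
have mCc : measurable (~` C : set (borel y0)) by exact: measurableC.
apply: le_anti; apply/andP; split.
  by apply: le_measure; rewrite ?inE//; exact: measurableI.
have {1}-> : B = (B `&` C) `|` (B `&` ~` C).
  by rewrite -setIUr setUv setIT.
apply: le_trans (measureU2 _ _ _) _; [exact: measurableI|exact: measurableI|].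
rewrite -[leRHS]adde0 leeD2l// -nC.
by apply: le_measure; rewrite ?inE//; exact: measurableI.
Qed.

(** * Measures transported along an embedding *)

Section ImageProbability.
Context {R : realType} {Y Z : topologicalType} (y0 : Y) (z0 : Z) (f : Y -> Z).
Hypothesis f_cont : continuous f.
Context (mu : probability (borel y0) R).
Local Open Scope ereal_scope.

Let image_prob (B : set (borel z0)) : \bar R := mu (f @^-1` B).

Let image_prob0 : image_prob set0 = 0.
Proof. by rewrite /image_prob preimage_set0 measure0. Qed.

Let image_prob_ge0 B : 0 <= image_prob B.
Proof. exact: measure_ge0. Qed.

Let image_prob_sigma_additive : semi_sigma_additive image_prob.
Proof.
move=> F mF tF mUF; rewrite /image_prob preimage_bigcup.
apply: measure_semi_sigma_additive.
- by move=> n; exact: (continuous_borel y0 f_cont (mF n)).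
- apply/trivIsetP => /= i k _ _ ik; rewrite -preimage_setI.
  by move/trivIsetP : tF => /(_ _ _ I I ik) ->; rewrite preimage_set0.
- by rewrite -preimage_bigcup; exact: (continuous_borel y0 f_cont mUF).
Qed.

HB.instance Definition _ := isMeasure.Build _ _ _ image_prob
  image_prob0 image_prob_ge0 image_prob_sigma_additive.

Let image_probT : image_prob setT = 1.
Proof. by rewrite /image_prob preimage_setT; exact: probability_setT. Qed.

HB.instance Definition _ :=
  Measure_isProbability.Build _ _ _ image_prob image_probT.

Lemma exists_image_probability : exists nu : probability (borel z0) R,
  forall B : set Z, measurable (B : set (borel z0)) -> nu B = mu (f @^-1` B).
Proof. by exists (image_prob : probability (borel z0) R). Qed.

End ImageProbability.

Section Embedding.
Context {R : realType} {Y Z : topologicalType} (y0 : Y) (z0 : Z) (j : Z -> Y).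
Hypotheses (hY : hausdorff_space Y) (hZ : hausdorff_space Z).
Hypotheses (j_cont : continuous j) (j_inj : injective j)
  (j_emb : forall z (B : set Z), nbhs z B ->
    exists W : set Y, [/\ open W, W (j z) & j @^-1` W `<=` B]).
Local Open Scope ereal_scope.

Lemma embedding_preimage_image (B : set Z) : j @^-1` (j @` B) = B.
Proof.
by apply/seteqP; split=> z; [move=> [w Bw /j_inj <-]|move=> Bz; exists z].
Qed.

Lemma embedding_image_preimage (B : set Y) :
  j @` (j @^-1` B) = B `&` range j.
Proof.
apply/seteqP; split=> y; first by move=> [z Bz <-]; split => //; exists z.
by move=> [By [z _ zy]]; exists z => //; rewrite /preimage /= zy.
Qed.

Lemma embedding_compact_preimage (C : set Y) : compact C -> C `<=` range j ->
  compact (j @^-1` C).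
Proof.
move=> cC Cj F PF FC.
have PG : ProperFilter (j @ F) by exact: fmap_proper_filter.
have GC : (j @ F) C by exact: FC.
have [y [Cy cly]] := cC _ PG GC.
have [z _ zy] := Cj _ Cy; rewrite -zy in Cy cly.
exists z; split => // B D FB /j_emb[W [oW Wz WD]].
have GB : (j @ F) (j @` B) by apply: (@filterS _ F _ B) FB => w Bw; exists w.
have [_ [[w Bw <-] Ww]] := cly _ W GB (open_nbhs_nbhs (conj oW Wz)).
by exists w; split => //; exact: WD.
Qed.

Section Dynamics.
Context (T : Y -> Y) (S : Z -> Z).
Hypotheses (cT : continuous T)
  (jS : forall z, j (S z) = T (j z)).

Lemma image_invariant_measure (nu : probability (borel z0) R) :
  invariant_measures R z0 S nu -> exists mu, invariant_measures R y0 T mu /\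
    forall B : set Y, measurable (B : set (borel y0)) -> mu B = nu (j @^-1` B).
Proof.
move=> [rnu inu]; have [mu muE] := exists_image_probability y0 j_cont nu.
exists mu; split => //; split.
  apply: radonP => // B e mB e0; rewrite muE//.
  have mjB := continuous_borel z0 j_cont mB.
  have [C [cC CB Ce]] := radon_inner_approx hZ rnu mjB e0.
  exists (j @` C); split.
  - by apply: continuous_compact => //; exact: continuous_subspaceT.
  - by move=> _ [z /CB Bz <-].
  apply: le_trans Ce _; rewrite leeD2r// muE; last first.
    apply: compact_borel => //; apply: continuous_compact => //.
    exact: continuous_subspaceT.
  by rewrite embedding_preimage_image.
move=> B mB; rewrite !muE//; last exact: (continuous_borel y0 cT mB).
rewrite -[RHS](inu _ (continuous_borel z0 j_cont mB)).
by congr (nu _); apply/funext => z; rewrite /preimage /mkset jS.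
Qed.

Section Restriction.
Context (mu : probability (borel y0) R).
Hypotheses (mj : measurable (range j : set (borel y0))) (muj : mu (range j) = 1).

Lemma embedding_image_borel (B : set Z) : measurable (B : set (borel z0)) ->
  measurable (j @` B : set (borel y0)).
Proof.
move: B; apply: smallest_sub; last first.
  move=> U oU.
  pose W := \bigcup_(V in [set V : set Y | open V /\ j @^-1` V `<=` U]) V.
  have -> : j @` U = W `&` range j.
    apply/seteqP; split=> y.
      move=> [z Uz <-]; split; last by exists z.
      have [V [oV Vz VU]] := j_emb (open_nbhs_nbhs (conj oU Uz)).
      by exists V.
    by move=> [[V [oV VU] Vy] [z _ zy]]; exists z => //; apply: VU; rewrite /= zy.
  by apply: measurableI => //; apply: open_borel; apply: bigcup_open => V [].
split.
- by rewrite /= image_set0; exact: measurable0.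
- move=> B /= mB; rewrite setTD (_ : j @` (~` B) = range j `\` j @` B).
    exact: measurableD.
  apply/seteqP; split=> y.
    by move=> [z nBz <-]; split; [exists z|move=> [w Bw /j_inj wz]; rewrite wz in Bw].
  by move=> [[z _ zy] nBy]; exists z => // Bz; apply: nBy; exists z.
- by move=> F /= mF; rewrite image_bigcup; exact: bigcup_measurable.
Qed.

Let restr_prob (B : set (borel z0)) : \bar R := mu (j @` B).

Let restr_prob0 : restr_prob set0 = 0.
Proof. by rewrite /restr_prob image_set0 measure0. Qed.

Let restr_prob_ge0 B : 0 <= restr_prob B.
Proof. exact: measure_ge0. Qed.

Let restr_prob_sigma_additive : semi_sigma_additive restr_prob.
Proof.
move=> F mF tF mUF; rewrite /restr_prob image_bigcup.
apply: measure_semi_sigma_additive.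
- by move=> n; exact: (embedding_image_borel (mF n)).
- apply/trivIsetP => /= i k _ _ ik; apply/seteqP; split=> // y.
  move=> [[z Fz <-] [w Fw /j_inj wz]]; rewrite wz in Fw.
  move/trivIsetP : tF => /(_ _ _ I I ik) E.
  by have : (F i `&` F k) z by []; rewrite E.
- by rewrite -image_bigcup; exact: (embedding_image_borel mUF).
Qed.

HB.instance Definition _ := isMeasure.Build _ _ _ restr_prob
  restr_prob0 restr_prob_ge0 restr_prob_sigma_additive.

HB.instance Definition _ :=
  Measure_isProbability.Build _ _ _ restr_prob muj.

Lemma exists_restricted_probability : exists nu : probability (borel z0) R,
  forall B : set Z, nu B = mu (j @` B).
Proof. by exists (restr_prob : probability (borel z0) R). Qed.

(** For an [S]-invariant [w], the image [W = j w] is merely contained in its [T]-preimage, since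
    points off the range may be mapped into it. Its iterated preimages increase and all have the
    measure of [W]; their union is strictly invariant, and ergodicity of [mu] applies to it. *)
Lemma restricted_ergodic_measure : ergodic_measures R y0 T mu ->
  exists nu, ergodic_measures R z0 S nu /\
    forall B : set Y, measurable (B : set (borel y0)) -> mu B = nu (j @^-1` B).
Proof.
move=> [[rmu imu] emu]; have [nu nuE] := exists_restricted_probability.
exists nu; split; last first.
  move=> B mB; rewrite nuE embedding_image_preimage; exact/esym/prob_setI1.
split; first split.
- apply: radonP => // B e mB e0.
  have mjB := embedding_image_borel mB.
  have [C [cC CB Ce]] := radon_inner_approx hY rmu mjB e0.
  have Cj : C `<=` range j by move=> y /CB [z _ zy]; exists z.
  exists (j @^-1` C); split.
  + exact: embedding_compact_preimage.
  + by move=> z /CB [w Bw /j_inj <-].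
  + by rewrite !nuE embedding_image_preimage (setIidl Cj).
- move=> w mw; rewrite !nuE.
  have mjw := embedding_image_borel mw.
  have -> : j @` (S @^-1` w) = T @^-1` (j @` w) `&` range j.
    apply/seteqP; split=> y.
      by move=> [z Sz <-]; split; [exists (S z)|exists z].
    by move=> [[u wu Tu] [z _ zy]]; exists z => //; rewrite /preimage /=;
      rewrite -zy -jS in Tu; move/j_inj : Tu => <-.
  have mTjw := continuous_borel y0 cT mjw.
  by rewrite (prob_setI1 mTjw mj muj) imu.
move=> w mw iw; rewrite !nuE.
pose W := j @` w; have mW : measurable (W : set (borel y0)).
  exact: embedding_image_borel.
pose V n := iter n T @^-1` W.
have mV n : measurable (V n : set (borel y0)).
  by apply: (continuous_borel y0 _ mW); exact: iter_continuous.
have VS n : V n.+1 = T @^-1` V n.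
  by apply/funext => y; rewrite /V /preimage /mkset iterSr.
have VleS n : V n `<=` V n.+1.
  move=> y [z wz zy]; exists (S z); last by rewrite jS zy.
  by have : (S @^-1` w) z by rewrite iw.
have Vle : nondecreasing_seq V by apply/nondecreasing_seqP => n; exact/subsetPset.
have mUV : measurable (\bigcup_n V n : set (borel y0)) by exact: bigcup_measurable.
have muV n : mu (V n) = mu W by rewrite /V (invariant_iter cT n (conj rmu imu) mW).
have muUV : mu (\bigcup_n V n) = mu W.
  have : (fun n => mu (V n)) @ \oo --> mu (\bigcup_n V n).
    exact: (nondecreasing_cvg_mu mV mUV Vle).
  rewrite (_ : (fun n => mu (V n)) = cst (mu W)); last exact/funext.
  by move/cvg_lim => <- //; rewrite lim_cst.
have iUV : T @^-1` (\bigcup_n V n) = \bigcup_n V n.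
  rewrite preimage_bigcup; apply/seteqP; split=> y [n _ Vy].
    by exists n.+1 => //; rewrite VS.
  by exists n => //; rewrite -VS; exact: VleS.
by have := emu _ mUV iUV; rewrite muUV.
Qed.

End Restriction.
End Dynamics.
End Embedding.

(** * Null sets and auxiliary integrands *)

Section NullSets.
Context {R : realType} {Y : topologicalType} {y0 : Y}.
Implicit Type mu : probability (borel y0) R.
Local Open Scope ereal_scope.

Lemma integral_lty_null mu (g : Y -> \bar R) (Z : set Y) :
  (forall y, 0 <= g y) -> measurable_fun setT (g : borel y0 -> \bar R) ->
  measurable (Z : set (borel y0)) -> (forall z, Z z -> g z = +oo) ->
  \int[mu]_y g y < +oo -> mu Z = 0.
Proof.
move=> g0 mg mZ gZ Ig.
have le (n : nat) : n%:R%:E * mu Z <= \int[mu]_y g y.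
  have -> : n%:R%:E * mu Z = \int[mu]_y (n%:R%:E * (\1_Z y)%:E).
    rewrite ge0_integralZl_EFin//.
    - by rewrite integral_indic// setIT.
    - by apply/measurable_EFinP; exact: measurable_indic.
  apply: ge0_le_integral => //.
  - apply: emeasurable_funM => //; apply/measurable_EFinP.
    exact: measurable_indic.
  - move=> y _; rewrite indicE; have [/set_mem/gZ ->|_] := boolP (y \in Z).
      by rewrite leey.
    by rewrite mule0.
have : mu Z \is a fin_num by exact: prob_fin.
have : 0 <= mu Z by exact: measure_ge0.
have I0 : 0 <= \int[mu]_y g y by exact: integral_ge0.
move: le Ig I0; case: (\int[mu]_y g y) => // s le _ _.
case: (mu Z) le => // p le p0 _; congr EFin; apply: le_anti.
rewrite -[X in _ && X]lee_fin p0 andbT leNgt; apply/negP => p1.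
have s0 : (0 <= s)%R by have := le 0%N; rewrite mul0e lee_fin.
have := le (Num.bound (s / p)); rewrite -EFinM lee_fin leNgt => /negP; apply.
rewrite -ltr_pdivrMr//; apply: archi_boundP.
by rewrite divr_ge0// ltW.
Qed.

Lemma prob_bigcap1 mu (F : nat -> set Y) :
  (forall n, measurable (F n : set (borel y0))) -> (forall n, mu (F n) = 1) ->
  mu (\bigcap_n F n) = 1.
Proof.
move=> mF F1; have mI : measurable (\bigcap_n F n : set (borel y0)).
  exact: bigcap_measurable.
have N : mu.-negligible (~` \bigcap_n F n).
  rewrite setC_bigcap; apply: negligible_bigcup => n.
  apply/negligibleP; first exact: measurableC.
  have E : mu (~` F n) = 0 by rewrite (prob_setC mu (mF n)) F1 subee.
  exact: E.
have : mu (~` \bigcap_n F n) = 0.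
  by apply/negligibleP => //; exact: measurableC.
rewrite (prob_setC mu mI); have := prob_fin mu mI.
by case: (mu _) => // p _ [] /eqP; rewrite subr_eq0 => /eqP <-.
Qed.

(** The zero set is null, hence has open neighbourhoods [U (t n)] of measure at most [2^-(n+1)]. The
    sum [g] of their indicators is infinite on the zero set, has integral at most 1, and is lower
    semicontinuous as an increasing limit of such functions. *)
Lemma integrable_blowup mu (v : Y -> R) : continuous v ->
  (forall y, 0 <= v y)%R -> mu [set y | v y = 0%R] = 0 ->
  exists g : Y -> \bar R, [/\ forall y, 0 <= g y, lower_semicontinuous g,
    forall y, v y = 0%R -> g y = +oo & \int[mu]_y g y < +oo].
Proof.
move=> cv v0 Z0; pose U (t : nat) : set Y := [set y | (v y < t.+1%:R^-1)%R].
have oU t : open (U t).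
  by apply: (@open_comp _ _ v [set x | (x < t.+1%:R^-1)%R]) => [y _|];
    [exact: cv|exact: open_lt].
have mU t : measurable (U t : set (borel y0)) by exact: open_borel.
have leU s t : (s <= t)%N -> U t `<=` U s.
  move=> st y; rewrite /U /= => /lt_le_trans; apply.
  by rewrite lef_pV2 ?posrE// ler_nat ltnS.
have cU : mu (U t) @[t --> \oo] --> 0.
  rewrite -Z0 (_ : [set y | v y = 0%R] = \bigcap_t U t).
    apply: nonincreasing_cvg_mu => //.
    - by rewrite -ge0_fin_numE ?measure_ge0//; exact: prob_fin.
    - exact: bigcap_measurable.
    - by move=> s t st; apply/subsetPset; exact: leU.
  apply/seteqP; split=> y; first by move=> vy t _; rewrite /U /= vy.
  move=> H; apply: le_anti; rewrite v0 andbT; apply/ler_addgt0Pr => e e0.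
  rewrite add0r; have := H (Num.bound e^-1) I; rewrite /U /= => /ltW/le_trans; apply.
  rewrite -[leRHS]invrK lef_pV2 ?posrE ?invr_gt0//.
  have /ltW/le_trans : (e^-1 < (Num.bound e^-1)%:R)%R.
    by apply: archi_boundP; rewrite invr_ge0 ltW.
  by apply; rewrite ler_nat.
have /choice[t Ht] n : exists t, mu (U t) <= (1 / (2 ^ n.+1)%:R)%:E.
  have e0 : (0 < 1 / (2 ^ n.+1)%:R :> R)%R by rewrite divr_gt0// ltr0n expn_gt0.
  have /fine_cvgP[_ /cvgr0_norm_lt/(_ _ e0)[t _ Ht]] := cU.
  exists t; have := Ht t (leqnn t); rewrite /= ger0_norm ?fine_ge0// => /ltW.
  by rewrite -lee_fin fineK// prob_fin.
pose g y : \bar R := \sum_(n <oo) (\1_(U (t n)) y)%:E.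
have i0 n y : 0 <= (\1_(U (t n)) y : R)%:E by rewrite lee_fin.
exists g; split.
- by move=> y; apply: nneseries_ge0.
- apply/lower_semicontinuousP => s.
  rewrite (_ : mkset _ = \bigcup_N
      [set y | s%:E < \sum_(n < N) (\1_(U (t n)) y)%:E]).
    apply: bigcup_open => N _; elim: N s => [|N IH] s.
      have [s0|s0] := ltP s 0%R.
        rewrite (_ : mkset _ = setT); first exact: openT.
        by apply/seteqP; split=> // y _; rewrite /= big_ord0.
      rewrite (_ : mkset _ = set0); first exact: open0.
      by apply/seteqP; split=> // y; rewrite /= big_ord0 lte_fin ltNge s0.
    rewrite (_ : mkset _ = [set y | s%:E < \sum_(n < N) (\1_(U (t n)) y)%:E] `|`
      ([set y | (s - 1)%:E < \sum_(n < N) (\1_(U (t n)) y)%:E] `&` U (t N))).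
      by apply: openU; [exact: IH|apply: openI; [exact: IH|exact: oU]].
    apply/seteqP; split=> y /=; rewrite big_ord_recr/= indicE.
      have [/set_mem Uy|nUy] := boolP (y \in U (t N)).
        by rewrite EFinB lteBlDr// => h; right.
      by rewrite adde0; left.
    move=> [h|[h Uy]].
      by apply: lt_le_trans h _; rewrite leeDl// lee_fin.
    by rewrite mem_set// -lteBlDr// -EFinB.
  apply/seteqP; split=> y /=.
    move=> sg; apply: contrapT => nx; move: sg; rewrite ltNge => /negP; apply.
    apply: lime_le; first by apply: is_cvg_nneseries => n _ _; exact: i0.
    apply: nearW => N; rewrite big_mkord leNgt; apply/negP => h.
    by apply: nx; exists N.
  move=> [N _ /= h]; apply: lt_le_trans h _.
  rewrite -(big_mkord xpredT (fun n => (\1_(U (t n)) y)%:E)).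
  exact: nneseries_lim_ge.
- move=> y vy; have i1 n : (\1_(U (t n)) y : R) = 1%R.
    by rewrite indicE mem_set//= /U /= vy.
  apply/eqP; rewrite -leye_eq leNgt; apply/negP => gy.
  have g0 : 0 <= g y by apply: nneseries_ge0.
  have [s sE] : exists s : R, g y = s%:E.
    by move: gy g0; case: (g y) => // s _ _; exists s.
  have : (Num.bound `|s|)%:R%:E <= g y.
    apply: le_trans (nneseries_lim_ge (Num.bound `|s|) _) => //.
    under eq_bigr do rewrite i1.
    by rewrite big_mkord sumEFin sumr_const card_ord.
  rewrite sE lee_fin leNgt => /negP; apply.
  by apply: le_lt_trans (ler_norm s) _; exact: archi_boundP.
- rewrite integral_nneseries//; last first.
    by move=> n; apply/measurable_EFinP; exact: measurable_indic.
  apply: le_lt_trans (ltry 1); apply: le_trans (epsilon_trick0 xpredT (@ler01 R)).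
  apply: lee_nneseries => n _; first by move=> _; exact: integral_ge0.
  by rewrite integral_indic// setIT; exact: Ht.
Qed.

End NullSets.

Lemma essential_domain_sub {X : choiceType} (D D' : set X) (phi : X -> X) :
  D' `<=` D -> essential_domain D' phi `<=` essential_domain D phi.
Proof.
move=> sub; have dom n : iter_dom D' phi n `<=` iter_dom D phi n.
  by elim: n => [//|n IH] x [D'x dx]; split; [exact: sub|exact: IH].
move=> x /essential_domainP H; apply/essential_domainP => n.
have [d [y dy yx]] := H n; split; first exact: dom.
by exists y => //; exact: dom.
Qed.

(** * Invariant measures on the essential domain *)

Section EssentialMeasures.
Context {R : realType} {A : comBanachAlgType R[i]}.
Hypothesis uniformA : uniform_algebra A.
Context (alpha : A -> A) (Delta : set (gelfand_spectrum A))
  (phi : gelfand_spectrum A -> gelfand_spectrum A) (a : A).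
Hypotheses (endo_alpha : algebra_endomorphism alpha)
  (dual_phi : dual_partial_system alpha Delta phi).

Local Notation X := (gelfand_spectrum A).
Local Notation r := (op_spectral_radius (weighted_endo a alpha)).
Local Notation u := (fun x : X => cmod (gelfand a x)).
Local Notation c := (ln (1 + rnorm a)).
Local Open Scope ereal_scope.

Let Delta_clopen : clopen Delta.
Proof. by have [] := dual_phi. Qed.

Let phi_cont : {within Delta, continuous phi}.
Proof. by have [] := dual_phi. Qed.

(** Adding 1 to the norm in [c] makes the logarithm meaningful also for [a = 0]. *)
Lemma cmod_gelfand_exp (x : X) : (0 <= u x <= expR c)%R.
Proof.
rewrite cmod_ge0 lnK ?posrE; last first.
  by rewrite ltr_wpDr// rnorm_ge0.
by apply: le_trans (gelfand_bound a x) _; rewrite lerDr.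
Qed.

Section OneDomain.
Context (D : set X) (D_sub : D `<=` Delta).
Local Notation E := (essential_domain D phi).
Local Notation T := (essential_map D phi).
Local Notation v := (fun x : E => cmod (gelfand a (set_val x))).

Lemma essential_map_val n (x : E) : set_val (iter n T x) = iter n phi (set_val x).
Proof. by elim: n => [//|n IH] /=; rewrite -IH. Qed.

Lemma essential_domain_dom n (x : E) : iter_dom Delta phi n (set_val x).
Proof.
have /(essential_domain_sub D_sub) := set_valP x.
by move=> /essential_domainP /(_ n) [].
Qed.

Lemma essential_map_continuous : continuous T.
Proof.
move=> x B /nbhs_set_type[W [oW Wx WB]].
have [Dx _] := essential_domain_dom 1 x.
have cphi := phi_continuous_at Delta_clopen phi_cont Dx.
have nW : nbhs (phi (set_val x)) W by exact: open_nbhs_nbhs.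
have N := @set_val_continuous X E x _ (cphi _ nW).
by apply: (@filterS _ (nbhs x) (nbhs_filter x) _ _ _ N) => y Wy; exact: WB.
Qed.

Lemma essential_weight_continuous : continuous v.
Proof.
move=> x; exact: (@continuous_comp E X R set_val u x
  (@set_val_continuous X E x) (@cmod_gelfand_continuous R A a _)).
Qed.

Lemma essential_weight_bound (x : E) : (0 <= v x <= expR c)%R.
Proof. exact: cmod_gelfand_exp. Qed.

Lemma essential_orbit_prod n (x : E) :
  orbit_prod T v n x = orbit_prod phi u n (set_val x).
Proof. by apply: eq_bigr => i _; rewrite essential_map_val. Qed.

(** For every [l > r], some [P (2^k)] is bounded by [l^(2^k)], and invariance turns this into a
    bound on the integral. The argument rests on continuity and invariance, so it covers the
    possibly noncompact essential domain of the restricted map. *)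
Lemma exp_int_ln_le (x0 : E) mu : invariant_measures R x0 T mu ->
  exp_int_ln (gelfand a) mu <= r.
Proof.
move=> imu.
have fr := spectral_radius_fin uniformA a endo_alpha dual_phi.
have r0 := spectral_radius_ge0 uniformA a endo_alpha dual_phi.
apply/lee_addgt0Pr => e e0.
pose l := (fine r + e)%R; have l0 : (0 < l)%R by rewrite ltr_wpDl// fine_ge0.
have rl : r < l%:E by rewrite -{1}(fineK fr) lte_fin ltrDl.
have [k Hk] := spectral_radius_gt uniformA endo_alpha dual_phi rl.
have -> : r + e%:E = l%:E by rewrite EFinD fineK.
have -> : l%:E = expeR (ln l)%:E by rewrite /= lnK.
rewrite lee_expeR; apply: (@invariant_integral_lne_le R E x0 v c
  essential_weight_continuous essential_weight_bound T essential_map_continuous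
  mu l (2 ^ k)%N imu) => //; first by rewrite expn_gt0.
move=> x; rewrite essential_orbit_prod; apply: (Hk k (leqnn _)).
exact: essential_domain_dom.
Qed.

End OneDomain.

Local Notation K := (essential_domain Delta phi).
Local Notation TK := (essential_map Delta phi).
Local Notation vK := (fun x : K => cmod (gelfand a (set_val x))).

Lemma essential_compact : compact [set: K].
Proof.
apply: set_type_compact; apply: (compact_closed_setT compact_gelfand).
exact: (essential_domain_closed gelfand_hausdorff compact_gelfand
  Delta_clopen phi_cont).
Qed.

Lemma essential_hausdorff (D : set X) : hausdorff_space (essential_domain D phi).
Proof. by apply: set_type_hausdorff; exact: gelfand_hausdorff. Qed.

(** An orbit realizing [r] carries an invariant measure whose defect has integral at most
    [c - ln r], and an ergodic minimizer does no worse. For [r = 0] the inequality is trivial and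
    the existence of some invariant measure is all that matters. *)
Lemma ergodic_maximizer (x0 : K) : exists mu,
  ergodic_measures R x0 TK mu /\ r <= exp_int_ln (gelfand a) mu.
Proof.
have cT := essential_map_continuous (@subset_refl _ Delta).
have cv := @essential_weight_continuous Delta.
have bv := @essential_weight_bound Delta.
have fr := spectral_radius_fin uniformA a endo_alpha dual_phi.
have r0 := spectral_radius_ge0 uniformA a endo_alpha dual_phi.
have d0 := log_defect_ge0 bv; have dlsc := log_defect_lsc cv bv.
have [nu [inu nuI]] : exists nu, invariant_measures R x0 TK nu /\
    (0 < r -> \int[nu]_x log_defect vK c x <= (c - ln (fine r))%:E).
  have [rE|r1] := eqVneq r 0.
    have [nu inu] := @exists_invariant_measure R K x0 TK
      (@essential_hausdorff Delta) essential_compact cT.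
    by exists nu; split => //; rewrite rE ltxx.
  have r2 : 0 < r by rewrite lt_neqAle eq_sym r1.
  have fr0 : (0 < fine r)%R by rewrite -lte_fin fineK.
  have [y Ky Py] := spectral_radius_orbit uniformA endo_alpha dual_phi r2.
  pose y' : K := exist _ y (mem_set Ky).
  have [|nu [inu nuI]] := @exists_orbit_measure R K x0 TK
    (@essential_hausdorff Delta) essential_compact cT y' (log_defect vK c)
    (c - ln (fine r)) d0 dlsc; last by exists nu.
  move=> n; apply: (log_defect_sum_le bv fr0).
  by rewrite essential_orbit_prod; exact: Py.
have [mu [emu mumin]] := ergodic_minimizer (@essential_hausdorff Delta)
  essential_compact cT d0 dlsc (ex_intro _ nu inu).
exists mu; split => //.
have [rE|r1] := eqVneq r 0; first by rewrite rE; exact: expeR_ge0.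
have r2 : 0 < r by rewrite lt_neqAle eq_sym r1.
have fr0 : (0 < fine r)%R by rewrite -lte_fin fineK.
rewrite -(fineK fr) -[X in X%:E](lnK _) ?posrE//.
rewrite -[leLHS]/(expeR (ln (fine r))%:E) lee_expeR.
rewrite (integral_lne cv bv); have := le_trans (mumin _ inu) (nuI r2).
have : 0 <= \int[mu]_x log_defect vK c x by exact: integral_ge0.
case: (\int[mu]_x log_defect vK c x) => //= s _.
by rewrite !lee_fin; lra.
Qed.

Local Notation Delta' := (Delta `&` [set x | gelfand a x != 0%R]).
Local Notation E' := (essential_domain Delta' phi).
Local Notation TE := (essential_map Delta' phi).

Lemma Delta'_sub : Delta' `<=` Delta. Proof. by move=> x []. Qed.

Definition essential_incl (x : E') : K :=
  exist _ (set_val x) (mem_set (essential_domain_sub Delta'_sub (set_valP x))).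

Lemma essential_incl_inj : injective essential_incl.
Proof. by move=> x y /(congr1 set_val)/= xy; exact: val_inj. Qed.

Lemma essential_incl_continuous : continuous essential_incl.
Proof.
move=> x B /nbhs_set_type[W [oW Wx WB]].
have N := @set_val_continuous X E' x W (open_nbhs_nbhs (conj oW Wx)).
by apply: (@filterS _ (nbhs x) (nbhs_filter x) _ _ _ N) => y Wy; exact: WB.
Qed.

Lemma essential_incl_emb (x : E') (B : set E') : nbhs x B ->
  exists W : set K, [/\ open W, W (essential_incl x) & essential_incl @^-1` W `<=` B].
Proof.
move=> /nbhs_set_type[W [oW Wx WB]]; exists (set_val @^-1` W); split => //.
by apply: open_comp => // y _; exact: set_val_continuous.
Qed.

Lemma essential_incl_map (x : E') : essential_incl (TE x) = TK (essential_incl x).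
Proof. exact: val_inj. Qed.

Lemma iter_dom_nonzero n x : iter_dom Delta' phi n x <->
  iter_dom Delta phi n x /\ (0 < orbit_prod phi u n x)%R.
Proof.
elim: n x => [|n IH] x; first by rewrite /orbit_prod big_ord0; split.
have E : orbit_prod phi u n.+1 x = (u x * orbit_prod phi u n (phi x))%R.
  by rewrite -[n.+1]/(1 + n)%N orbit_prodD /orbit_prod big_ord1.
rewrite E; split.
  move=> [[Dx ux] /IH [dx Px]]; split; first by split.
  by rewrite mulr_gt0// cmod_gt0.
move=> [[Dx dx]]; have [u0|u0] := eqVneq (gelfand a x) 0%R.
  by rewrite u0 cmod0 mul0r ltxx.
by rewrite pmulr_rgt0 ?cmod_gt0// => Px; split; [split|apply/IH].
Qed.

(** The set [S n] of points whose first [n] iterates avoid the zeros has full measure, by invariance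
    and induction. The set [I n] of points reached by [n] nonzero steps is Borel as a countable
    union of traces of compact images, those of the closed sets where [P n >= 1 / (k + 1)]; its
    preimage under the [n]-th iterate contains [S n], so it has full measure too. *)
Lemma range_essential_incl (x0 : K) mu : invariant_measures R x0 TK mu ->
  mu [set x : K | vK x = 0%R] = 0 ->
  measurable (range essential_incl : set (borel x0)) /\
  mu (range essential_incl) = 1.
Proof.
move=> imu Z0; have [rmu inv] := imu.
have cT := essential_map_continuous (@subset_refl _ Delta).
have cv := @essential_weight_continuous Delta.
pose Z : set K := [set x : K | vK x = 0%R].
have mZ : measurable (Z : set (borel x0)).
  apply: closed_borel; rewrite (_ : Z = vK @^-1` [set 0%R])//.
  by apply: closed_comp; [move=> x _; exact: cv|exact: closed_eq].
have mZc : measurable (~` Z : set (borel x0)) by exact: measurableC.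
have muZc : mu (~` Z) = 1 by rewrite (prob_setC mu mZ) Z0 sube0.
pose S n : set K := [set x : K | iter_dom Delta' phi n (set_val x)].
have SS n : S n.+1 = TK @^-1` S n `&` ~` Z.
  apply/seteqP; split=> x /=.
    move=> [[Dx ux] dx]; split => // /eqP; rewrite cmod_eq0; exact/negP.
  move=> [dx nz]; split => //; split.
    by have [] := essential_domain_dom (@subset_refl _ Delta) 1 x.
  by apply/negP => /eqP ux; apply: nz; rewrite /Z /= ux cmod0.
have [mS muS] : (forall n, measurable (S n : set (borel x0))) /\
    (forall n, mu (S n) = 1).
  suff H n : measurable (S n : set (borel x0)) /\ mu (S n) = 1.
    by split => n; have [] := H n.
  elim: n => [|n [mSn muSn]].
    rewrite (_ : S 0%N = setT); last by apply/seteqP; split.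
    by split; [exact: measurableT|exact: probability_setT].
  have mTS := continuous_borel x0 cT mSn.
  rewrite SS; split; first exact: measurableI.
  by rewrite (prob_setI1 mTS mZc muZc) inv.
pose I n : set K := [set x : K | iter_image Delta' phi n (set_val x)].
pose C n k : set X := iter n phi @` (iter_dom Delta phi n `&`
  orbit_prod phi u n @^-1` [set t | (k.+1%:R^-1 <= t)%R]).
have clC n k : closed (C n k).
  apply: (compact_closed gelfand_hausdorff); apply: continuous_compact.
    apply: continuous_in_subspaceT => x /set_mem [dx _].
    exact: (iter_phi_continuous_at Delta_clopen phi_cont).
  apply: (compact_closed_setT compact_gelfand).
  apply: closed_preimage_at; last exact: closed_ge.
    exact: (iter_dom_closed Delta_clopen phi_cont).
  move=> x dx; apply: (orbit_prod_continuous_at Delta_clopen phi_cont) => //.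
  exact: cmod_gelfand_continuous.
have IE n : I n = \bigcup_k (set_val @^-1` C n k).
  apply/seteqP; split=> x.
    move=> [y /iter_dom_nonzero [dy Py] yx].
    have := archi_boundP (ltW (_ : (0 < (orbit_prod phi u n y)^-1)%R)).
    rewrite invr_gt0 => /(_ Py) b; set N := Num.bound _ in b.
    exists N => //; exists y => //; split => //=.
    rewrite -[leRHS]invrK lef_pV2 ?posrE ?invr_gt0//.
    by apply: le_trans (ltW b) _; rewrite ler_nat.
  move=> [k _ [y [dy Py] yx]]; exists y => //; apply/iter_dom_nonzero; split => //.
  by apply: lt_le_trans Py; rewrite invr_gt0.
have mI n : measurable (I n : set (borel x0)).
  rewrite IE; apply: bigcup_measurable => k _; apply: closed_borel.
  by apply: closed_comp => // x _; exact: set_val_continuous.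
have muI n : mu (I n) = 1.
  apply: le_anti; rewrite probability_le1//= -(muS n) -(invariant_iter cT n imu (mI n)).
  apply: le_measure; rewrite ?inE//.
    exact: (continuous_borel x0 (@iter_continuous _ _ cT n) (mI n)).
  move=> x dx; rewrite /I /preimage /= essential_map_val.
  by exists (set_val x).
have rE : range essential_incl = \bigcap_n (S n `&` I n).
  apply/seteqP; split=> x.
    by move=> [y _ <-] n _; have /essential_domainP := set_valP y; exact.
  move=> H; have Ex : E' (set_val x) by apply/essential_domainP => n; exact: H.
  by exists (exist _ (set_val x) (mem_set Ex)) => //; exact: val_inj.
rewrite rE; split.
  by apply: bigcap_measurable => // n _; exact: measurableI.
apply: prob_bigcap1 => n; first exact: measurableI.
by rewrite (prob_setI1 (mS n) (mI n) (muI n)).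
Qed.

Lemma exp_int_ln_gt0_null (x0 : K) (mu : probability (borel x0) R) :
  0 < exp_int_ln (gelfand a) mu -> mu [set x : K | vK x = 0%R] = 0.
Proof.
have cv := @essential_weight_continuous Delta.
have bv := @essential_weight_bound Delta.
move=> e0; apply: (@integral_lty_null R K x0 mu (log_defect vK c)).
- exact: log_defect_ge0.
- exact: log_defect_measurable.
- apply: closed_borel; rewrite (_ : mkset _ = vK @^-1` [set 0%R])//.
  by apply: closed_comp; [move=> x _; exact: cv|exact: closed_eq].
- by move=> x; exact: log_defect0.
move: e0; rewrite /exp_int_ln (integral_lne cv bv) ltNge => e0.
by rewrite ltey; apply: contra e0 => /eqP ->.
Qed.

Lemma restricted_ergodic (x0 : K) (z0 : E') mu : ergodic_measures R x0 TK mu ->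
  mu [set x : K | vK x = 0%R] = 0 ->
  exists nu, ergodic_measures R z0 TE nu /\
    exp_int_ln (gelfand a) nu = exp_int_ln (gelfand a) mu.
Proof.
move=> emu Z0; have [imu _] := emu.
have [mj muj] := range_essential_incl imu Z0.
have cT := essential_map_continuous (@subset_refl _ Delta).
have [nu [enu nuE]] := @restricted_ergodic_measure R K E' x0 z0 essential_incl
  (@essential_hausdorff Delta) (@essential_hausdorff Delta')
  essential_incl_inj essential_incl_emb TK TE cT essential_incl_map mu mj muj
  emu.
exists nu; split => //.
have cv := @essential_weight_continuous Delta.
have bv := @essential_weight_bound Delta.
have cv' := @essential_weight_continuous Delta'.
have bv' := @essential_weight_bound Delta'.
rewrite /exp_int_ln (integral_lne cv bv) (integral_lne cv' bv').
congr (expeR (_ - _)); apply/esym.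
apply: (ge0_integral_image essential_incl_continuous nuE).
  exact: log_defect_ge0.
exact: log_defect_measurable.
Qed.

(** Needed for [r = 0], when a maximizer may charge the zeros. The image of [nu] does not charge
    them; a function infinite there and integrable for this image has an ergodic minimizer on the
    compact [K], whose integral is again finite, so that it does not charge them either. *)
Lemma ergodic_nonzero (x0 : K) (z0 : E') nu : invariant_measures R z0 TE nu ->
  exists mu, ergodic_measures R x0 TK mu /\ mu [set x : K | vK x = 0%R] = 0.
Proof.
move=> inu.
have cT := essential_map_continuous (@subset_refl _ Delta).
have cv := @essential_weight_continuous Delta.
have [mu [imu muE]] := @image_invariant_measure R K E' x0 z0 essential_incl
  (@essential_hausdorff Delta) (@essential_hausdorff Delta')
  essential_incl_continuous essential_incl_inj TK TE cT essential_incl_map nu inu.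
have mZ : measurable ([set x : K | vK x = 0%R] : set (borel x0)).
  apply: closed_borel; rewrite (_ : mkset _ = vK @^-1` [set 0%R])//.
  by apply: closed_comp; [move=> x _; exact: cv|exact: closed_eq].
have muZ : mu [set x : K | vK x = 0%R] = 0.
  rewrite muE// (_ : _ @^-1` _ = set0) ?measure0//.
  apply/seteqP; split=> // x /= /eqP; rewrite cmod_eq0 => /eqP ax.
  have /essential_domainP/(_ 1%N) [[[_ /negP ux] _] _] := set_valP x.
  by apply: ux; rewrite ax.
have [|g [g0 lg gZ Ig]] := integrable_blowup cv _ muZ.
  by move=> x; exact: cmod_ge0.
have [mu' [emu' min']] := ergodic_minimizer (@essential_hausdorff Delta)
  essential_compact cT g0 lg (ex_intro _ mu imu).
exists mu'; split => //.
apply: (integral_lty_null g0 (lsc_measurable x0 lg) mZ gZ).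
exact: le_lt_trans (min' _ imu) Ig.
Qed.

End EssentialMeasures.

(** * The variational formula for the spectral radius *)

Theorem theorem5p1 (R : realType) (A : comBanachAlgType R[i])
    (uniformA : uniform_algebra A)
    (alpha : A -> A) (endo_alpha : algebra_endomorphism alpha)
    (Delta : set (gelfand_spectrum A))
    (phi : gelfand_spectrum A -> gelfand_spectrum A)
    (dual_phi : dual_partial_system alpha Delta phi)
    (a : A) :
  let r := op_spectral_radius (weighted_endo a alpha) in
  let Delta' := Delta `&` [set x | gelfand a x != 0] in
  [/\ essential_domain Delta phi = set0 -> r = 0%E,
      forall x0 : essential_domain Delta phi,
        let T := essential_map Delta phi in
        is_max [set exp_int_ln (gelfand a) mu |
                 mu in invariant_measures R x0 T] r /\
        is_max [set exp_int_ln (gelfand a) mu |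
                 mu in ergodic_measures R x0 T] r,
      essential_domain Delta' phi = set0 -> r = 0%E
    & forall x0 : essential_domain Delta' phi,
        let T := essential_map Delta' phi in
        (invariant_measures R x0 T = set0 -> r = 0%E) /\
        (invariant_measures R x0 T !=set0 ->
          is_max [set exp_int_ln (gelfand a) mu |
                 mu in invariant_measures R x0 T] r /\
          is_max [set exp_int_ln (gelfand a) mu |
                 mu in ergodic_measures R x0 T] r)].
Proof.
move=> r Delta'.
have r0 : (0 <= r)%E := spectral_radius_ge0 uniformA a endo_alpha dual_phi.
have r_gt0 : r <> 0%E -> (0 < r)%E.
  by move=> /eqP rn0; rewrite lt_neqAle eq_sym rn0.
have pointK : r <> 0%E -> exists y, essential_domain Delta phi y.
  move=> /r_gt0 rp.
  by have [y Ky _] := spectral_radius_orbit uniformA endo_alpha dual_phi rp; exists y.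
have subDelta' : Delta' `<=` Delta by move=> x [].
(* The upper bound holds for all invariant measures, so one ergodic measure reaching [r] settles
   both maxima. *)
have is_max_of (D : set (gelfand_spectrum A)) (x0 : essential_domain D phi)
    (mu : probability (borel x0) R) : D `<=` Delta ->
    ergodic_measures R x0 (essential_map D phi) mu ->
    (r <= exp_int_ln (gelfand a) mu)%E ->
    is_max [set exp_int_ln (gelfand a) nu |
      nu in invariant_measures R x0 (essential_map D phi)] r /\
    is_max [set exp_int_ln (gelfand a) nu |
      nu in ergodic_measures R x0 (essential_map D phi)] r.
  move=> sub emu rmu; have [imu _] := emu.
  have le nu : invariant_measures R x0 (essential_map D phi) nu ->
      (exp_int_ln (gelfand a) nu <= r)%E.
    exact: (exp_int_ln_le uniformA a endo_alpha dual_phi sub).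
  have murE : exp_int_ln (gelfand a) mu = r by apply: le_anti; rewrite rmu le.
  split; split; [by exists mu| |by exists mu|]; move=> _ [nu inu <-].
    exact: le.
  by apply: le; have [] := inu.
have maxK (x0 : essential_domain Delta phi) :=
  ergodic_maximizer uniformA a endo_alpha dual_phi x0.
have nullZ (x0 : essential_domain Delta phi) (mu : probability (borel x0) R) :
    r <> 0%E -> (r <= exp_int_ln (gelfand a) mu)%E ->
    mu [set x : essential_domain Delta phi |
      cmod (gelfand a (set_val x)) = 0] = 0%E.
  by move=> /r_gt0 rp rmu; apply: exp_int_ln_gt0_null; exact: lt_le_trans rmu.
split.
- move=> K0; apply: contrapT => /pointK[y]; by rewrite K0.
- move=> x0 T; have [mu [emu rmu]] := maxK x0.
  exact: is_max_of emu rmu.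
- move=> E0; have noE y : ~ essential_domain Delta' phi y by rewrite E0.
  apply: contrapT => rn0.
  have [y Ky] := pointK rn0.
  pose x0 : essential_domain Delta phi := exist _ y (mem_set Ky).
  have [mu [[imu _] rmu]] := maxK x0.
  (* For [r] nonzero the maximizer gives mass 1 to the image of the restricted essential domain,
     which cannot be empty. *)
  have [_] := range_essential_incl dual_phi imu (nullZ x0 mu rn0 rmu).
  rewrite (_ : range _ = set0) ?measure0; last first.
    apply/seteqP; split=> // x [z _ _].
    exact: (noE _ (set_valP z)).
  by move/eqP; rewrite eq_sym onee_eq0.
- move=> z0 T.
  pose x0 : essential_domain Delta phi :=
    exist _ (set_val z0) (mem_set (essential_domain_sub subDelta' (set_valP z0))).
  have maxE : r <> 0%E -> exists nu, ergodic_measures R z0 T nu /\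
      (r <= exp_int_ln (gelfand a) nu)%E.
    move=> rn0; have [mu [emu rmu]] := maxK x0.
    have [nu [enu nuE]] := restricted_ergodic dual_phi z0 emu (nullZ x0 mu rn0 rmu).
    by exists nu; rewrite nuE.
  split.
    move=> inv0; apply: contrapT => /maxE[nu [[inu _] _]].
    by rewrite inv0 in inu.
  move=> [nu inu]; have [rE|/eqP rn0] := eqVneq r 0%E; last first.
    have [mu [emu rmu]] := maxE rn0; exact: is_max_of emu rmu.
  (* For [r = 0] every ergodic measure reaches the maximum, exponentials being nonnegative; what
     remains is to find one on the restricted domain. *)
  have [mu [emu muZ]] := ergodic_nonzero dual_phi x0 inu.
  have [nu' [enu' _]] := restricted_ergodic dual_phi z0 emu muZ.
  by apply: is_max_of enu' _ => //; rewrite rE; exact: expeR_ge0.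
Qed.
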